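(* Let $\tfrac12\le s<1$, $0<h\le\infty$ and $\beta\in\mathbb R$. There exists $r>0$ such that for any $A,T>0$ there exists $B>0$ such that every global solution $u\in C(\mathbb R;H^\infty(\mathbb T))$ of $$\partial_tu+i\partial_x^2u=2\beta u\,\Pi_{+,h}\partial_x(|u|^2)$$ with $\|u(0)\|_{L^2}\le r$ and $\|u(0)\|_{H^s}\le A$ satisfies $\sup_{|t|\le T}\|u(t)\|_{H^s}\le B$. Moreover $r$ and $B$ can be chosen uniformly for $1\le h\le\infty$.
   Context: $\mathbb{T}=\mathbb{R}/(2\pi\mathbb{Z})$. $\mathcal T_h$ ($h<\infty$) is the Fourier multiplier with symbol $-i\coth(h\xi)$ for $\xi\ne0$ and $0$ at $\xi=0$; $\mathcal T_\infty$ is the Hilbert transform; $\Pi_{+,h}=\frac12(1+i\mathcal T_h)$. The displayed equation is INLS $\partial_tu+i\partial_x^2u=\beta u(1+i\mathcal T_h)\partial_x(|u|^2)$ with $\gamma=0$. *)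

(* Defs.v *)
From Stdlib Require Import Reals ZArith.
From Coquelicot Require Import Coquelicot.
Open Scope R_scope.

Definition cexpi (y : R) : C := (cos y, sin y).

(* Total derivative of a complex-valued function of a real variable,
   taken componentwise (correct whenever the function is differentiable). *)
Definition CDerive (f : R -> C) (x : R) : C :=
  (Derive (fun y => fst (f y)) x, Derive (fun y => snd (f y)) x).

Definition ex_CDerive (f : R -> C) (x : R) : Prop :=
  ex_derive (fun y => fst (f y)) x /\ ex_derive (fun y => snd (f y)) x.

Fixpoint CDerive_n (n : nat) (f : R -> C) : R -> C :=
  match n with O => f | S m => CDerive (CDerive_n m f) end.

(* 2pi-periodic function, i.e. a function on T = R/(2 pi Z) *)
Definition periodic (f : R -> C) : Prop := forall x, f (x + 2 * PI) = f x.

Definition smooth (f : R -> C) : Prop := forall n x, ex_CDerive (CDerive_n n f) x.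

(* Fourier coefficient  \hat f(k) = (1/2pi) \int_0^{2pi} f(x) e^{-ikx} dx *)
Definition fcoef (f : R -> C) (k : Z) : C :=
  let kk := IZR k in
  (/ (2 * PI) * RInt (fun x => fst (f x) * cos (kk * x) + snd (f x) * sin (kk * x)) 0 (2 * PI),
   / (2 * PI) * RInt (fun x => snd (f x) * cos (kk * x) - fst (f x) * sin (kk * x)) 0 (2 * PI)).

Definition ZSeriesR (a : Z -> R) : R :=
  Series (fun n : nat => a (Z.of_nat n) + a (- Z.of_nat n - 1)%Z).
Definition ZSeriesC (a : Z -> C) : C :=
  (ZSeriesR (fun k => fst (a k)), ZSeriesR (fun k => snd (a k))).

Definition L2norm (f : R -> C) : R :=
  sqrt (RInt (fun x => (Cmod (f x)) ^ 2) 0 (2 * PI)).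

Definition Hsnorm (s : R) (f : R -> C) : R :=
  sqrt (ZSeriesR (fun k => Rpower (1 + (IZR k) ^ 2) s * (Cmod (fcoef f k)) ^ 2)).

Definition coth (y : R) : R := cosh y / sinh y.

(* Symbol of i T_h : coth(h k) for k <> 0 (h finite), sgn k for h = oo
   (T_oo = Hilbert transform, symbol -i sgn k), and 0 at k = 0. *)
Definition iTh_symbol (h : Rbar) (k : Z) : R :=
  if Z.eqb k 0 then 0 else
  match h with
  | Finite h0 => coth (h0 * IZR k)
  | p_infty => IZR (Z.sgn k)
  | m_infty => 0
  end.

Definition Piplus (h : Rbar) (g : R -> C) (x : R) : C :=
  ZSeriesC (fun k => Cmult (RtoC ((1 + iTh_symbol h k) / 2))
                           (Cmult (fcoef g k) (cexpi (IZR k * x)))).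

Definition C_Hinf (u : R -> R -> C) : Prop :=
  (forall t, periodic (u t) /\ smooth (u t)) /\
  (forall (N : nat) (t0 eps : R), 0 < eps ->
     exists delta, 0 < delta /\ forall t, Rabs (t - t0) < delta ->
       Hsnorm (INR N) (fun x => Cminus (u t x) (u t0 x)) < eps).

Definition solves_INLS (h : Rbar) (beta : R) (u : R -> R -> C) : Prop :=
  forall t x,
    ex_CDerive (fun tau => u tau x) t /\
    CDerive (fun tau => u tau x) t =
      Cplus (Cmult (0, -1) (CDerive_n 2 (u t) x))
            (Cmult (RtoC (2 * beta))
               (Cmult (u t x)
                  (Piplus h (fun y => RtoC (Derive (fun z => (Cmod (u t z)) ^ 2) y)) x))).

(* Main.v *)
Require Import Defs.
From Stdlib Require Import Reals ZArith Lra Lia Psatz List.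
From Stdlib Require Import FunctionalExtensionality ProofIrrelevance IndefiniteDescription.
From Coquelicot Require Import Coquelicot.
Open Scope R_scope.

(* On the Fourier side the equation reads u_t = B u + i V u, where
   B = i D^2 + 2 i beta u P D conj(u), D = -i d/dx, P is the projection onto nonnegative frequencies
   and V is the smooth real potential produced by the exponentially small difference between coth(h k)
   and sgn k.  The self-adjoint operator L = D + beta u P conj(u) satisfies
   L_t = [B + i V, L] + i (D V): a Lax pair for V = 0, up to a bounded commutator in general.
   Hence b = (L + i kappa)^(-1) u makes |L b|^2 (which is the energy of u above frequency kappa,
   seen by L) grow at most exponentially, with a rate independent of kappa, up to kappa^(-2).
   When |u|_{L^2} <= r and u lives at frequency scale N, i.e. |u|_{H^s} = N^s r, the bound
   |u P (conj(u) f)| <= C r^2 (N / mu)^(1/2) (|D f| + mu |f|) shows that for small r the operators L and D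
   see the same energy above frequencies kappa >= mu = 2^(-d) N.  Summing over dyadic kappa gives the H^s norm;
   the frequencies below mu contribute at most a small multiple of N^{2s} r^2, that is of the supremum
   of |u(t)|_{H^s}^2, which is absorbed.  This is where s >= 1/2 and the smallness of r enter. *)

(* Coquelicot states equations over the carriers of its structures; [ring] needs the type [R]. *)
Ltac real_eq := lazymatch goal with |- @eq _ ?a ?b => change (@eq R a b) end.

(** The circularity to break is that the threshold mu is fixed by the supremum of the very norm to
    be bounded, while [r] must not depend on [A] or [T]. The gap [d] between mu and N depends only
    on [s], so [r] depends only on [s] and [beta]. At time 0 the energies seen by L and by D are
    compared at the scale of the data, so the Gronwall factor exp(E T) multiplies only quantities
    controlled by [A]; the term to be absorbed comes from the masses and the comparison at the final
    time and carries no such factor. Smoothness of u makes the supremum finite beforehand.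

    The evolving quantity is |L b|^2 = |u|^2 - kappa^2 |b|^2, and kappa |b|^2 = - Im <b, u>. Hence
    only <b, u> has to be differentiated, and the second resolvent identity does this without any
    regularity of b in time: b is merely chosen at each time. *)

Lemma sum_SnR (a : nat -> R) (n : nat) : sum_n a (S n) = sum_n a n + a (S n).
Proof. exact (sum_Sn a n). Qed.

Lemma INR_lt_pow2 (n : nat) : INR n < 2 ^ n.
Proof.
  induction n; [simpl; lra|]. rewrite S_INR. simpl.
  assert (1 <= 2 ^ n) by (apply pow_R1_Rle; lra). lra.
Qed.

(** * Absolutely convergent sums over the integers *)

Definition zpair (a : Z -> R) (n : nat) : R :=
  a (Z.of_nat n) + a (- Z.of_nat n - 1)%Z.

(** Absolute convergence frees the sum from the pairing of [n] with [-n-1] built into [ZSeriesR],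
    and so makes it invariant under shifts. *)
Definition summable (a : Z -> R) : Prop := ex_series (zpair (fun k => Rabs (a k))).

Lemma ex_series_le_R (a b : nat -> R) :
  (forall n, Rabs (a n) <= b n) -> ex_series b -> ex_series a.
Proof. intros H Hb. exact (ex_series_le a b H Hb). Qed.

Lemma summable_le (a b : Z -> R) :
  (forall k, Rabs (a k) <= b k) -> summable b -> summable a.
Proof.
  intros H Hb. apply (ex_series_le_R _ (zpair (fun k => Rabs (b k)))); [|exact Hb].
  intros n. unfold zpair.
  assert (H1 := H (Z.of_nat n)). assert (H2 := H (- Z.of_nat n - 1)%Z).
  assert (H3 := Rle_abs (b (Z.of_nat n))). assert (H4 := Rle_abs (b (- Z.of_nat n - 1)%Z)).
  rewrite Rabs_pos_eq.
  - lra.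
  - assert (H5 := Rabs_pos (a (Z.of_nat n))).
    assert (H6 := Rabs_pos (a (- Z.of_nat n - 1)%Z)). lra.
Qed.

Lemma summable_ex (a : Z -> R) : summable a -> ex_series (zpair a).
Proof.
  intros H. apply (ex_series_le_R _ _ (fun n => Rabs_triang _ _) H).
Qed.

Lemma summable_plus (a b : Z -> R) :
  summable a -> summable b -> summable (fun k => a k + b k).
Proof.
  intros Ha Hb.
  apply (ex_series_le_R _ (fun n => zpair (fun k => Rabs (a k)) n + zpair (fun k => Rabs (b k)) n)).
  - intros n. unfold zpair. rewrite Rabs_pos_eq.
    + assert (H1 := Rabs_triang (a (Z.of_nat n)) (b (Z.of_nat n))).
      assert (H2 := Rabs_triang (a (- Z.of_nat n - 1)%Z) (b (- Z.of_nat n - 1)%Z)). lra.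
    + apply Rplus_le_le_0_compat; apply Rabs_pos.
  - exact (ex_series_plus _ _ Ha Hb).
Qed.

Lemma summable_scal (c : R) (a : Z -> R) : summable a -> summable (fun k => c * a k).
Proof.
  intros Ha.
  apply (ex_series_ext (fun n => Rabs c * zpair (fun k => Rabs (a k)) n)).
  - intros n. real_eq. unfold zpair. rewrite !Rabs_mult. ring.
  - exact (ex_series_scal_l (Rabs c) _ Ha).
Qed.

Lemma summable_ext (a b : Z -> R) : (forall k, a k = b k) -> summable a -> summable b.
Proof.
  intros H. apply ex_series_ext. intros n. unfold zpair. now rewrite !H.
Qed.

Lemma summable_abs (a : Z -> R) : summable a -> summable (fun k => Rabs (a k)).
Proof.
  apply ex_series_ext. intros n. unfold zpair. now rewrite !Rabs_Rabsolu.
Qed.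

Lemma ZS_ext (a b : Z -> R) : (forall k, a k = b k) -> ZSeriesR a = ZSeriesR b.
Proof. intros H. apply Series_ext. intros n. now rewrite !H. Qed.

Lemma ZS_plus (a b : Z -> R) : summable a -> summable b ->
  ZSeriesR (fun k => a k + b k) = ZSeriesR a + ZSeriesR b.
Proof.
  intros Ha Hb. unfold ZSeriesR.
  rewrite <- Series_plus; try (now apply summable_ex).
  apply Series_ext. intros n. ring.
Qed.

Lemma ZS_scal (c : R) (a : Z -> R) : ZSeriesR (fun k => c * a k) = c * ZSeriesR a.
Proof.
  unfold ZSeriesR. rewrite <- Series_scal_l. apply Series_ext. intros n. ring.
Qed.

Lemma ZS_minus (a b : Z -> R) : summable a -> summable b ->
  ZSeriesR (fun k => a k - b k) = ZSeriesR a - ZSeriesR b.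
Proof.
  intros Ha Hb. unfold Rminus at 2.
  replace (- ZSeriesR b) with (-1 * ZSeriesR b) by ring.
  rewrite <- ZS_scal, <- ZS_plus; auto using summable_scal.
  apply ZS_ext. intros; ring.
Qed.

Lemma ZS_pos (a : Z -> R) : summable a -> (forall k, 0 <= a k) -> 0 <= ZSeriesR a.
Proof.
  intros Ha H.
  replace 0 with (ZSeriesR (fun k => 0 * a k)) by (rewrite ZS_scal; ring).
  apply Series_le.
  - intros n. assert (H1 := H (Z.of_nat n)). assert (H2 := H (- Z.of_nat n - 1)%Z). lra.
  - now apply summable_ex.
Qed.

Lemma ZS_le (a b : Z -> R) : summable a -> summable b ->
  (forall k, a k <= b k) -> ZSeriesR a <= ZSeriesR b.
Proof.
  intros Ha Hb H.
  assert (H0 : 0 <= ZSeriesR (fun k => b k - a k)).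
  { apply ZS_pos.
    - apply summable_ext with (fun k => b k + (-1) * a k); [intros; ring|].
      auto using summable_plus, summable_scal.
    - intros k. assert (H1 := H k). lra. }
  rewrite ZS_minus in H0; auto. lra.
Qed.

Lemma ZS_abs (a : Z -> R) : summable a -> Rabs (ZSeriesR a) <= ZSeriesR (fun k => Rabs (a k)).
Proof.
  intros Ha. apply Rabs_le. split.
  - replace (- ZSeriesR (fun k => Rabs (a k))) with (ZSeriesR (fun k => -1 * Rabs (a k)))
      by (rewrite ZS_scal; ring).
    apply ZS_le; auto using summable_scal, summable_abs.
    intros k. assert (H1 := Rle_abs (- a k)). rewrite Rabs_Ropp in H1. lra.
  - apply ZS_le; auto using summable_abs. intros k. apply Rle_abs.
Qed.

Lemma is_series_lim (a : nat -> R) (l : R) : is_series a l <-> is_lim_seq (sum_n a) l.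
Proof. reflexivity. Qed.

Lemma sum_n_le_Series (a : nat -> R) (n : nat) :
  ex_series a -> (forall n, 0 <= a n) -> sum_n a n <= Series a.
Proof.
  intros Ha H. apply (is_lim_seq_incr_compare (sum_n a)).
  - exact (Series_correct a Ha).
  - intros m. rewrite sum_SnR. assert (H1 := H (S m)). lra.
Qed.

Lemma partial_le_ZS (a : Z -> R) (n : nat) :
  summable a -> (forall k, 0 <= a k) -> sum_n (zpair a) n <= ZSeriesR a.
Proof.
  intros Ha H. apply sum_n_le_Series.
  - now apply summable_ex.
  - intros m. assert (H1 := H (Z.of_nat m)). assert (H2 := H (- Z.of_nat m - 1)%Z).
    unfold zpair; lra.
Qed.

Lemma ZS_bound (a : Z -> R) (M : R) : (forall k, 0 <= a k) ->
  (forall n, sum_n (zpair a) n <= M) -> summable a /\ ZSeriesR a <= M.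
Proof.
  intros H HM.
  assert (Hi : forall n, sum_n (zpair a) n <= sum_n (zpair a) (S n)).
  { intros n. rewrite sum_SnR. unfold plus; simpl.
    assert (H1 := H (Z.of_nat (S n))). assert (H2 := H (- Z.of_nat (S n) - 1)%Z).
    unfold zpair in *. lra. }
  destruct (ex_finite_lim_seq_incr (sum_n (zpair a)) M Hi HM) as [l Hl].
  assert (Hs : is_series (zpair a) l) by exact Hl.
  split.
  - apply (ex_series_ext (zpair a)).
    + intros n. unfold zpair. rewrite !Rabs_pos_eq; auto.
    + now exists l.
  - unfold ZSeriesR. change (Series (zpair a) <= M).
    rewrite (is_series_unique _ _ Hs).
    exact (is_lim_seq_le (sum_n (zpair a)) (fun _ => M) l M HM Hl (is_lim_seq_const M)).
Qed.

Lemma zpair_in_partial (a : Z -> R) (m : nat) : (forall k, 0 <= a k) ->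
  zpair a m <= sum_n (zpair a) m.
Proof.
  intros H. destruct m.
  - rewrite sum_O. lra.
  - rewrite sum_SnR. unfold plus; simpl.
    enough (0 <= sum_n (zpair a) m) by lra.
    induction m.
    + rewrite sum_O. unfold zpair. assert (H1 := H (Z.of_nat 0)).
      assert (H2 := H (- Z.of_nat 0 - 1)%Z). lra.
    + rewrite sum_SnR. assert (H1 := H (Z.of_nat (S m))).
      assert (H2 := H (- Z.of_nat (S m) - 1)%Z). unfold zpair at 2. lra.
Qed.

Lemma term_le_ZS (a : Z -> R) (k : Z) :
  summable a -> (forall k, 0 <= a k) -> a k <= ZSeriesR a.
Proof.
  intros Ha H.
  assert (Hk : exists m, a k <= zpair a m).
  { destruct (Z_le_gt_dec 0 k) as [h|h].
    - exists (Z.to_nat k). unfold zpair. rewrite Z2Nat.id by lia.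
      assert (H1 := H (- k - 1)%Z). lra.
    - exists (Z.to_nat (- k - 1)). unfold zpair. rewrite Z2Nat.id by lia.
      replace (- (- k - 1) - 1)%Z with k by lia. assert (H1 := H (- k - 1)%Z). lra. }
  destruct Hk as [m Hm].
  apply Rle_trans with (1 := Hm). apply Rle_trans with (sum_n (zpair a) m).
  - now apply zpair_in_partial.
  - now apply partial_le_ZS.
Qed.

Lemma summable_tail (a : Z -> R) : summable a ->
  is_lim_seq (fun n => a (Z.of_nat n)) 0 /\ is_lim_seq (fun n => a (- Z.of_nat n - 1)%Z) 0.
Proof.
  intros Ha. apply ex_series_lim_0 in Ha.
  split; apply is_lim_seq_abs_0;
    apply (is_lim_seq_le_le (fun _ => 0) _ (zpair (fun k => Rabs (a k))));
    auto using is_lim_seq_const; intros n; unfold zpair;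
    assert (H1 := Rabs_pos (a (Z.of_nat n))); assert (H2 := Rabs_pos (a (- Z.of_nat n - 1)%Z)); lra.
Qed.

(** The [n]-th partial sum runs over [-n-1 <= k <= n]; a unit shift of this window gains the term
    [n + 1] and loses the term [-n-1]. Both tend to 0 for a summable sequence. *)
Lemma sum_shift (a : Z -> R) (n : nat) :
  sum_n (zpair (fun k => a (k + 1)%Z)) n =
  sum_n (zpair a) n + a (Z.of_nat (S n)) - a (- Z.of_nat n - 1)%Z.
Proof.
  induction n.
  - rewrite !sum_O. unfold zpair. simpl. ring.
  - rewrite !sum_SnR, IHn. unfold zpair.
    replace (Z.of_nat (S n) + 1)%Z with (Z.of_nat (S (S n))) by lia.
    replace (- Z.of_nat (S n) - 1 + 1)%Z with (- Z.of_nat n - 1)%Z by lia.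
    real_eq. ring.
Qed.

Lemma shift1 (a : Z -> R) : summable a ->
  summable (fun k => a (k + 1)%Z) /\ ZSeriesR (fun k => a (k + 1)%Z) = ZSeriesR a.
Proof.
  assert (Hl : forall b, summable b ->
    is_series (zpair (fun k => b (k + 1)%Z)) (ZSeriesR b)).
  { intros b Hb. apply is_series_lim.
    apply (is_lim_seq_ext
      (fun n => sum_n (zpair b) n + b (Z.of_nat (S n)) - b (- Z.of_nat n - 1)%Z)).
    { intros n. now rewrite sum_shift. }
    destruct (summable_tail b Hb) as [h1 h2].
    replace (ZSeriesR b) with (ZSeriesR b + 0 - 0) by ring.
    apply is_lim_seq_minus'; [apply is_lim_seq_plus'|]; auto.
    - exact (Series_correct _ (summable_ex b Hb)).
    - exact (proj1 (is_lim_seq_incr_1 (fun n => b (Z.of_nat n)) 0) h1). }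
  intros Ha. split.
  - exists (ZSeriesR (fun k => Rabs (a k))). exact (Hl _ (summable_abs _ Ha)).
  - exact (is_series_unique _ _ (Hl a Ha)).
Qed.

(** The map [k -> -1 - k] exchanges the two members of every pair, so the paired series does not
    change and the sums agree even without convergence. *)
Lemma shift_reflect (a : Z -> R) :
  (summable a -> summable (fun k => a (- 1 - k)%Z)) /\
  ZSeriesR (fun k => a (- 1 - k)%Z) = ZSeriesR a.
Proof.
  split.
  - apply ex_series_ext. intros n. unfold zpair.
    replace (-1 - Z.of_nat n)%Z with (- Z.of_nat n - 1)%Z by lia.
    replace (-1 - (- Z.of_nat n - 1))%Z with (Z.of_nat n) by lia. real_eq. ring.
  - apply Series_ext. intros n.
    replace (-1 - Z.of_nat n)%Z with (- Z.of_nat n - 1)%Z by lia.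
    replace (-1 - (- Z.of_nat n - 1))%Z with (Z.of_nat n) by lia. ring.
Qed.

Lemma shift_nat (a : Z -> R) (m : nat) : summable a ->
  summable (fun k => a (k + Z.of_nat m)%Z) /\
  ZSeriesR (fun k => a (k + Z.of_nat m)%Z) = ZSeriesR a.
Proof.
  intros Ha. induction m as [|m [IH1 IH2]].
  - split.
    + apply summable_ext with a; auto. intros k. f_equal. lia.
    + apply ZS_ext. intros k. f_equal. lia.
  - destruct (shift1 _ IH1) as [h1 h2]. split.
    + apply summable_ext with (2 := h1). intros k. f_equal. lia.
    + rewrite <- IH2, <- h2. apply ZS_ext. intros k. f_equal. lia.
Qed.

(** Every reflection is [k -> -1 - k] combined with a shift by a natural number, taken before or
    after it according to the sign of [m + 1]. Two reflections then give all integer shifts. *)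
Lemma ZS_reflect (a : Z -> R) (m : Z) : summable a ->
  summable (fun k => a (m - k)%Z) /\ ZSeriesR (fun k => a (m - k)%Z) = ZSeriesR a.
Proof.
  intros Ha. destruct (Z_le_gt_dec (-1) m) as [h|h].
  - destruct (shift_nat a (Z.to_nat (m + 1)) Ha) as [h1 h2].
    destruct (shift_reflect (fun k => a (k + Z.of_nat (Z.to_nat (m + 1)))%Z)) as [h3 h4].
    split.
    + apply summable_ext with (2 := h3 h1). intros k. f_equal. lia.
    + rewrite <- h2, <- h4. apply ZS_ext. intros k. f_equal. lia.
  - destruct (shift_reflect a) as [h3 h4].
    destruct (shift_nat _ (Z.to_nat (- m - 1)) (h3 Ha)) as [h1 h2].
    split.
    + apply summable_ext with (2 := h1). intros k. f_equal. lia.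
    + rewrite <- h4, <- h2. apply ZS_ext. intros k. f_equal. lia.
Qed.

Lemma ZS_shift (a : Z -> R) (m : Z) : summable a ->
  summable (fun k => a (k + m)%Z) /\ ZSeriesR (fun k => a (k + m)%Z) = ZSeriesR a.
Proof.
  intros Ha. destruct (ZS_reflect a m Ha) as [h1 h2].
  destruct (ZS_reflect _ 0%Z h1) as [h3 h4]. split.
  - apply summable_ext with (2 := h3). intros k. simpl. f_equal. lia.
  - rewrite <- h2, <- h4. apply ZS_ext. intros k. f_equal. lia.
Qed.

Lemma Series_sum_n (f : nat -> nat -> R) (M : nat) : (forall m, ex_series (f m)) ->
  ex_series (fun n => sum_n (fun m => f m n) M) /\
  sum_n (fun m => Series (f m)) M = Series (fun n => sum_n (fun m => f m n) M).
Proof.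
  intros H. induction M as [|M [IH1 IH2]].
  - split.
    + apply ex_series_ext with (2 := H 0%nat). intros n. now rewrite sum_O.
    + rewrite sum_O. apply Series_ext. intros n. now rewrite sum_O.
  - split.
    + apply ex_series_ext with (2 := ex_series_plus _ _ IH1 (H (S M))).
      intros n. now rewrite sum_SnR.
    + rewrite sum_SnR, IH2. rewrite <- Series_plus; auto.
      apply Series_ext. intros n. now rewrite sum_SnR.
Qed.

Lemma Series_tail (a : nat -> R) (n : nat) : ex_series a ->
  Series a - sum_n a n = Series (fun k => a (S n + k)%nat).
Proof.
  intros Ha. rewrite (Series_incr_n a (S n)); auto; [|lia].
  simpl Init.Nat.pred. rewrite sum_n_Reals. ring.
Qed.

(** Fubini with a rank-one majorant: the sum of the rows up to [M] differs from the other iterated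
    sum by at most [Series q] times the tail of [p] beyond [M]. *)
Lemma Series_swap (f : nat -> nat -> R) (p q : nat -> R) :
  (forall m n, Rabs (f m n) <= p m * q n) -> (forall n, 0 <= p n) -> (forall n, 0 <= q n) ->
  ex_series p -> ex_series q ->
  Series (fun m => Series (f m)) = Series (fun n => Series (fun m => f m n)).
Proof.
  intros H p0 q0 Hp Hq. apply is_series_unique, is_series_lim.
  assert (Hf : forall m, ex_series (f m)).
  { intros m. apply ex_series_le_R with (1 := H m). exact (ex_series_scal_l (p m) q Hq). }
  assert (Hf' : forall n, ex_series (fun m => f m n)).
  { intros n. apply ex_series_le_R with (b := fun m => p m * q n).
    - intros m; apply H.
    - exact (ex_series_scal_r (q n) p Hp). }
  set (S0 := Series (fun n => Series (fun m => f m n))).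
  assert (Hb : forall n, Rabs (Series (fun m => f m n)) <= q n * Series p).
  { intros n. assert (Hx : ex_series (fun m => Rabs (f m n))).
    { apply ex_series_le_R with (b := fun m => p m * q n).
      - intros m. rewrite Rabs_Rabsolu. apply H.
      - exact (ex_series_scal_r (q n) p Hp). }
    apply Rle_trans with (1 := Series_Rabs _ Hx).
    rewrite Rmult_comm, <- Series_scal_r. apply Series_le.
    - intros m. split; [apply Rabs_pos|apply H].
    - exact (ex_series_scal_r (q n) p Hp). }
  assert (Hex : ex_series (fun n => Series (fun m => f m n))).
  { apply ex_series_le_R with (1 := Hb). exact (ex_series_scal_r (Series p) q Hq). }
  assert (Hd : forall M, Rabs (sum_n (fun m => Series (f m)) M - S0)
                 <= Series q * (Series p - sum_n p M)).
  { intros M. destruct (Series_sum_n f M Hf) as [h1 h2]. rewrite h2. unfold S0.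
    rewrite <- Series_minus; auto.
    assert (Ht : forall n, Rabs (sum_n (fun m => f m n) M - Series (fun m => f m n))
                   <= q n * (Series p - sum_n p M)).
    { intros n.
      rewrite Rabs_minus_sym, !Series_tail; auto.
      assert (Hp' : ex_series (fun k => p (S M + k)%nat)) by now apply ex_series_incr_n.
      assert (Hpq : ex_series (fun k => p (S M + k)%nat * q n))
        by exact (ex_series_scal_r (q n) _ Hp').
      apply Rle_trans with (Series (fun k => Rabs (f (S M + k)%nat n))).
      - apply Series_Rabs. apply ex_series_le_R with (b := fun k => p (S M + k)%nat * q n); auto.
        intros k. rewrite Rabs_Rabsolu. apply H.
      - rewrite Rmult_comm, <- Series_scal_r. apply Series_le; auto.
        intros k. split; [apply Rabs_pos|apply H]. }
    rewrite <- Series_scal_r.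
    assert (Hq' : ex_series (fun n => q n * (Series p - sum_n p M)))
      by exact (ex_series_scal_r _ q Hq).
    apply Rle_trans with
      (Series (fun n => Rabs (sum_n (fun m => f m n) M - Series (fun m => f m n)))).
    - apply Series_Rabs. apply ex_series_le_R with (2 := Hq').
      intros n. rewrite Rabs_Rabsolu. apply Ht.
    - apply Series_le; auto. intros n. split; [apply Rabs_pos|apply Ht]. }
  assert (Hl : is_lim_seq (fun M => Series q * (Series p - sum_n p M)) 0).
  { replace (Finite 0) with (Finite (Series q * (Series p - Series p))) by (f_equal; ring).
    apply is_lim_seq_mult'; [apply is_lim_seq_const|].
    apply is_lim_seq_minus'; [apply is_lim_seq_const|]. exact (Series_correct p Hp). }
  replace S0 with (S0 + 0) by ring.
  apply is_lim_seq_ext with (fun M => S0 + (sum_n (fun m => Series (f m)) M - S0)).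
  { intros; ring. }
  apply is_lim_seq_plus'; [apply is_lim_seq_const|].
  apply is_lim_seq_abs_0.
  apply (is_lim_seq_le_le (fun _ => 0) _ (fun M => Series q * (Series p - sum_n p M))); auto.
  - intros n. split; [apply Rabs_pos|apply Hd].
  - apply is_lim_seq_const.
Qed.

Lemma ZS_swap (f : Z -> Z -> R) (p q : Z -> R) :
  (forall j k, Rabs (f j k) <= p j * q k) -> (forall k, 0 <= p k) -> (forall k, 0 <= q k) ->
  summable p -> summable q ->
  ZSeriesR (fun j => ZSeriesR (f j)) = ZSeriesR (fun k => ZSeriesR (fun j => f j k)).
Proof.
  intros H p0 q0 Hp Hq.
  assert (Hp1 := summable_ex _ Hp). assert (Hq1 := summable_ex _ Hq).
  assert (H1 : forall j, summable (f j)).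
  { intros j. apply summable_le with (1 := H j). now apply summable_scal. }
  assert (H2 : forall k, summable (fun j => f j k)).
  { intros k. apply summable_le with (b := fun j => q k * p j).
    - intros j. rewrite Rmult_comm. apply H.
    - now apply summable_scal. }
  unfold ZSeriesR.
  transitivity (Series (fun m => Series (fun n =>
    zpair (fun j => zpair (f j) n) m))).
  { apply Series_ext. intros m. rewrite <- Series_plus.
    - apply Series_ext. intros n. reflexivity.
    - apply (summable_ex _ (H1 _)).
    - apply (summable_ex _ (H1 _)). }
  rewrite (Series_swap _ (zpair p) (zpair q)); auto.
  - apply Series_ext. intros n. rewrite <- Series_plus.
    + apply Series_ext. intros m. unfold zpair. ring.
    + apply (summable_ex _ (H2 _)).
    + apply (summable_ex _ (H2 _)).
  - intros m n. unfold zpair.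
    set (j1 := Z.of_nat m). set (j2 := (- Z.of_nat m - 1)%Z).
    set (k1 := Z.of_nat n). set (k2 := (- Z.of_nat n - 1)%Z).
    assert (A1 := H j1 k1). assert (A2 := H j1 k2). assert (A3 := H j2 k1). assert (A4 := H j2 k2).
    assert (B1 := Rabs_triang (f j1 k1 + f j1 k2) (f j2 k1 + f j2 k2)).
    assert (B2 := Rabs_triang (f j1 k1) (f j1 k2)).
    assert (B3 := Rabs_triang (f j2 k1) (f j2 k2)).
    change (- k1 - 1)%Z with k2. change (- j1 - 1)%Z with j2.
    rewrite Rmult_plus_distr_r, !Rmult_plus_distr_l. lra.
  - intros n. unfold zpair. assert (A := p0 (Z.of_nat n)).
    assert (B := p0 (- Z.of_nat n - 1)%Z). lra.
  - intros n. unfold zpair. assert (A := q0 (Z.of_nat n)).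
    assert (B := q0 (- Z.of_nat n - 1)%Z). lra.
Qed.

Lemma summable_ZS (f : Z -> Z -> R) (p q : Z -> R) :
  (forall j k, Rabs (f j k) <= p j * q k) -> summable p -> summable q ->
  summable (fun j => ZSeriesR (f j)).
Proof.
  intros H Hp Hq. apply summable_le with (b := fun j => ZSeriesR q * p j).
  - intros j. rewrite Rmult_comm, <- ZS_scal.
    assert (Hs : summable (f j)).
    { apply summable_le with (1 := H j). now apply summable_scal. }
    apply Rle_trans with (1 := ZS_abs _ Hs). apply ZS_le; auto.
    + now apply summable_abs.
    + now apply summable_scal.
  - now apply summable_scal.
Qed.

(** * Absolutely convergent complex sums *)

Definition Csummable (a : Z -> C) : Prop := summable (fun k => Cmod (a k)).

Lemma fst_le_Cmod (z : C) : Rabs (fst z) <= Cmod z.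
Proof. apply Rle_trans with (2 := Rmax_Cmod z). apply Rmax_l. Qed.

Lemma snd_le_Cmod (z : C) : Rabs (snd z) <= Cmod z.
Proof. apply Rle_trans with (2 := Rmax_Cmod z). apply Rmax_r. Qed.

Lemma Cmod_le_parts (z : C) : Cmod z <= Rabs (fst z) + Rabs (snd z).
Proof.
  destruct z as [x y]; simpl.
  replace ((x, y) : C) with (RtoC x + Ci * RtoC y)%C
    by (unfold Ci, RtoC, Cplus, Cmult; simpl; f_equal; ring).
  apply Rle_trans with (1 := Cmod_triangle _ _).
  rewrite Cmod_mult, Cmod_Ci, !Cmod_R. lra.
Qed.

Lemma Csummable_fst (a : Z -> C) : Csummable a -> summable (fun k => fst (a k)).
Proof. apply summable_le. intros k. apply fst_le_Cmod. Qed.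

Lemma Csummable_snd (a : Z -> C) : Csummable a -> summable (fun k => snd (a k)).
Proof. apply summable_le. intros k. apply snd_le_Cmod. Qed.

Lemma Csummable_le (a : Z -> C) (b : Z -> R) :
  (forall k, Cmod (a k) <= b k) -> summable b -> Csummable a.
Proof.
  intros H. apply summable_le. intros k. rewrite Rabs_pos_eq; auto. apply Cmod_ge_0.
Qed.

Lemma Csummable_scal (c : C) (a : Z -> C) : Csummable a -> Csummable (fun k => c * a k)%C.
Proof.
  intros Ha. apply Csummable_le with (fun k => Cmod c * Cmod (a k)).
  - intros k. rewrite Cmod_mult. lra.
  - now apply summable_scal.
Qed.

Lemma CS_ext (a b : Z -> C) : (forall k, a k = b k) -> ZSeriesC a = ZSeriesC b.
Proof. intros H. unfold ZSeriesC. f_equal; apply ZS_ext; intros k; now rewrite H. Qed.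

Lemma CS_plus (a b : Z -> C) : Csummable a -> Csummable b ->
  ZSeriesC (fun k => a k + b k)%C = (ZSeriesC a + ZSeriesC b)%C.
Proof.
  intros Ha Hb. unfold ZSeriesC, Cplus; simpl.
  rewrite <- !ZS_plus; auto using Csummable_fst, Csummable_snd.
Qed.

Lemma CS_scal (c : C) (a : Z -> C) : Csummable a ->
  ZSeriesC (fun k => c * a k)%C = (c * ZSeriesC a)%C.
Proof.
  intros Ha. assert (H1 := Csummable_fst a Ha). assert (H2 := Csummable_snd a Ha).
  unfold ZSeriesC, Cmult; simpl. f_equal.
  - rewrite <- !ZS_scal, <- ZS_minus; auto using summable_scal.
  - rewrite <- !ZS_scal, <- ZS_plus; auto using summable_scal.
Qed.

Lemma CS_minus (a b : Z -> C) : Csummable a -> Csummable b ->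
  ZSeriesC (fun k => a k - b k)%C = (ZSeriesC a - ZSeriesC b)%C.
Proof.
  intros Ha Hb. transitivity (ZSeriesC (fun k => a k + (-1) * b k)%C).
  - apply CS_ext. intros k. ring.
  - rewrite CS_plus, CS_scal; auto using Csummable_scal. ring.
Qed.

Lemma CS_conj (a : Z -> C) : ZSeriesC (fun k => Cconj (a k)) = Cconj (ZSeriesC a).
Proof.
  unfold ZSeriesC, Cconj; simpl. f_equal.
  replace (- ZSeriesR (fun k => snd (a k))) with (-1 * ZSeriesR (fun k => snd (a k))) by ring.
  rewrite <- ZS_scal. apply ZS_ext. intros k. ring.
Qed.

(** With z the sum, |z|^2 is the sum of the real parts of the terms multiplied by the conjugate of
    z, hence at most |z| times the sum of the moduli. *)
Lemma CS_norm (a : Z -> C) : Csummable a -> Cmod (ZSeriesC a) <= ZSeriesR (fun k => Cmod (a k)).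
Proof.
  intros Ha. set (z := ZSeriesC a).
  destruct (Req_dec (Cmod z) 0) as [h|h].
  { rewrite h. apply ZS_pos; auto. intros; apply Cmod_ge_0. }
  assert (h0 : 0 < Cmod z) by (assert (H := Cmod_ge_0 z); lra).
  apply Rmult_le_reg_l with (Cmod z); auto.
  assert (E : Cmod z * Cmod z = ZSeriesR (fun k => fst (Cconj z * a k)%C)).
  { transitivity (fst (ZSeriesC (fun k => Cconj z * a k)%C)); [|reflexivity].
    rewrite CS_scal; auto. fold z.
    assert (H := Cmod2_conj z). apply (f_equal fst) in H.
    rewrite Cmult_comm, <- H. simpl. ring. }
  rewrite E, <- ZS_scal. apply ZS_le.
  - apply Csummable_fst. now apply Csummable_scal.
  - now apply summable_scal.
  - intros k. apply Rle_trans with (1 := Rle_abs _).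
    apply Rle_trans with (1 := fst_le_Cmod _). rewrite Cmod_mult, Cmod_conj. lra.
Qed.

Lemma CS_shift (a : Z -> C) (m : Z) : Csummable a ->
  Csummable (fun k => a (k + m)%Z) /\ ZSeriesC (fun k => a (k + m)%Z) = ZSeriesC a.
Proof.
  intros Ha. split.
  - exact (proj1 (ZS_shift _ m Ha)).
  - unfold ZSeriesC. f_equal.
    + exact (proj2 (ZS_shift _ m (Csummable_fst a Ha))).
    + exact (proj2 (ZS_shift _ m (Csummable_snd a Ha))).
Qed.

Lemma CS_reflect (a : Z -> C) (m : Z) : Csummable a ->
  Csummable (fun k => a (m - k)%Z) /\ ZSeriesC (fun k => a (m - k)%Z) = ZSeriesC a.
Proof.
  intros Ha. split.
  - exact (proj1 (ZS_reflect _ m Ha)).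
  - unfold ZSeriesC. f_equal.
    + exact (proj2 (ZS_reflect _ m (Csummable_fst a Ha))).
    + exact (proj2 (ZS_reflect _ m (Csummable_snd a Ha))).
Qed.

Lemma CS_swap (f : Z -> Z -> C) (p q : Z -> R) :
  (forall j k, Cmod (f j k) <= p j * q k) -> (forall k, 0 <= p k) -> (forall k, 0 <= q k) ->
  summable p -> summable q ->
  ZSeriesC (fun j => ZSeriesC (f j)) = ZSeriesC (fun k => ZSeriesC (fun j => f j k)).
Proof.
  intros H p0 q0 Hp Hq. unfold ZSeriesC; simpl. f_equal.
  - apply (ZS_swap (fun j k => fst (f j k)) p q); auto.
    intros j k. apply Rle_trans with (2 := H j k). apply fst_le_Cmod.
  - apply (ZS_swap (fun j k => snd (f j k)) p q); auto.
    intros j k. apply Rle_trans with (2 := H j k). apply snd_le_Cmod.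
Qed.

Lemma ZS_single (a : Z -> R) : (forall k, k <> 0%Z -> a k = 0) -> ZSeriesR a = a 0%Z.
Proof.
  intros H.
  assert (Hz : forall n, zpair a (S n) = 0).
  { intros n. unfold zpair. rewrite !H by lia. ring. }
  assert (Hs : is_series (zpair a) (a 0%Z)).
  { apply is_series_lim. apply is_lim_seq_ext with (fun _ => a 0%Z).
    - intros n. induction n.
      + rewrite sum_O. unfold zpair. simpl. rewrite (H (-1)%Z) by lia. ring.
      + rewrite sum_SnR, Hz. lra.
    - apply is_lim_seq_const. }
  exact (is_series_unique _ _ Hs).
Qed.

Lemma CS_single (a : Z -> C) : (forall k, k <> 0%Z -> a k = 0%C) -> ZSeriesC a = a 0%Z.
Proof.
  intros H. unfold ZSeriesC.
  rewrite !ZS_single; try (intros k Hk; now rewrite (H k Hk)).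
  now destruct (a 0%Z).
Qed.

(** * Polynomial weights and rapid decay *)

Definition wt (k : Z) : R := 1 + Rabs (IZR k).

Lemma wt_ge1 (k : Z) : 1 <= wt k.
Proof. unfold wt. assert (H := Rabs_pos (IZR k)). lra. Qed.

Lemma wt_pos (k : Z) : 0 < wt k.
Proof. assert (H := wt_ge1 k). lra. Qed.

Lemma wt_pow_ge1 (m : nat) (k : Z) : 1 <= wt k ^ m.
Proof. apply pow_R1_Rle, wt_ge1. Qed.

(** The triangle inequality |n| <= |j| + |n - j| in multiplicative form: a weight at the output
    frequency of a convolution is distributed over the two inputs. *)
Lemma wt_mul (n j : Z) : wt n <= wt j * wt (n - j).
Proof.
  unfold wt. rewrite minus_IZR.
  assert (H := Rabs_triang (IZR j) (IZR n - IZR j)).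
  replace (IZR j + (IZR n - IZR j)) with (IZR n) in H by ring.
  assert (H1 := Rabs_pos (IZR j)). assert (H2 := Rabs_pos (IZR n - IZR j)). nra.
Qed.

Lemma wt_mul_pow (m : nat) (n j : Z) : wt n ^ m <= wt j ^ m * wt (n - j) ^ m.
Proof.
  rewrite <- Rpow_mult_distr. apply pow_incr. split; [|apply wt_mul].
  assert (H := wt_pos n). lra.
Qed.

(* Telescoping against [N / x n], where [x n = 1 + n / N]. *)
Lemma sum_weight (N : R) : 1 <= N ->
  summable (fun k => / (1 + Rabs (IZR k) / N) ^ 2) /\
  ZSeriesR (fun k => / (1 + Rabs (IZR k) / N) ^ 2) <= 3 * N.
Proof.
  intros HN. set (a := fun k => / (1 + Rabs (IZR k) / N) ^ 2).
  set (x := fun n : nat => 1 + INR n / N).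
  assert (Hx : forall n, 1 <= x n).
  { intros n. unfold x. enough (0 <= INR n / N) by lra.
    apply Rmult_le_pos; [apply pos_INR|]. left. apply Rinv_0_lt_compat. lra. }
  assert (Ha : forall n, zpair a n = / x n ^ 2 + / x (S n) ^ 2).
  { intros n. unfold zpair, a, x. rewrite <- INR_IZR_INZ.
    replace (IZR (- Z.of_nat n - 1)) with (- INR (S n)).
    - rewrite Rabs_Ropp, !Rabs_pos_eq; auto using pos_INR.
    - rewrite minus_IZR, opp_IZR, <- INR_IZR_INZ, S_INR. ring. }
  assert (Hstep : forall n, / x (S n) ^ 2 <= N * (/ x n - / x (S n))).
  { intros n. assert (H1 := Hx n). assert (H2 := Hx (S n)).
    assert (E : x (S n) = x n + / N).
    { unfold x. rewrite S_INR. field. lra. }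
    replace (N * (/ x n - / x (S n))) with (/ (x n * x (S n))).
    - apply Rinv_le_contravar; [nra|]. assert (0 < / N) by (apply Rinv_0_lt_compat; lra). nra.
    - rewrite E. rewrite E in H2. field. repeat split; lra || nra. }
  assert (Hn : forall n, 0 < / x n).
  { intros n. apply Rinv_0_lt_compat. assert (H := Hx n). lra. }
  destruct (ZS_bound a (3 * N)) as [h1 h2].
  - intros k. unfold a. left. apply Rinv_0_lt_compat, pow_lt.
    enough (0 <= Rabs (IZR k) / N) by lra.
    apply Rmult_le_pos; [apply Rabs_pos|]. left. apply Rinv_0_lt_compat. lra.
  - intros n. enough (sum_n (zpair a) n <= 1 + 2 * N - N / x (S n) - N / x n).
    { assert (H1 := Hn n). assert (H2 := Hn (S n)). unfold Rdiv in *. nra. }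
    induction n.
    + rewrite sum_O, Ha. assert (H1 := Hstep 0%nat).
      assert (E : x 0%nat = 1) by (unfold x; simpl; field; lra).
      rewrite E in *. unfold Rdiv. rewrite Rinv_1 in *. simpl (1 ^ 2).
      replace (/ (1 * (1 * 1))) with 1 by field. lra.
    + rewrite sum_SnR, Ha. assert (H1 := Hstep n). assert (H2 := Hstep (S n)).
      unfold Rdiv in *. lra.
  - now split.
Qed.

Lemma wt_opp (k : Z) : wt (- k) = wt k.
Proof. unfold wt. now rewrite opp_IZR, Rabs_Ropp. Qed.

(** Of the four powers on the first factor, two pay for moving weight to the output frequency [n]
    and two remain for the sum over [j]. The bound has rank one, the form that [ZS_swap] and
    [CS_swap] require. *)
Lemma conv_dominated (x y ca cb : R) (n j : Z) : 0 <= x -> 0 <= y ->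
  x * wt j ^ 4 <= ca -> y * wt (n - j) ^ 2 <= cb ->
  x * y <= (cb * / wt n ^ 2) * (ca * / wt j ^ 2).
Proof.
  intros x0 y0 A B. assert (w1 := wt_pow_ge1 2 n). assert (w2 := wt_pow_ge1 2 j).
  assert (w3 := wt_pow_ge1 2 (n - j)). assert (w4 := wt_mul_pow 2 n j).
  replace (wt j ^ 4) with (wt j ^ 2 * wt j ^ 2) in A by ring.
  set (X := wt n ^ 2) in *. set (Y := wt j ^ 2) in *. set (W := wt (n - j) ^ 2) in *.
  clearbody X Y W. apply Rmult_le_reg_r with (X * Y); [nra|].
  replace (cb * / X * (ca * / Y) * (X * Y)) with (ca * cb) by (field; lra).
  apply Rle_trans with ((x * (Y * Y)) * (y * W)).
  - replace (x * y * (X * Y)) with ((x * y * Y) * X) by ring.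
    replace (x * (Y * Y) * (y * W)) with ((x * y * Y) * (Y * W)) by ring.
    apply Rmult_le_compat_l; auto. repeat apply Rmult_le_pos; lra.
  - apply Rmult_le_compat; auto; repeat apply Rmult_le_pos; lra.
Qed.

Lemma wt_inv_nonneg (k : Z) : 0 <= / wt k ^ 2.
Proof. left. apply Rinv_0_lt_compat, pow_lt, wt_pos. Qed.

Lemma le_div_wt (x c : R) (m : nat) (k : Z) : x * wt k ^ m <= c -> x <= c * / wt k ^ m.
Proof.
  intros H. assert (w := wt_pow_ge1 m k).
  apply Rmult_le_reg_r with (wt k ^ m); [lra|]. rewrite Rmult_assoc, Rinv_l; lra.
Qed.

Lemma sum_wt : summable (fun k => / wt k ^ 2) /\ ZSeriesR (fun k => / wt k ^ 2) <= 3.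
Proof.
  destruct (sum_weight 1 (Rle_refl 1)) as [h1 h2].
  assert (E : forall k, / (1 + Rabs (IZR k) / 1) ^ 2 = / wt k ^ 2).
  { intros k. unfold wt. now rewrite Rdiv_1_r. }
  split.
  - exact (summable_ext _ _ E h1).
  - rewrite <- (ZS_ext _ _ E). lra.
Qed.

(** These weighted sup norms are the seminorms of the Frechet space [RD]. Continuity, derivatives
    and limits of sequences are all measured in them. *)
Definition small (m : nat) (eps : R) (a : Z -> C) : Prop :=
  forall k, Cmod (a k) * wt k ^ m <= eps.

Definition RD (a : Z -> C) : Prop := forall m, exists c, small m c a.

Lemma small_nonneg (m : nat) (c : R) (a : Z -> C) : small m c a -> 0 <= c.
Proof.
  intros H. apply Rle_trans with (2 := H 0%Z). apply Rmult_le_pos; [apply Cmod_ge_0|].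
  assert (h := wt_pow_ge1 m 0). lra.
Qed.

Lemma small_le (m : nat) (c c' : R) (a : Z -> C) : c <= c' -> small m c a -> small m c' a.
Proof. intros H Ha k. now apply Rle_trans with (2 := H). Qed.

Lemma small_weaken (m m' : nat) (c : R) (a : Z -> C) :
  (m' <= m)%nat -> small m c a -> small m' c a.
Proof.
  intros H Ha k. apply Rle_trans with (2 := Ha k).
  apply Rmult_le_compat_l; [apply Cmod_ge_0|]. apply Rle_pow; auto using wt_ge1.
Qed.

Lemma small_term (m : nat) (c : R) (a : Z -> C) (k : Z) : small m c a -> Cmod (a k) <= c.
Proof.
  intros H. apply (small_weaken m 0) in H; [|lia]. assert (h := H k). simpl in h. lra.
Qed.

Lemma small_div (m : nat) (c : R) (a : Z -> C) (k : Z) :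
  small m c a -> Cmod (a k) <= c * / wt k ^ m.
Proof.
  intros H. apply le_div_wt, H.
Qed.

Lemma small2_sum (c : R) (a : Z -> C) : small 2 c a ->
  Csummable a /\ ZSeriesR (fun k => Cmod (a k)) <= 3 * c.
Proof.
  intros H. destruct sum_wt as [h1 h2]. assert (c0 := small_nonneg _ _ _ H).
  assert (Hs : Csummable a).
  { apply Csummable_le with (fun k => c * / wt k ^ 2).
    - intros k. now apply small_div.
    - now apply summable_scal. }
  split; auto. apply Rle_trans with (ZSeriesR (fun k => c * / wt k ^ 2)).
  - apply ZS_le; auto using summable_scal. intros k. now apply small_div.
  - rewrite ZS_scal. nra.
Qed.

Lemma RD_summable (a : Z -> C) : RD a -> Csummable a.
Proof. intros H. destruct (H 2%nat) as [c Hc]. exact (proj1 (small2_sum c a Hc)). Qed.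

Definition conv (a b : Z -> C) (n : Z) : C := ZSeriesC (fun j => a j * b (n - j)%Z)%C.

Lemma conv_terms (a b : Z -> C) (c : R) (n : Z) :
  Csummable a -> (forall k, Cmod (b k) <= c) -> Csummable (fun j => a j * b (n - j)%Z)%C.
Proof.
  intros Ha Hb. apply Csummable_le with (fun k => c * Cmod (a k)).
  - intros k. rewrite Cmod_mult, Rmult_comm. apply Rmult_le_compat_r; auto. apply Cmod_ge_0.
  - now apply summable_scal.
Qed.

Lemma RD_terms (a b : Z -> C) (n : Z) : RD a -> RD b ->
  Csummable (fun j => a j * b (n - j)%Z)%C.
Proof.
  intros Ha Hb. destruct (Hb 0%nat) as [c Hc]. apply conv_terms with c.
  - now apply RD_summable.
  - intros k. now apply (small_term 0).
Qed.

(** One factor carries two extra powers of the weight, spent on the sum over [j]; the constant 3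
    bounds the sum of [/ wt j ^ 2]. *)
Lemma small_conv (m : nat) (c c' : R) (a b : Z -> C) :
  small (m + 2) c a -> small m c' b -> small m (3 * c * c') (conv a b).
Proof.
  intros Ha Hb n. assert (c0 := small_nonneg _ _ _ Ha). assert (c0' := small_nonneg _ _ _ Hb).
  assert (Hn := wt_pow_ge1 m n).
  assert (Hs : Csummable a).
  { apply (small2_sum c). apply (small_weaken (m + 2)); auto. lia. }
  assert (Ht : Csummable (fun j => a j * b (n - j)%Z)%C).
  { apply conv_terms with c'; auto. intros k. now apply (small_term m). }
  rewrite Rmult_comm. apply Rle_trans with
    (wt n ^ m * ZSeriesR (fun j => Cmod (a j * b (n - j)%Z)%C)).
  { apply Rmult_le_compat_l; [lra|]. now apply CS_norm. }
  destruct sum_wt as [h1 h2].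
  rewrite <- ZS_scal. apply Rle_trans with (ZSeriesR (fun j => (c * c') * / wt j ^ 2)).
  - apply ZS_le; auto using summable_scal. intros j. rewrite Cmod_mult.
    assert (Hw := wt_mul_pow m n j).
    assert (A1 := Ha j). assert (A2 := Hb (n - j)%Z). rewrite pow_add in A1.
    assert (P1 := Cmod_ge_0 (a j)). assert (P2 := Cmod_ge_0 (b (n - j)%Z)).
    assert (P3 := wt_pow_ge1 m j). assert (P4 := wt_pow_ge1 m (n - j)).
    assert (P5 := wt_pow_ge1 2 j).
    assert (A1' : Cmod (a j) * wt j ^ m <= c * / wt j ^ 2).
    { apply le_div_wt. lra. }
    apply Rle_trans with ((Cmod (a j) * wt j ^ m) * (Cmod (b (n - j)%Z) * wt (n - j) ^ m)).
    + assert (P6 : 0 <= Cmod (a j) * Cmod (b (n - j)%Z)) by now apply Rmult_le_pos.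
      replace (Cmod (a j) * wt j ^ m * (Cmod (b (n - j)%Z) * wt (n - j) ^ m))
        with ((wt j ^ m * wt (n - j) ^ m) * (Cmod (a j) * Cmod (b (n - j)%Z))) by ring.
      now apply Rmult_le_compat_r.
    + replace (c * c' * / wt j ^ 2) with ((c * / wt j ^ 2) * c') by ring.
      apply Rmult_le_compat; auto; apply Rmult_le_pos; lra.
  - rewrite ZS_scal. assert (0 <= c * c') by now apply Rmult_le_pos. nra.
Qed.

Lemma small_plus (m : nat) (c c' : R) (a b : Z -> C) :
  small m c a -> small m c' b -> small m (c + c') (fun k => a k + b k)%C.
Proof.
  intros Ha Hb k. assert (h1 := Ha k). assert (h2 := Hb k).
  assert (h3 := Cmod_triangle (a k) (b k)). assert (h4 := wt_pow_ge1 m k). nra.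
Qed.

Lemma small_mult (m : nat) (c d : R) (s : Z -> C) (a : Z -> C) :
  (forall k, Cmod (s k) <= d) -> small m c a -> small m (d * c) (fun k => s k * a k)%C.
Proof.
  intros Hs Ha k. rewrite Cmod_mult, Rmult_assoc.
  assert (h4 := wt_pow_ge1 m k). assert (h5 := Cmod_ge_0 (a k)).
  apply Rmult_le_compat; auto; [apply Cmod_ge_0|nra].
Qed.

Lemma small_ext (m : nat) (c : R) (a b : Z -> C) :
  (forall k, a k = b k) -> small m c a -> small m c b.
Proof. intros H Ha k. rewrite <- H. apply Ha. Qed.

Lemma Cconj_RtoC (x : R) : Cconj (RtoC x) = RtoC x.
Proof. unfold Cconj, RtoC; simpl. now rewrite Ropp_0. Qed.

Lemma Cconj_Ci : Cconj Ci = (- Ci)%C.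
Proof. unfold Ci, Cconj, Copp; simpl. f_equal; ring. Qed.

Lemma Ci_neq_0 : Ci <> 0%C.
Proof. intros h. apply (f_equal Cmod) in h. rewrite Cmod_Ci, Cmod_0 in h. lra. Qed.

(** * The convolution algebra of rapidly decaying sequences *)

Record rdseq := mkrd { co :> Z -> C; co_RD : RD co }.

(** Functional extensionality and proof irrelevance turn coefficientwise equality into Leibniz
    equality, so that [ring] and plain rewriting apply to sequences. *)
Lemma rd_ext (f g : rdseq) : (forall k, f k = g k) -> f = g.
Proof.
  destruct f as [f Hf], g as [g Hg]. simpl. intros H.
  assert (E : f = g) by now apply functional_extensionality.
  subst g. f_equal. apply proof_irrelevance.
Qed.

Lemma RD_plus (a b : Z -> C) : RD a -> RD b -> RD (fun k => a k + b k)%C.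
Proof.
  intros Ha Hb m. destruct (Ha m) as [c Hc]. destruct (Hb m) as [c' Hc'].
  exists (c + c'). now apply small_plus.
Qed.

Lemma RD_conv (a b : Z -> C) : RD a -> RD b -> RD (conv a b).
Proof.
  intros Ha Hb m. destruct (Ha (m + 2)%nat) as [c Hc]. destruct (Hb m) as [c' Hc'].
  exists (3 * c * c'). now apply small_conv.
Qed.

Definition lin_growth (s : Z -> C) : Prop := exists d, forall k, Cmod (s k) <= d * wt k.

Lemma RD_diag (s a : Z -> C) : lin_growth s -> RD a -> RD (fun k => s k * a k)%C.
Proof.
  intros [d Hd] Ha m. destruct (Ha (S m)) as [c Hc]. exists (d * c). intros k.
  rewrite Cmod_mult. assert (H1 := Hd k). assert (H2 := Hc k). simpl in H2.
  assert (H3 := wt_pos k). assert (H4 := wt_pow_ge1 m k). assert (H5 := Cmod_ge_0 (a k)).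
  assert (H6 := Cmod_ge_0 (s k)).
  assert (H7 : 0 <= d).
  { apply Rmult_le_reg_r with (wt k); auto. lra. }
  apply Rle_trans with ((d * wt k) * (Cmod (a k) * wt k ^ m)).
  - rewrite Rmult_assoc. apply Rmult_le_compat_r; auto. apply Rmult_le_pos; lra.
  - replace (d * wt k * (Cmod (a k) * wt k ^ m)) with (d * (Cmod (a k) * (wt k * wt k ^ m))) by ring.
    now apply Rmult_le_compat_l.
Qed.

Lemma bounded_growth (s : Z -> C) (d : R) : (forall k, Cmod (s k) <= d) -> lin_growth s.
Proof.
  intros H. exists d. intros k. apply Rle_trans with (1 := H k).
  assert (h := wt_ge1 k). assert (h1 := H k). assert (h2 := Cmod_ge_0 (s k)). nra.
Qed.

Definition Aadd (f g : rdseq) : rdseq := mkrd _ (RD_plus f g (co_RD f) (co_RD g)).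
Definition Amul (f g : rdseq) : rdseq := mkrd _ (RD_conv f g (co_RD f) (co_RD g)).
Definition Adiag (s : Z -> C) (H : lin_growth s) (f : rdseq) : rdseq :=
  mkrd _ (RD_diag s f H (co_RD f)).

Lemma growth_opp : lin_growth (fun _ => (-1)%C).
Proof. apply bounded_growth with 1. intros _. rewrite Cmod_R, Rabs_left; lra. Qed.

Definition Aopp (f : rdseq) : rdseq := Adiag _ growth_opp f.
Definition Asub (f g : rdseq) : rdseq := Aadd f (Aopp g).

Lemma RD_cst (c : C) : RD (fun k => if Z.eqb k 0 then c else 0%C).
Proof.
  intros m. exists (Cmod c). intros k. destruct (Z.eqb_spec k 0) as [->|h].
  - unfold wt. rewrite Rabs_R0, Rplus_0_r, pow1. lra.
  - rewrite Cmod_0, Rmult_0_l. apply Cmod_ge_0.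
Qed.

(** The coefficients of the constant function [c]: scalars become elements of the ring, and scaling
    becomes a product. *)
Definition Acst (c : C) : rdseq := mkrd _ (RD_cst c).

Lemma RD_conj (a : Z -> C) : RD a -> RD (fun k => Cconj (a (- k)%Z)).
Proof.
  intros Ha m. destruct (Ha m) as [c Hc]. exists c. intros k. rewrite Cmod_conj.
  rewrite <- wt_opp. apply Hc.
Qed.

(** The coefficients of the complex conjugate of the function, hence the reflected frequency. *)
Definition Aconj (f : rdseq) : rdseq := mkrd _ (RD_conj f (co_RD f)).

Lemma growth_D : lin_growth (fun k => RtoC (IZR k)).
Proof. exists 1. intros k. rewrite Cmod_R. unfold wt. lra. Qed.

Definition AD (f : rdseq) : rdseq := Adiag _ growth_D f.

Lemma growth_P : lin_growth (fun k => if Z.leb 0 k then 1%C else 0%C).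
Proof.
  apply bounded_growth with 1. intros k.
  destruct (Z.leb 0 k); rewrite Cmod_R, ?Rabs_R1, ?Rabs_R0; lra.
Qed.

Definition AP (f : rdseq) : rdseq := Adiag _ growth_P f.

Lemma RD_abs (a : Z -> C) : RD a -> RD (fun k => RtoC (Cmod (a k))).
Proof.
  intros Ha m. destruct (Ha m) as [c Hc]. exists c. intros k.
  rewrite Cmod_R, Rabs_pos_eq by apply Cmod_ge_0. apply Hc.
Qed.

Definition Aabs (f : rdseq) : rdseq := mkrd _ (RD_abs f (co_RD f)).

Declare Scope A_scope.
Delimit Scope A_scope with A.
Bind Scope A_scope with rdseq.
Notation "x + y" := (Aadd x y) : A_scope.
Notation "x - y" := (Asub x y) : A_scope.
Notation "x * y" := (Amul x y) : A_scope.
Notation "- x" := (Aopp x) : A_scope.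

Lemma Aadd_co (f g : rdseq) (k : Z) : (f + g)%A k = (f k + g k)%C.
Proof. reflexivity. Qed.

Lemma Aopp_co (f : rdseq) (k : Z) : (- f)%A k = (- f k)%C.
Proof. simpl. ring. Qed.

Lemma Asub_co (f g : rdseq) (k : Z) : (f - g)%A k = (f k - g k)%C.
Proof. simpl. ring. Qed.

Lemma AD_co (f : rdseq) (k : Z) : AD f k = (IZR k * f k)%C.
Proof. reflexivity. Qed.

Lemma AP_co (f : rdseq) (k : Z) : AP f k = ((if Z.leb 0 k then 1 else 0) * f k)%C.
Proof. reflexivity. Qed.

Lemma AP_le (f : rdseq) (k : Z) : Cmod (AP f k) <= Cmod (f k).
Proof.
  rewrite AP_co, Cmod_mult. assert (h := Cmod_ge_0 (f k)).
  destruct (Z.leb 0 k); rewrite Cmod_R, ?Rabs_R1, ?Rabs_R0; lra.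
Qed.

Lemma Amul_comm (f g : rdseq) : (f * g = g * f)%A.
Proof.
  apply rd_ext. intros n. simpl. unfold conv.
  destruct (CS_reflect (fun j => f j * g (n - j)%Z)%C n) as [_ h].
  - apply RD_terms; apply co_RD.
  - rewrite <- h. apply CS_ext. intros k.
    replace (n - (n - k))%Z with k by lia. ring.
Qed.

Lemma Amul_assoc (f g h : rdseq) : (f * (g * h) = f * g * h)%A.
Proof.
  apply rd_ext. intros n. simpl. unfold conv. symmetry.
  destruct (co_RD g 0%nat) as [c Hc].
  assert (Hcb : forall k, Cmod (g k) <= c) by (intros k; now apply (small_term 0)).
  assert (c0 := small_nonneg _ _ _ Hc).
  transitivity (ZSeriesC (fun k => ZSeriesC (fun j => f j * (g (k - j)%Z * h (n - k)%Z))%C)).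
  { apply CS_ext. intros k. rewrite Cmult_comm, <- CS_scal.
    - apply CS_ext. intros j. ring.
    - apply RD_terms; apply co_RD. }
  rewrite (CS_swap _ (fun k => c * Cmod (h (n - k)%Z)) (fun j => Cmod (f j))).
  - apply CS_ext. intros j. rewrite CS_scal.
    + f_equal.
      destruct (CS_shift (fun k => g (k - j)%Z * h (n - k)%Z)%C j) as [_ e].
      * destruct (CS_shift (fun k => g k * h (n - j - k)%Z)%C (- j)) as [e _].
        -- apply RD_terms; apply co_RD.
        -- unfold Csummable in *. apply summable_ext with (2 := e). intros k. simpl.
           do 2 f_equal. f_equal. lia.
      * rewrite <- e. apply CS_ext. intros k. f_equal; f_equal; lia.
    + destruct (CS_shift (fun k => g k * h (n - j - k)%Z)%C (- j)) as [e _].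
      * apply RD_terms; apply co_RD.
      * unfold Csummable in *. apply summable_ext with (2 := e). intros k. simpl.
        do 2 f_equal. f_equal. lia.
  - intros k j. rewrite !Cmod_mult.
    assert (H1 := Hcb (k - j)%Z). assert (H2 := Cmod_ge_0 (f j)).
    assert (H3 := Cmod_ge_0 (h (n - k)%Z)).
    rewrite (Rmult_comm (c * _)). apply Rmult_le_compat_l; auto.
    now apply Rmult_le_compat_r.
  - intros k. apply Rmult_le_pos; auto. apply Cmod_ge_0.
  - intros; apply Cmod_ge_0.
  - apply summable_scal.
    exact (proj1 (ZS_reflect (fun k => Cmod (h k)) n (RD_summable _ (co_RD h)))).
  - exact (RD_summable _ (co_RD f)).
Qed.

Lemma Amul_cst (c : C) (f : rdseq) (n : Z) : (Acst c * f)%A n = (c * f n)%C.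
Proof.
  simpl. unfold conv. rewrite CS_single.
  - simpl. now rewrite Z.sub_0_r.
  - intros k Hk. destruct (Z.eqb_spec k 0); [contradiction|]. ring.
Qed.

Lemma Amul_addl (f g h : rdseq) : ((f + g) * h = f * h + g * h)%A.
Proof.
  apply rd_ext. intros n. simpl. unfold conv. rewrite <- CS_plus.
  - apply CS_ext. intros k. ring.
  - apply RD_terms; apply co_RD.
  - apply RD_terms; apply co_RD.
Qed.

Lemma A_ring_theory : ring_theory (Acst 0) (Acst 1) Aadd Amul Asub Aopp (@eq rdseq).
Proof.
  split.
  - intros f. apply rd_ext. intros k. simpl. destruct (Z.eqb k 0); ring.
  - intros f g. apply rd_ext. intros k. simpl. ring.
  - intros f g h. apply rd_ext. intros k. simpl. ring.
  - intros f. apply rd_ext. intros k. rewrite Amul_cst. ring.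
  - exact Amul_comm.
  - exact Amul_assoc.
  - exact Amul_addl.
  - reflexivity.
  - intros f. apply rd_ext. intros k. simpl. destruct (Z.eqb k 0); ring.
Qed.

Add Ring A_ring : A_ring_theory.

Lemma Acst_mult (c d : C) : Acst (c * d) = (Acst c * Acst d)%A.
Proof.
  apply rd_ext. intros k. rewrite Amul_cst. simpl. destruct (Z.eqb k 0); ring.
Qed.

Lemma Acst_plus (c d : C) : Acst (c + d) = (Acst c + Acst d)%A.
Proof. apply rd_ext. intros k. simpl. destruct (Z.eqb k 0); ring. Qed.

Lemma Acst_opp (c : C) : Acst (- c) = (- Acst c)%A.
Proof. apply rd_ext. intros k. simpl. destruct (Z.eqb k 0); ring. Qed.

Lemma AD_add (f g : rdseq) : (AD (f + g) = AD f + AD g)%A.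
Proof. apply rd_ext. intros k. simpl. ring. Qed.

Lemma AP_add (f g : rdseq) : (AP (f + g) = AP f + AP g)%A.
Proof. apply rd_ext. intros k. simpl. ring. Qed.

Lemma AD_mul (f g : rdseq) : (AD (f * g) = AD f * g + f * AD g)%A.
Proof.
  apply rd_ext. intros n. simpl. unfold conv.
  assert (H1 : Csummable (fun j => AD f j * g (n - j)%Z)%C) by (apply RD_terms; apply co_RD).
  assert (H2 : Csummable (fun j => f j * AD g (n - j)%Z)%C) by (apply RD_terms; apply co_RD).
  simpl in H1, H2. rewrite <- CS_scal, <- CS_plus; auto.
  - apply CS_ext. intros j. rewrite minus_IZR, RtoC_minus. ring.
  - apply RD_terms; apply co_RD.
Qed.

Lemma AD_cst (c : C) : AD (Acst c) = Acst 0.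
Proof.
  apply rd_ext. intros k. simpl. destruct (Z.eqb_spec k 0) as [->|]; ring.
Qed.

Lemma AP_cst_mul (c : C) (f : rdseq) : AP (Acst c * f) = (Acst c * AP f)%A.
Proof.
  apply rd_ext. intros k. rewrite Amul_cst, !AP_co, Amul_cst. ring.
Qed.

Lemma AP_D (f : rdseq) : AP (AD f) = AD (AP f).
Proof. apply rd_ext. intros k. simpl. ring. Qed.

Lemma Aconj_add (f g : rdseq) : (Aconj (f + g) = Aconj f + Aconj g)%A.
Proof. apply rd_ext. intros k. simpl. now rewrite Cplus_conj. Qed.

Lemma Aconj_mul (f g : rdseq) : (Aconj (f * g) = Aconj f * Aconj g)%A.
Proof.
  apply rd_ext. intros n. simpl. unfold conv. rewrite <- CS_conj.
  assert (Hs : Csummable (fun j => Aconj f j * Aconj g (n - j)%Z)%C) by (apply RD_terms; apply co_RD).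
  destruct (CS_reflect _ 0 Hs) as [_ h]. simpl in h. rewrite <- h.
  apply CS_ext. intros k. rewrite Cmult_conj. do 3 f_equal; lia.
Qed.

Lemma Aconj_cst (c : C) : Aconj (Acst c) = Acst (Cconj c).
Proof.
  apply rd_ext. intros k. simpl.
  destruct (Z.eqb_spec k 0) as [->|h]; simpl; auto.
  destruct (Z.eqb_spec (- k) 0); [lia|]. apply Cconj_RtoC.
Qed.

Lemma Aconj_conj (f : rdseq) : Aconj (Aconj f) = f.
Proof. apply rd_ext. intros k. simpl. now rewrite Z.opp_involutive, Cconj_conj. Qed.

Lemma Aconj_D (f : rdseq) : Aconj (AD f) = (- AD (Aconj f))%A.
Proof.
  apply rd_ext. intros k. simpl.
  rewrite Cmult_conj, opp_IZR, RtoC_opp, Copp_conj, Cconj_RtoC. ring.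
Qed.

(** * Hardy space identities and the Lax pair *)

(** Functions without negative frequencies form an algebra: if n < 0, one of k and n - k is
    negative. *)
Lemma AP_mul_pos (f h : rdseq) : (AP (AP f * AP h) = AP f * AP h)%A.
Proof.
  apply rd_ext. intros n. rewrite AP_co. destruct (Z.leb_spec 0 n) as [Hn|Hn]; [ring|].
  simpl. unfold conv. rewrite (CS_ext _ (fun k => 0 * 0)%C).
  - rewrite CS_single; intros; ring.
  - intros k. destruct (Z.leb_spec 0 k); destruct (Z.leb_spec 0 (n - k)); try lia; ring.
Qed.

(** [Aconj (AP f)] has only nonpositive frequencies, so against a negative frequency of [h] it
    produces only negative ones, which [AP] removes. *)
Lemma AP_mul_neg (f h : rdseq) : AP (Aconj (AP f) * h) = AP (Aconj (AP f) * AP h).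
Proof.
  apply rd_ext. intros n. rewrite !AP_co. destruct (Z.leb_spec 0 n) as [Hn|Hn]; [|ring].
  f_equal. simpl. unfold conv. apply CS_ext. intros k.
  destruct (Z.leb_spec 0 (- k)); destruct (Z.leb_spec 0 (n - k)); try lia;
  rewrite ?Cmult_conj, ?Cconj_RtoC; ring.
Qed.

(** For real [g] the two halves of the spectrum of [AD g] mirror each other with opposite signs.
    Frequency 0 is kept by both projections but carries nothing after differentiation. *)
Lemma AD_real (g : rdseq) : Aconj g = g ->
  AD g = (AP (AD g) - Aconj (AP (AD g)))%A.
Proof.
  intros Hg. apply rd_ext. intros k.
  assert (Hk : Cconj (g (- k)%Z) = g k) by (rewrite <- Hg at 2; reflexivity).
  rewrite Asub_co. simpl.
  rewrite opp_IZR, RtoC_opp, !Cmult_conj, Copp_conj, Hk, Cconj_RtoC.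
  destruct (Z.leb_spec 0 k); destruct (Z.leb_spec 0 (- k)); try lia;
    rewrite ?Cconj_RtoC; try ring.
  assert (k = 0%Z) by lia. subst k. ring.
Qed.

(* A function is identified with its sequence of Fourier coefficients: [opL] is the Lax operator L,
   [opB beta V u] the generator B + i V, and [dX u u'] the derivative of [opX] at [u] in the direction [u']. *)
Definition opX (u f : rdseq) : rdseq := (u * AP (Aconj u * f))%A.
Definition opL (beta : R) (u f : rdseq) : rdseq := (AD f + Acst beta * opX u f)%A.
Definition opB (beta : R) (V u f : rdseq) : rdseq :=
  (Acst Ci * AD (AD f) + Acst (2 * beta) * Acst Ci * (u * AP (AD (Aconj u * f)))
   + Acst Ci * V * f)%A.
Definition dX (u u' f : rdseq) : rdseq :=
  (u' * AP (Aconj u * f) + u * AP (Aconj u' * f))%A.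

Lemma AD_cst_mul (c : C) (f : rdseq) : AD (Acst c * f) = (Acst c * AD f)%A.
Proof. rewrite AD_mul, AD_cst. ring. Qed.

Lemma Aconj_AD2 (f : rdseq) : Aconj (AD (AD f)) = AD (AD (Aconj f)).
Proof. apply rd_ext. intros k. simpl.
  rewrite !Cmult_conj, opp_IZR, RtoC_opp, Copp_conj, Cconj_RtoC. ring. Qed.

Lemma AP_opp (f : rdseq) : AP (- f) = (- AP f)%A.
Proof. apply rd_ext. intros k. rewrite Aopp_co, !AP_co, Aopp_co. ring. Qed.

Lemma AD_opp (f : rdseq) : AD (- f) = (- AD f)%A.
Proof. apply rd_ext. intros k. rewrite Aopp_co, !AD_co, Aopp_co. ring. Qed.

(** With [p = AP (AD g)], the conjugate of [p] is [p - AD g] by [AD_real]. By [AP_mul_neg] it sees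
    only [AP q], and [p * AP q] is fixed by [AP]. *)
Lemma AP_conj_mul (g q : rdseq) : Aconj g = g ->
  AP (Aconj (AP (AD g)) * q) = (AP (AD g) * AP q - AP (AD g * AP q))%A.
Proof.
  intros Hg. rewrite AP_mul_neg, <- AP_mul_pos.
  rewrite (AD_real g Hg) at 3.
  set (p := AP (AD g)). set (pc := Aconj p).
  replace ((p - pc) * AP q)%A with (p * AP q + - (pc * AP q))%A by ring.
  rewrite AP_add, AP_opp. ring.
Qed.

(* With [Y f = u P D (conj u f)], the key point is [Y X - X Y = u P ((D |u|^2) P (conj u _))]. *)
Lemma lax (beta : R) (V u b : rdseq) : Aconj V = V ->
  (Acst beta * dX u (opB beta V u u) b =
   opB beta V u (opL beta u b) - opL beta u (opB beta V u b) + Acst Ci * AD V * b)%A.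
Proof.
  intros HV. unfold dX, opL, opX.
  set (g := (Aconj u * u)%A).
  assert (Hg : Aconj g = g) by (unfold g; rewrite Aconj_mul, Aconj_conj; ring).
  (* Every projection in the identity is to be expressed through [p], [Q], [R1], [R2], [G1], [G2]
     and [PV]; what is left is a polynomial identity. *)
  set (q := (Aconj u * b)%A). set (Q := AP q).
  set (R1 := AP (AD (Aconj u) * b)). set (R2 := AP (AD (AD (Aconj u)) * b)).
  set (G1 := AP (AD g * Q)). set (G2 := AP (g * AD Q)). set (PV := AP (V * q)).
  set (p := AP (AD g)). set (I := Acst Ci). set (bA := Acst beta).
  assert (HI : Aconj I = (- I)%A).
  { unfold I. now rewrite Aconj_cst, Cconj_Ci, Acst_opp. }
  assert (H2 : Acst (2 * beta) = (bA + bA)%A).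
  { unfold bA. rewrite <- Acst_plus. f_equal. ring. }
  assert (Pc : forall c f, AP (Acst c * f) = (Acst c * AP f)%A) by apply AP_cst_mul.
  assert (Pb : forall f, AP (bA * f) = (bA * AP f)%A) by (intros; apply Pc).
  assert (PI : forall f, AP (I * f) = (I * AP f)%A) by (intros; apply Pc).
  assert (Pn := AP_opp).
  assert (Db : forall f, AD (bA * f) = (bA * AD f)%A) by (intros; apply AD_cst_mul).
  assert (DI : forall f, AD (I * f) = (I * AD f)%A) by (intros; apply AD_cst_mul).
  assert (Dn := AD_opp).
  assert (E0 : opB beta V u u = (I * AD (AD u) + (bA + bA) * I * (u * p) + I * V * u)%A).
  { unfold opB. now rewrite H2. }
  assert (EPDQ : AP (AD q) = AD Q) by apply AP_D.
  assert (EB : opB beta V u b = (I * AD (AD b) + (bA + bA) * I * (u * AD Q) + I * V * b)%A).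
  { unfold opB. now rewrite H2, <- EPDQ. }
  (* The only place that uses more of [AP] than its linearity and its commutation with [AD]. *)
  assert (E1 : AP (Aconj (opB beta V u u) * b) =
    (- (I * R2) - (bA + bA) * I * (p * Q - G1) - I * PV)%A).
  { rewrite E0, !Aconj_add, !Aconj_mul, !Aconj_add, HI, HV, Aconj_AD2.
    replace (Aconj bA) with bA.
    2: { unfold bA. now rewrite Aconj_cst, Cconj_RtoC. }
    replace ((- I * AD (AD (Aconj u)) + (bA + bA) * - I * (Aconj u * Aconj p) + - I * V * Aconj u) * b)%A
      with (- (I * (AD (AD (Aconj u)) * b)) + (- (bA * (I * (Aconj p * q))) + - (bA * (I * (Aconj p * q))) + - (I * (V * q))))%A
      by (unfold q; ring).
    rewrite !AP_add, !Pn, !Pb, !PI.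
    unfold p at 1 2. rewrite (AP_conj_mul g q Hg).
    fold p Q G1 PV R2. ring. }
  assert (EDq : AP (Aconj u * AD b) = (AD Q - R1)%A).
  { replace (Aconj u * AD b)%A with (AD q + - (AD (Aconj u) * b))%A
      by (unfold q; rewrite AD_mul; ring).
    rewrite AP_add, Pn, EPDQ. fold R1. ring. }
  assert (EgQ : AP (AD (g * Q)) = (G1 + G2)%A).
  { rewrite AD_mul, AP_add. reflexivity. }
  assert (E2 : AP (AD (Aconj u * (AD b + bA * (u * Q)))) = (AD (AD Q - R1) + bA * (G1 + G2))%A).
  { replace (Aconj u * (AD b + bA * (u * Q)))%A with (Aconj u * AD b + bA * (g * Q))%A
      by (unfold g; ring).
    now rewrite AD_add, AP_add, Db, Pb, EgQ, AP_D, EDq. }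
  assert (E3 : AP (Aconj u * opB beta V u b) =
     (I * (AD (AD Q) - (AD R1 + AD R1) + R2) + (bA + bA) * I * G2 + I * PV)%A).
  { rewrite EB.
    replace (Aconj u * (I * AD (AD b) + (bA + bA) * I * (u * AD Q) + I * V * b))%A
      with (I * (Aconj u * AD (AD b)) + (bA * (I * (g * AD Q)) + bA * (I * (g * AD Q)) + I * (V * q)))%A
      by (unfold g, q; ring).
    replace (Aconj u * AD (AD b))%A
      with (AD (AD q) + (- AD (AD (Aconj u) * b) + - AD (AD (Aconj u) * b)) + AD (AD (Aconj u)) * b)%A
      by (unfold q; rewrite !AD_mul, !AD_add, !AD_mul; ring).
    rewrite !AP_add, !Pb, !PI, !AP_add, !Pn, !AP_D. fold Q R1 R2 G2 PV. ring. }
  rewrite E1, E3.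
  replace (opB beta V u (AD b + bA * (u * Q)))%A
    with (I * AD (AD (AD b + bA * (u * Q))) + (bA + bA) * I * (u * (AD (AD Q - R1) + bA * (G1 + G2)))
      + I * V * (AD b + bA * (u * Q)))%A
    by (unfold opB; rewrite H2, E2; reflexivity).
  rewrite E0, EB. unfold Asub.
  rewrite !AD_add, !Db, !AD_mul, !AD_add, !AD_mul, !Dn.
  replace (AD I) with (Acst 0) by (symmetry; apply AD_cst).
  replace (AD bA) with (Acst 0) by (symmetry; apply AD_cst).
  ring.
Qed.

(** * The l^2 inner product and norm *)

Lemma quadratic_nonneg (a b c : R) : (forall x, 0 <= a * x ^ 2 + 2 * b * x + c) ->
  0 <= a -> b ^ 2 <= a * c.
Proof.
  intros H Ha. destruct (Req_dec a 0) as [->|h].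
  - destruct (Req_dec b 0) as [->|hb]; [lra|].
    assert (h1 := H (- (c + 1) / (2 * b))). exfalso.
    replace (0 * (- (c + 1) / (2 * b)) ^ 2 + 2 * b * (- (c + 1) / (2 * b)) + c) with (-1) in h1
      by (field; auto). lra.
  - assert (h1 := H (- b / a)). apply Rmult_le_reg_r with (/ a).
    + apply Rinv_0_lt_compat. lra.
    + replace (a * c * / a) with c by (field; auto).
      replace (a * (- b / a) ^ 2 + 2 * b * (- b / a) + c) with (c - b ^ 2 * / a) in h1
        by (field; auto). lra.
Qed.

(** The discriminant argument. The pointwise hypothesis [c k ^ 2 <= A k * B k] lets weights be
    shared between [A] and [B] at will. *)
Lemma ZS_CS (A B c : Z -> R) : (forall k, 0 <= A k) -> (forall k, 0 <= B k) ->
  (forall k, c k ^ 2 <= A k * B k) -> summable A -> summable B ->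
  summable c /\ ZSeriesR c ^ 2 <= ZSeriesR A * ZSeriesR B.
Proof.
  intros HA HB Hc SA SB.
  assert (Hs : summable c).
  { apply summable_le with (fun k => A k + B k); [|now apply summable_plus].
    intros k. assert (h1 := HA k). assert (h2 := HB k). assert (h3 := Hc k).
    apply Rabs_le. split; nra. }
  split; auto. apply quadratic_nonneg; [|now apply ZS_pos].
  intros x.
  replace (ZSeriesR A * x ^ 2 + 2 * ZSeriesR c * x + ZSeriesR B)
    with (ZSeriesR (fun k => x ^ 2 * A k + (2 * x * c k + B k))).
  - apply ZS_pos; [repeat apply summable_plus; auto using summable_scal|].
    intros k. assert (h1 := HA k). assert (h2 := HB k). assert (h3 := Hc k).
    destruct (Req_dec (A k) 0) as [e|e].
    + rewrite e in *. assert (c k = 0) by nra. rewrite H. lra.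
    + assert (0 < A k) by lra.
      apply Rmult_le_reg_l with (A k); auto. rewrite Rmult_0_r.
      replace (A k * (x ^ 2 * A k + (2 * x * c k + B k)))
        with ((A k * x + c k) ^ 2 + (A k * B k - c k ^ 2)) by ring.
      assert (h4 := pow2_ge_0 (A k * x + c k)). lra.
  - rewrite !ZS_plus; auto using summable_plus, summable_scal. rewrite !ZS_scal. ring.
Qed.

Definition norm2 (f : rdseq) : R := ZSeriesR (fun k => Cmod (f k) ^ 2).
Definition nrm (f : rdseq) : R := sqrt (norm2 f).
Definition l1 (f : rdseq) : R := ZSeriesR (fun k => Cmod (f k)).
(** The mean of [f] times the conjugate of [g], read off as a coefficient at frequency 0, so that
    the adjoint of a multiplication is a matter of [ring]. *)
Definition ip (f g : rdseq) : C := (f * Aconj g)%A 0%Z.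

Lemma rd_bound (m : nat) (f : rdseq) : exists c, 0 <= c /\ forall k, Cmod (f k) * wt k ^ m <= c.
Proof.
  destruct (co_RD f m) as [c Hc]. exists c. split; auto. now apply small_nonneg in Hc.
Qed.

Lemma l1_summable (f : rdseq) : summable (fun k => Cmod (f k)).
Proof. exact (RD_summable _ (co_RD f)). Qed.

Lemma sq_summable (f : rdseq) : summable (fun k => Cmod (f k) ^ 2).
Proof.
  destruct (co_RD f 0%nat) as [c Hc].
  apply summable_le with (fun k => c * Cmod (f k)).
  - intros k. assert (h := small_term 0 c f k Hc). assert (h1 := Cmod_ge_0 (f k)).
    rewrite Rabs_pos_eq; nra.
  - apply summable_scal, l1_summable.
Qed.

Lemma norm2_pos (f : rdseq) : 0 <= norm2 f.
Proof. apply ZS_pos; [apply sq_summable|]. intros k. apply pow2_ge_0. Qed.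

Lemma nrm_pos (f : rdseq) : 0 <= nrm f.
Proof. apply sqrt_pos. Qed.

Lemma nrm_sq (f : rdseq) : nrm f * nrm f = norm2 f.
Proof. apply sqrt_sqrt, norm2_pos. Qed.

Lemma l1_pos (f : rdseq) : 0 <= l1 f.
Proof. apply ZS_pos; [apply l1_summable|]. intros; apply Cmod_ge_0. Qed.

Lemma nrm_le (f g : rdseq) : (forall k, Cmod (f k) <= Cmod (g k)) -> nrm f <= nrm g.
Proof.
  intros H. apply sqrt_le_1_alt. apply ZS_le; try apply sq_summable.
  intros k. apply pow_incr. split; auto. apply Cmod_ge_0.
Qed.

Lemma nrm_term (f : rdseq) (k : Z) : Cmod (f k) <= nrm f.
Proof.
  apply Rsqr_incr_0; [|apply Cmod_ge_0|apply nrm_pos].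
  unfold Rsqr. rewrite nrm_sq.
  replace (Cmod (f k) * Cmod (f k)) with (Cmod (f k) ^ 2) by ring.
  apply (term_le_ZS (fun k => Cmod (f k) ^ 2)); [apply sq_summable|].
  intros j. apply pow2_ge_0.
Qed.

(** The factor 2 exceeds the square root of 3, the bound on the sum of [/ wt k ^ 2]. *)
Lemma nrm_small (c : R) (f : rdseq) : small 1 c f -> nrm f <= 2 * c.
Proof.
  intros H. assert (c0 := small_nonneg _ _ _ H).
  apply Rsqr_incr_0; [|apply nrm_pos|lra]. unfold Rsqr. rewrite nrm_sq.
  destruct sum_wt as [h1 h2].
  apply Rle_trans with (ZSeriesR (fun k => c ^ 2 * / wt k ^ 2)).
  - apply ZS_le; auto using sq_summable, summable_scal. intros k.
    assert (h := small_div 1 c f k H). rewrite pow_1 in h.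
    rewrite <- pow_inv, <- Rpow_mult_distr. apply pow_incr. split; auto. apply Cmod_ge_0.
  - rewrite ZS_scal. nra.
Qed.

Lemma ip_sum (f g : rdseq) : ip f g = ZSeriesC (fun k => f k * Cconj (g k))%C.
Proof.
  unfold ip. simpl. unfold conv. apply CS_ext. intros k. do 3 f_equal. lia.
Qed.

Lemma ip_terms (f g : rdseq) : Csummable (fun k => f k * Cconj (g k))%C.
Proof.
  destruct (co_RD g 0%nat) as [c Hc]. apply Csummable_le with (fun k => c * Cmod (f k)).
  - intros k. rewrite Cmod_mult, Cmod_conj, Rmult_comm.
    apply Rmult_le_compat_r; [apply Cmod_ge_0|]. now apply (small_term 0).
  - apply summable_scal, l1_summable.
Qed.

Lemma ip_self (f : rdseq) : ip f f = RtoC (norm2 f).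
Proof.
  rewrite ip_sum. rewrite (CS_ext _ (fun k => RtoC (Cmod (f k) ^ 2))).
  - unfold ZSeriesC, RtoC; simpl. f_equal.
    rewrite (ZS_ext _ (fun k => 0 * 0)); [rewrite ZS_scal|intros]; ring.
  - intros k. now rewrite <- Cmod2_conj, RtoC_pow.
Qed.

Lemma ip_CS (f g : rdseq) : Cmod (ip f g) <= nrm f * nrm g.
Proof.
  rewrite ip_sum. apply Rle_trans with (1 := CS_norm _ (ip_terms f g)).
  destruct (ZS_CS (fun k => Cmod (f k) ^ 2) (fun k => Cmod (g k) ^ 2)
     (fun k => Cmod (f k * Cconj (g k))%C)) as [h1 h2]; try apply sq_summable.
  - intros; apply pow2_ge_0.
  - intros; apply pow2_ge_0.
  - intros k. rewrite Cmod_mult, Cmod_conj. right; ring.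
  - apply Rsqr_incr_0.
    + unfold Rsqr. fold (norm2 f) (norm2 g) in h2. rewrite <- !nrm_sq in h2. lra.
    + apply ZS_pos; auto. intros; apply Cmod_ge_0.
    + apply Rmult_le_pos; apply nrm_pos.
Qed.

Lemma ip_addl (f g h : rdseq) : ip (f + g) h = (ip f h + ip g h)%C.
Proof. unfold ip. rewrite Amul_addl. reflexivity. Qed.

Lemma ip_conj (f g : rdseq) : ip g f = Cconj (ip f g).
Proof.
  unfold ip. replace (g * Aconj f)%A with (Aconj (f * Aconj g)).
  - reflexivity.
  - rewrite Aconj_mul, Aconj_conj. ring.
Qed.

Lemma ip_addr (f g h : rdseq) : ip f (g + h) = (ip f g + ip f h)%C.
Proof. rewrite ip_conj, ip_addl, Cplus_conj, <- !ip_conj. reflexivity. Qed.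

Lemma ip_cstl (c : C) (f g : rdseq) : ip (Acst c * f) g = (c * ip f g)%C.
Proof.
  unfold ip. rewrite <- Amul_cst. f_equal. ring.
Qed.

Lemma ip_cstr (c : C) (f g : rdseq) : ip f (Acst c * g) = (Cconj c * ip f g)%C.
Proof. rewrite ip_conj, ip_cstl, Cmult_conj, <- ip_conj. reflexivity. Qed.

Lemma ip_oppl (f g : rdseq) : ip (- f) g = (- ip f g)%C.
Proof.
  replace (- f)%A with (Acst (- (1)) * f)%A by (rewrite Acst_opp; ring).
  rewrite ip_cstl. ring.
Qed.

Lemma ip_oppr (f g : rdseq) : ip f (- g) = (- ip f g)%C.
Proof. rewrite ip_conj, ip_oppl, Copp_conj, <- ip_conj. reflexivity. Qed.

Lemma ip_mul (u f g : rdseq) : ip (u * f) g = ip f (Aconj u * g).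
Proof. unfold ip. rewrite Aconj_mul, Aconj_conj. f_equal. ring. Qed.

Lemma ip_D (f g : rdseq) : ip (AD f) g = ip f (AD g).
Proof.
  rewrite !ip_sum. apply CS_ext. intros k. simpl.
  rewrite Cmult_conj, Cconj_RtoC. ring.
Qed.

Lemma ip_P (f g : rdseq) : ip (AP f) g = ip f (AP g).
Proof.
  rewrite !ip_sum. apply CS_ext. intros k. simpl.
  rewrite Cmult_conj. destruct (Z.leb 0 k); rewrite Cconj_RtoC; ring.
Qed.

Lemma ip_X (u f g : rdseq) : ip (opX u f) g = ip f (opX u g).
Proof.
  unfold opX. rewrite ip_mul, ip_P, (ip_mul (Aconj u)), Aconj_conj. reflexivity.
Qed.

Lemma ip_L (beta : R) (u f g : rdseq) : ip (opL beta u f) g = ip f (opL beta u g).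
Proof.
  unfold opL. now rewrite ip_addl, ip_addr, ip_cstl, ip_cstr, ip_D, ip_X, Cconj_RtoC.
Qed.

(** For real [V] every summand is [Ci] times a self-adjoint operator. Applied to [u] itself this
    conserves the mass; in the Lax computation it moves the generator across the pairing. *)
Lemma ip_B (beta : R) (V u f g : rdseq) : Aconj V = V ->
  ip (opB beta V u f) g = (- ip f (opB beta V u g))%C.
Proof.
  intros HV. unfold opB.
  rewrite <- !(Amul_assoc (Acst _)), !ip_addl, !ip_addr, !ip_cstl, !ip_cstr.
  rewrite !ip_D, !ip_mul, HV, ip_P, ip_D, (ip_mul (Aconj u)), Aconj_conj, <- AP_D.
  rewrite Cmult_conj, !Cconj_RtoC, Cconj_Ci.
  ring.
Qed.

Lemma nrm_cst (c : C) (f : rdseq) : nrm (Acst c * f) = Cmod c * nrm f.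
Proof.
  unfold nrm, norm2. rewrite (ZS_ext _ (fun k => Cmod c ^ 2 * Cmod (f k) ^ 2)).
  - rewrite ZS_scal, sqrt_mult_alt by apply pow2_ge_0.
    rewrite sqrt_pow2 by apply Cmod_ge_0. reflexivity.
  - intros k. rewrite Amul_cst, Cmod_mult. ring.
Qed.

Lemma nrm_opp (f : rdseq) : nrm (- f) = nrm f.
Proof.
  unfold nrm, norm2. f_equal. apply ZS_ext. intros k. now rewrite Aopp_co, Cmod_opp.
Qed.

Lemma norm2_add (f g : rdseq) : norm2 (f + g) = norm2 f + 2 * fst (ip f g) + norm2 g.
Proof.
  assert (H := ip_self (f + g)).
  rewrite ip_addl, !ip_addr, !ip_self, (ip_conj f g) in H.
  apply (f_equal fst) in H. unfold Cplus, Cconj, RtoC in H. cbn [fst snd] in H. lra.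
Qed.

Lemma nrm_add (f g : rdseq) : nrm (f + g) <= nrm f + nrm g.
Proof.
  assert (h1 := nrm_pos f). assert (h2 := nrm_pos g).
  apply Rsqr_incr_0; [|apply nrm_pos|lra]. unfold Rsqr. rewrite nrm_sq, norm2_add, <- !nrm_sq.
  assert (h3 := fst_le_Cmod (ip f g)). assert (h4 := ip_CS f g).
  assert (h5 := Rle_abs (fst (ip f g))). nra.
Qed.

Lemma nrm_sub (f g : rdseq) : nrm (f - g) <= nrm f + nrm g.
Proof. unfold Asub. rewrite <- (nrm_opp g). apply nrm_add. Qed.

(** * Convolution estimates and the relative bound on [opX] *)

Lemma ZS_conv (a b : Z -> R) (ca cb : R) :
  (forall k, Rabs (a k) * wt k ^ 4 <= ca) -> (forall k, Rabs (b k) * wt k ^ 2 <= cb) ->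
  summable (fun n => ZSeriesR (fun j => a j * b (n - j)%Z)) /\
  ZSeriesR (fun n => ZSeriesR (fun j => a j * b (n - j)%Z)) = ZSeriesR a * ZSeriesR b.
Proof.
  intros Ha Hb. destruct sum_wt as [h1 _].
  assert (cb0 : 0 <= cb).
  { apply Rle_trans with (2 := Hb 0%Z). assert (h := wt_pow_ge1 2 0).
    assert (h' := Rabs_pos (b 0%Z)). nra. }
  assert (ca0 : 0 <= ca).
  { apply Rle_trans with (2 := Ha 0%Z). assert (h := wt_pow_ge1 4 0).
    assert (h' := Rabs_pos (a 0%Z)). nra. }
  assert (Hb' : forall k, Rabs (b k) <= cb * / wt k ^ 2).
  { intros k. apply le_div_wt, Hb. }
  assert (Sb : summable b) by (apply summable_le with (1 := Hb'); now apply summable_scal).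
  assert (Hdom : forall n j, Rabs (a j * b (n - j)%Z) <= (cb * / wt n ^ 2) * (ca * / wt j ^ 2)).
  { intros n j. rewrite Rabs_mult. apply conv_dominated; auto using Rabs_pos. }
  split.
  - apply summable_ZS with (1 := Hdom); now apply summable_scal.
  - rewrite (ZS_swap _ _ _ Hdom); try now apply summable_scal.
    + rewrite Rmult_comm, <- ZS_scal. apply ZS_ext. intros j. rewrite ZS_scal, Rmult_comm.
      f_equal. destruct (ZS_shift b (- j)%Z Sb) as [_ e]. rewrite <- e.
      apply ZS_ext. intros k. f_equal.
    + intros k. apply Rmult_le_pos; auto using wt_inv_nonneg.
    + intros k. apply Rmult_le_pos; auto using wt_inv_nonneg.
Qed.

Lemma abs_conv (f g : rdseq) (n : Z) :
  (Aabs f * Aabs g)%A n = RtoC (ZSeriesR (fun j => Cmod (f j) * Cmod (g (n - j)%Z))).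
Proof.
  simpl. unfold conv, ZSeriesC, RtoC; simpl. f_equal.
  - apply ZS_ext. intros k. ring.
  - rewrite (ZS_ext _ (fun k => 0 * 0)); [rewrite ZS_scal|intros]; ring.
Qed.

Lemma abs_terms (f g : rdseq) (n : Z) : summable (fun j => Cmod (f j) * Cmod (g (n - j)%Z)).
Proof.
  apply summable_ext with (2 := RD_terms f g n (co_RD f) (co_RD g)).
  intros j. apply Cmod_mult.
Qed.

(** Passing to moduli of coefficients loses the phases, but it allows a projection to be dropped and
    the factors to be regrouped. *)
Lemma conv_dom (f g f' g' : rdseq) : (forall k, Cmod (f k) <= Cmod (f' k)) ->
  (forall k, Cmod (g k) <= Cmod (g' k)) ->
  forall n, Cmod ((f * g)%A n) <= Cmod ((Aabs f' * Aabs g')%A n).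
Proof.
  intros Hf Hg n. rewrite abs_conv, Cmod_R. apply Rle_trans with (2 := Rle_abs _).
  simpl. unfold conv. apply Rle_trans with (1 := CS_norm _ (RD_terms f g n (co_RD f) (co_RD g))).
  apply ZS_le.
  - exact (RD_terms f g n (co_RD f) (co_RD g)).
  - apply abs_terms.
  - intros j. rewrite Cmod_mult. apply Rmult_le_compat; auto; apply Cmod_ge_0.
Qed.

Lemma Aabs_conv (f g : rdseq) : Aabs (Aabs f * Aabs g) = (Aabs f * Aabs g)%A.
Proof.
  apply rd_ext. intros k.
  change (RtoC (Cmod ((Aabs f * Aabs g)%A k)) = (Aabs f * Aabs g)%A k).
  rewrite abs_conv, Cmod_R, Rabs_pos_eq; auto.
  apply ZS_pos; [apply abs_terms|]. intros j. apply Rmult_le_pos; apply Cmod_ge_0.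
Qed.

Lemma rd_sq_bound (m : nat) (f : rdseq) :
  exists c, forall k, Rabs (Cmod (f k) ^ 2) * wt k ^ m <= c.
Proof.
  destruct (rd_bound m f) as [c [c0 Hc]]. exists (c * c). intros k.
  rewrite Rabs_pos_eq by apply pow2_ge_0.
  assert (h := Hc k). assert (h1 := wt_pow_ge1 m k). assert (h2 := Cmod_ge_0 (f k)).
  replace (Cmod (f k) ^ 2 * wt k ^ m) with (Cmod (f k) * (Cmod (f k) * wt k ^ m)) by ring.
  apply Rmult_le_compat; auto; nra.
Qed.

(** The common frame of [young] and [quartic]: a Cauchy-Schwarz inequality at each output frequency,
    with a factor [A] uniform in [n], is summed by [ZS_conv]. *)
Lemma norm2_conv_le (f g : rdseq) (A : R) (p q : Z -> R) (cp cq : R) :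
  (forall k, Rabs (p k) * wt k ^ 4 <= cp) -> (forall k, Rabs (q k) * wt k ^ 2 <= cq) ->
  (forall n, ZSeriesR (fun j => Cmod (f j) * Cmod (g (n - j)%Z)) ^ 2 <=
     A * ZSeriesR (fun j => p j * q (n - j)%Z)) ->
  norm2 (f * g) <= A * (ZSeriesR p * ZSeriesR q).
Proof.
  intros Hp Hq H. destruct (ZS_conv p q cp cq Hp Hq) as [h1 h2].
  rewrite <- h2, <- ZS_scal. apply ZS_le; [apply sq_summable|now apply summable_scal|].
  intros n. apply Rle_trans with (2 := H n). apply pow_incr. split; [apply Cmod_ge_0|].
  apply Rle_trans with (1 := conv_dom f g f g (fun k => Rle_refl _) (fun k => Rle_refl _) n).
  rewrite abs_conv, Cmod_R, Rabs_pos_eq; [lra|].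
  apply ZS_pos; [apply abs_terms|]. intros j. apply Rmult_le_pos; apply Cmod_ge_0.
Qed.

(** Cauchy-Schwarz after splitting |f_j| |g_(n-j)| into |f_j|^(1/2) and |f_j|^(1/2) |g_(n-j)|. *)
Lemma young (f g : rdseq) : nrm (f * g) <= l1 f * nrm g.
Proof.
  apply Rsqr_incr_0; [|apply nrm_pos|apply Rmult_le_pos; [apply l1_pos|apply nrm_pos]].
  unfold Rsqr. rewrite nrm_sq.
  replace (l1 f * nrm g * (l1 f * nrm g)) with (l1 f * (l1 f * norm2 g))
    by (rewrite <- nrm_sq; ring).
  destruct (rd_bound 4 f) as [c [_ Hc]]. destruct (rd_sq_bound 2 g) as [c' Hc'].
  apply (norm2_conv_le f g (l1 f) (fun k => Cmod (f k)) (fun k => Cmod (g k) ^ 2) c c'); auto.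
  - intros k. rewrite Rabs_pos_eq by apply Cmod_ge_0. apply Hc.
  - intros n. assert (Hs : summable (fun j => Cmod (f j) * Cmod (g (n - j)%Z) ^ 2)).
    { destruct (rd_bound 0 g) as [d [d0 Hd]].
      apply summable_le with (fun j => d ^ 2 * Cmod (f j)); [|apply summable_scal, l1_summable].
      intros j. assert (h := Hd (n - j)%Z). simpl in h. rewrite Rmult_1_r in h.
      assert (h1 := Cmod_ge_0 (f j)). assert (h2 := Cmod_ge_0 (g (n - j)%Z)).
      rewrite Rabs_pos_eq; [|apply Rmult_le_pos; auto; apply pow2_ge_0].
      rewrite Rmult_comm. apply Rmult_le_compat_r; auto. now apply pow_incr. }
    apply ZS_CS; auto.
    + intros; apply Cmod_ge_0.
    + intros; apply Rmult_le_pos; [apply Cmod_ge_0|apply pow2_ge_0].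
    + intros. right. ring.
    + apply l1_summable.
Qed.

(** Of order 1 up to frequency [N] and of order |k| / N beyond: the H^(1/2) weight rescaled to
    frequency [N]. *)
Definition wN (N : R) (k : Z) : R := 1 + Rabs (IZR k) / N.

Lemma wN_ge1 (N : R) (k : Z) : 1 <= N -> 1 <= wN N k.
Proof.
  intros HN. unfold wN. enough (0 <= Rabs (IZR k) / N) by lra.
  apply Rmult_le_pos; [apply Rabs_pos|]. left. apply Rinv_0_lt_compat. lra.
Qed.

Lemma wN_le_wt (N : R) (k : Z) : 1 <= N -> wN N k <= wt k.
Proof.
  intros HN. unfold wN, wt. assert (h := Rabs_pos (IZR k)).
  enough (Rabs (IZR k) / N <= Rabs (IZR k)) by lra.
  apply Rmult_le_reg_r with N; [lra|]. unfold Rdiv. rewrite Rmult_assoc, Rinv_l; nra.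
Qed.

Lemma wsq_bound (N : R) (m : nat) (f : rdseq) : 1 <= N ->
  exists c, forall k, Rabs (Cmod (f k) ^ 2 * wN N k) * wt k ^ m <= c.
Proof.
  intros HN. destruct (rd_sq_bound (S m) f) as [c Hc]. exists c. intros k.
  apply Rle_trans with (2 := Hc k). rewrite Rabs_mult, Rmult_assoc.
  apply Rmult_le_compat_l; [apply Rabs_pos|]. simpl.
  assert (h := wN_ge1 N k HN). assert (h1 := wN_le_wt N k HN). assert (h2 := wt_pow_ge1 m k).
  rewrite Rabs_pos_eq by lra. apply Rmult_le_compat_r; lra.
Qed.

Lemma wsq_summable (N : R) (f : rdseq) : 1 <= N -> summable (fun k => Cmod (f k) ^ 2 * wN N k).
Proof.
  intros HN. destruct (wsq_bound N 2 f HN) as [c Hc]. destruct sum_wt as [h1 _].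
  apply summable_le with (fun k => c * / wt k ^ 2); [|now apply summable_scal].
  intros k. apply le_div_wt, Hc.
Qed.

(* Cauchy-Schwarz with the weights [w j * w (n - j)], whose inverses have sums bounded uniformly in [n]:
   interpolating through the scale [N] avoids the logarithm of the endpoint H^{1/2} estimate. *)
Lemma quartic (N : R) (f g : rdseq) : 1 <= N ->
  norm2 (f * g) <= 3 * N * (ZSeriesR (fun k => Cmod (f k) ^ 2 * wN N k) *
                            ZSeriesR (fun k => Cmod (g k) ^ 2 * wN N k)).
Proof.
  intros HN. destruct (wsq_bound N 4 f HN) as [c Hc]. destruct (wsq_bound N 2 g HN) as [c' Hc'].
  apply (norm2_conv_le f g _ _ _ c c' Hc Hc'). intros n.
  set (w := wN N).
  assert (Hw : forall k, 1 <= w k) by (intros; now apply wN_ge1).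
  destruct (sum_weight N HN) as [s1 s2].
  change (summable (fun k => / w k ^ 2)) in s1.
  change (ZSeriesR (fun k => / w k ^ 2) <= 3 * N) in s2.
  destruct (ZS_reflect _ n s1) as [s3 s4]. cbv beta in s3, s4.
  set (p := fun k => Cmod (f k) ^ 2 * w k). set (q := fun k => Cmod (g k) ^ 2 * w k).
  assert (Hd : forall j, / (w j * w (n - j)%Z) <= / 2 * (/ w j ^ 2 + / w (n - j)%Z ^ 2)).
  { intros j. rewrite Rinv_mult. rewrite <- !pow_inv.
    assert (h := pow2_ge_0 (/ w j - / w (n - j)%Z)). lra. }
  assert (Hpos : forall j, 0 <= / (w j * w (n - j)%Z)).
  { intros j. left. apply Rinv_0_lt_compat. assert (h1 := Hw j). assert (h2 := Hw (n - j)%Z). nra. }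
  assert (Hsq : summable (fun j => / 2 * (/ w j ^ 2 + / w (n - j)%Z ^ 2)))
    by (apply summable_scal, summable_plus; auto).
  assert (SA : summable (fun j => / (w j * w (n - j)%Z))).
  { apply summable_le with (2 := Hsq). intros j. rewrite Rabs_pos_eq; auto. }
  assert (LA : ZSeriesR (fun j => / (w j * w (n - j)%Z)) <= 3 * N).
  { apply Rle_trans with (1 := ZS_le _ _ SA Hsq Hd). rewrite ZS_scal, ZS_plus; auto. lra. }
  assert (Sp : summable p) by now apply wsq_summable.
  assert (Sq : summable q) by now apply wsq_summable.
  assert (p0 : forall k, 0 <= p k).
  { intros k. apply Rmult_le_pos; [apply pow2_ge_0|]. assert (h := Hw k). lra. }
  assert (q0 : forall k, 0 <= q k).
  { intros k. apply Rmult_le_pos; [apply pow2_ge_0|]. assert (h := Hw k). lra. }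
  assert (SB : summable (fun j => p j * q (n - j)%Z)).
  { apply summable_le with (fun j => ZSeriesR q * p j); [|now apply summable_scal].
    intros j. assert (h1 := p0 j). assert (h2 := q0 (n - j)%Z).
    assert (h3 := term_le_ZS q (n - j)%Z Sq q0).
    rewrite Rabs_pos_eq by (now apply Rmult_le_pos).
    rewrite Rmult_comm. now apply Rmult_le_compat_r. }
  assert (HB0 : forall j, 0 <= p j * q (n - j)%Z) by (intros j; apply Rmult_le_pos; auto).
  destruct (ZS_CS _ _ (fun j => Cmod (f j) * Cmod (g (n - j)%Z)) Hpos HB0) as [_ h]; auto.
  - intros j. unfold p, q. right. assert (h1 := Hw j). assert (h2 := Hw (n - j)%Z). field. lra.
  - apply Rle_trans with (1 := h). apply Rmult_le_compat_r; auto. now apply ZS_pos.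
Qed.

(** The Sobolev embedding of H^1 at scale [mu]: Cauchy-Schwarz with the weight (1 + |k| / mu)^2 <= 2
    (1 + k^2 / mu^2). The factor 6 / mu is 3 mu, from [sum_weight], times 2 / mu^2. *)
Lemma l1_bound (mu : R) (f : rdseq) : 1 <= mu ->
  l1 f ^ 2 <= 6 / mu * (norm2 (AD f) + mu ^ 2 * norm2 f).
Proof.
  intros Hmu. destruct (sum_weight mu Hmu) as [s1 s2].
  change (summable (fun k => / wN mu k ^ 2)) in s1.
  change (ZSeriesR (fun k => / wN mu k ^ 2) <= 3 * mu) in s2.
  set (B := fun k => 2 * / mu ^ 2 * (Cmod (AD f k) ^ 2 + mu ^ 2 * Cmod (f k) ^ 2)).
  assert (SB : summable B).
  { apply summable_scal, summable_plus; [|apply summable_scal]; apply sq_summable. }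
  assert (Hw : forall k, 1 <= wN mu k) by (intros; now apply wN_ge1).
  assert (B0 : forall k, 0 <= B k).
  { intros k. unfold B. apply Rmult_le_pos.
    - apply Rmult_le_pos; [lra|]. left. apply Rinv_0_lt_compat. nra.
    - assert (h1 := pow2_ge_0 (Cmod (AD f k))). assert (h2 := pow2_ge_0 (Cmod (f k))). nra. }
  destruct (ZS_CS (fun k => / wN mu k ^ 2) B (fun k => Cmod (f k))) as [_ h]; auto.
  - intros k. left. apply Rinv_0_lt_compat. assert (h := Hw k). nra.
  - intros k. unfold B. rewrite AD_co, Cmod_mult, Cmod_R.
    apply Rmult_le_reg_l with (wN mu k ^ 2); [assert (h := Hw k); nra|].
    rewrite <- Rmult_assoc, Rinv_r, Rmult_1_l by (assert (h := Hw k); nra).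
    unfold wN. set (x := Rabs (IZR k)). set (y := Cmod (f k)).
    replace (2 * / mu ^ 2 * ((x * y) ^ 2 + mu ^ 2 * y ^ 2)) with (2 * ((x / mu) ^ 2 + 1) * y ^ 2)
      by (field; lra).
    apply Rmult_le_compat_r; [apply pow2_ge_0|]. assert (h := pow2_ge_0 (1 - x / mu)). lra.
  - unfold l1. apply Rle_trans with (1 := h).
    assert (E : ZSeriesR B = 2 * / mu ^ 2 * (norm2 (AD f) + mu ^ 2 * norm2 f)).
    { unfold B. rewrite ZS_scal, ZS_plus, ZS_scal; auto using sq_summable, summable_scal. }
    assert (E0 : 0 <= ZSeriesR B) by now apply ZS_pos.
    apply Rle_trans with (3 * mu * ZSeriesR B); [now apply Rmult_le_compat_r|].
    rewrite E. right. field. lra.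
Qed.

(** Moduli remove the projection and leave [Aabs f] times [g], the majorant of |u|^2. Then [young]
    takes [f] in l^1 and [g] in l^2, where [quartic] applies; 18 is 6 from [l1_bound] times 3 from
    [quartic]. *)
Lemma opX_bound (N mu : R) (u f : rdseq) : 1 <= N -> 1 <= mu ->
  norm2 (opX u f) <=
    18 * N / mu * ZSeriesR (fun k => Cmod (u k) ^ 2 * wN N k) ^ 2 *
    (norm2 (AD f) + mu ^ 2 * norm2 f).
Proof.
  intros HN Hmu. set (W := ZSeriesR (fun k => Cmod (u k) ^ 2 * wN N k)).
  set (g := (Aabs u * Aabs (Aconj u))%A).
  assert (Hn : nrm (opX u f) <= nrm (Aabs f * g)).
  { replace (Aabs f * g)%A with (Aabs u * Aabs (Aabs (Aconj u) * Aabs f))%A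
      by (rewrite Aabs_conv; unfold g; ring).
    apply nrm_le. unfold opX. apply conv_dom; [intros; lra|].
    intros k. apply Rle_trans with (1 := AP_le _ k). apply conv_dom; intros; lra. }
  assert (Hg : norm2 g <= 3 * N * (W * W)).
  { unfold g. apply Rle_trans with (1 := quartic N _ _ HN). right. f_equal. f_equal.
    - unfold W. apply ZS_ext. intros k. simpl. now rewrite Cmod_R, Rabs_pos_eq by apply Cmod_ge_0.
    - unfold W. destruct (ZS_reflect _ 0 (wsq_summable N u HN)) as [_ e]. cbv beta in e.
      rewrite <- e. apply ZS_ext. intros k. simpl.
      rewrite Cmod_conj, Cmod_R, Rabs_pos_eq by apply Cmod_ge_0.
      replace (- k)%Z with (0 - k)%Z by lia. f_equal. unfold wN.
      rewrite minus_IZR, Rminus_0_l, Rabs_Ropp. reflexivity. }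
  assert (Hl : l1 (Aabs f) = l1 f).
  { apply ZS_ext. intros k. simpl. now rewrite Cmod_R, Rabs_pos_eq by apply Cmod_ge_0. }
  assert (Hy := young (Aabs f) g). rewrite Hl in Hy.
  assert (L := l1_bound mu f Hmu). assert (l0 := l1_pos f).
  assert (H1 : norm2 (opX u f) <= l1 f ^ 2 * norm2 g).
  { rewrite <- !nrm_sq. assert (h1 := nrm_pos (opX u f)). assert (h2 := nrm_pos g).
    replace (l1 f ^ 2 * (nrm g * nrm g)) with ((l1 f * nrm g) * (l1 f * nrm g)) by ring.
    apply Rmult_le_compat; lra. }
  apply Rle_trans with (1 := H1).
  apply Rle_trans with ((6 / mu * (norm2 (AD f) + mu ^ 2 * norm2 f)) * (3 * N * (W * W))).
  - apply Rmult_le_compat; auto; [apply pow2_ge_0|apply norm2_pos].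
  - right. field. lra.
Qed.

(** * Completeness and the resolvent of L *)

Lemma q_pos (n : nat) : 0 < (/ 4) ^ n.
Proof. apply pow_lt. lra. Qed.

(** The ratio 1/4 is that of the Neumann series for the resolvent; the geometric sum 4/3 is rounded
    up to 2. *)
Lemma geom_bound (x : nat -> R) (c l : R) : (forall n, Rabs (x (S n) - x n) <= c * (/ 4) ^ n) ->
  is_lim_seq x l -> forall n, Rabs (l - x n) <= 2 * c * (/ 4) ^ n.
Proof.
  intros H Hl n. assert (c0 : 0 <= c).
  { assert (h := H 0%nat). simpl in h. assert (h1 := Rabs_pos (x 1%nat - x 0%nat)). lra. }
  assert (Hj : forall j, Rabs (x (j + n)%nat - x n) <= c * (/ 4) ^ n * (4 / 3 * (1 - (/ 4) ^ j))).
  { induction j.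
    - simpl. rewrite Rminus_diag, Rabs_R0. lra.
    - assert (h := H (j + n)%nat). rewrite pow_add in h. simpl.
      assert (h1 := Rabs_triang (x (S (j + n)) - x (j + n)%nat) (x (j + n)%nat - x n)).
      replace (x (S (j + n)) - x (j + n)%nat + (x (j + n)%nat - x n)) with (x (S (j + n)) - x n)
        in h1 by ring.
      apply Rle_trans with (1 := h1). lra. }
  assert (HL : is_lim_seq (fun j => Rabs (x (j + n)%nat - x n)) (Rabs (l - x n))).
  { apply (is_lim_seq_abs _ (l - x n)). apply is_lim_seq_minus'; [|apply is_lim_seq_const].
    now apply (is_lim_seq_incr_n x n l). }
  apply (is_lim_seq_le _ (fun _ => 2 * c * (/ 4) ^ n) (Rabs (l - x n)) (2 * c * (/ 4) ^ n)) with (2 := HL).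
  - intros j. apply Rle_trans with (1 := Hj j). assert (h := q_pos n). assert (h1 := q_pos j).
    assert (0 <= c * (/ 4) ^ n) by (apply Rmult_le_pos; lra). nra.
  - apply is_lim_seq_const.
Qed.

Lemma geom_ex (x : nat -> R) (c : R) : (forall n, Rabs (x (S n) - x n) <= c * (/ 4) ^ n) ->
  is_lim_seq x (real (Lim_seq x)).
Proof.
  intros H.
  assert (He : ex_series (fun n => x (S n) - x n)).
  { apply ex_series_le_R with (1 := H).
    apply (ex_series_scal_l c (fun n => (/ 4) ^ n)). apply ex_series_geom.
    rewrite Rabs_pos_eq; lra. }
  destruct He as [l Hl]. apply is_series_lim in Hl.
  assert (E : forall n, sum_n (fun n => x (S n) - x n) n = x (S n) - x 0%nat).
  { induction n; [now rewrite sum_O|]. rewrite sum_SnR, IHn. real_eq. ring. }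
  assert (Hx : is_lim_seq x (x 0%nat + l)).
  { apply is_lim_seq_incr_1.
    apply is_lim_seq_ext with (fun n => x 0%nat + sum_n (fun n => x (S n) - x n) n).
    - intros n. rewrite E. ring.
    - apply is_lim_seq_plus'; auto. apply is_lim_seq_const. }
  rewrite (is_lim_seq_unique _ _ Hx). exact Hx.
Qed.

(** Limits are taken coefficient by coefficient. The constant may depend on the seminorm but the
    ratio does not, so one limit serves all seminorms. *)
Lemma rd_complete (p : nat -> rdseq) :
  (forall m, exists c, forall n, small m (c * (/ 4) ^ n) (p (S n) - p n)%A) ->
  exists b : rdseq, forall m, exists c, forall n, small m (c * (/ 4) ^ n) (b - p n)%A.
Proof.
  intros H.
  set (b := fun k => (real (Lim_seq (fun n => fst (p n k))), real (Lim_seq (fun n => snd (p n k)))) : C).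
  assert (Hb : forall m c, (forall n, small m (c * (/ 4) ^ n) (p (S n) - p n)%A) ->
    forall n k, Cmod (b k - p n k)%C * wt k ^ m <= 4 * c * (/ 4) ^ n).
  { intros m c Hc n k. assert (W := wt_pow_ge1 m k).
    assert (Hd : forall n, Cmod (p (S n) k - p n k)%C <= c * / wt k ^ m * (/ 4) ^ n).
    { intros n0. assert (h := small_div _ _ _ k (Hc n0)). rewrite Asub_co in h. lra. }
    assert (H1 : forall n, Rabs (fst (p (S n) k) - fst (p n k)) <= c * / wt k ^ m * (/ 4) ^ n).
    { intros n0. apply Rle_trans with (2 := Hd n0). exact (fst_le_Cmod (p (S n0) k - p n0 k)%C). }
    assert (H2 : forall n, Rabs (snd (p (S n) k) - snd (p n k)) <= c * / wt k ^ m * (/ 4) ^ n).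
    { intros n0. apply Rle_trans with (2 := Hd n0). exact (snd_le_Cmod (p (S n0) k - p n0 k)%C). }
    assert (B1 := geom_bound _ _ _ H1 (geom_ex (fun n => fst (p n k)) _ H1) n).
    assert (B2 := geom_bound _ _ _ H2 (geom_ex (fun n => snd (p n k)) _ H2) n).
    assert (B3 := Cmod_le_parts (b k - p n k)%C).
    replace (4 * c * (/ 4) ^ n) with (4 * c * / wt k ^ m * (/ 4) ^ n * wt k ^ m) by (field; lra).
    apply Rmult_le_compat_r; [lra|]. apply Rle_trans with (1 := B3).
    unfold b, Cminus, Cplus, Copp. cbn [fst snd]. unfold Rminus in B1, B2. lra. }
  assert (RDb : RD b).
  { intros m. destruct (H m) as [c Hc]. destruct (co_RD (p 0%nat) m) as [c' Hc'].
    exists (4 * c + c'). apply small_ext with (fun k => (b k - p 0%nat k) + p 0%nat k)%C.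
    - intros k. ring.
    - apply small_plus; auto. intros k. assert (h := Hb m c Hc 0%nat k). simpl in h. lra. }
  exists (mkrd b RDb). intros m. destruct (H m) as [c Hc]. exists (4 * c).
  intros n k. rewrite Asub_co. apply Hb; auto.
Qed.

(** The constant [K] depends on [u] and [m] and need not be small: smallness of [opX] is only ever
    used in l^2. *)
Lemma small_X (u : rdseq) (m : nat) : exists K, 0 <= K /\ forall c f,
  small m c (co f) -> small m (K * c) (opX u f).
Proof.
  destruct (co_RD u (m + 2)%nat) as [c1 H1]. destruct (co_RD (Aconj u) (m + 2)%nat) as [c2 H2].
  assert (P1 := small_nonneg _ _ _ H1). assert (P2 := small_nonneg _ _ _ H2).
  exists (3 * c1 * (3 * c2)). split; [repeat apply Rmult_le_pos; lra|].
  intros c f Hf. replace (3 * c1 * (3 * c2) * c) with (3 * c1 * (3 * c2 * c)) by ring.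
  apply small_conv; auto. intros k.
  apply Rle_trans with (2 := small_conv m c2 c (Aconj u) f H2 Hf k).
  apply Rmult_le_compat_r; [assert (h1 := wt_pow_ge1 m k); lra|]. apply AP_le.
Qed.

Lemma opX_add (u f g : rdseq) : opX u (f + g) = (opX u f + opX u g)%A.
Proof.
  unfold opX. replace (Aconj u * (f + g))%A with (Aconj u * f + Aconj u * g)%A by ring.
  rewrite AP_add. ring.
Qed.

Lemma opX_opp (u f : rdseq) : opX u (- f) = (- opX u f)%A.
Proof.
  unfold opX. replace (Aconj u * - f)%A with (- (Aconj u * f))%A by ring.
  rewrite AP_opp. ring.
Qed.

Lemma opL_add (beta : R) (u f g : rdseq) : opL beta u (f + g) = (opL beta u f + opL beta u g)%A.
Proof. unfold opL. rewrite AD_add, opX_add. ring. Qed.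

Definition ik (kappa : R) : rdseq := Acst (Ci * RtoC kappa).

Lemma Cmod_ksq (k kappa : R) : Cmod (k + Ci * kappa)%C ^ 2 = k ^ 2 + kappa ^ 2.
Proof. rewrite Cmod2_alt. unfold Re, Im; simpl. ring. Qed.

Lemma norm2_Dk (kappa : R) (f : rdseq) :
  norm2 (AD f + ik kappa * f) = norm2 (AD f) + kappa ^ 2 * norm2 f.
Proof.
  unfold norm2. rewrite <- ZS_scal, <- ZS_plus; auto using sq_summable, summable_scal.
  apply ZS_ext. intros k. rewrite Aadd_co. unfold ik. rewrite Amul_cst, AD_co.
  replace (IZR k * f k + Ci * kappa * f k)%C with ((IZR k + Ci * kappa) * f k)%C by ring.
  rewrite !Cmod_mult, !Rpow_mult_distr, Cmod_ksq, Cmod_R, pow2_abs. ring.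
Qed.

Lemma kappa_growth (kappa : R) : 1 <= Rabs kappa ->
  lin_growth (fun k => / (IZR k + Ci * kappa))%C.
Proof.
  intros H. apply bounded_growth with 1. intros k.
  assert (E := Cmod_ksq (IZR k) kappa). assert (P := Cmod_ge_0 (IZR k + Ci * kappa)%C).
  assert (h := pow2_abs kappa). assert (h2 := pow2_ge_0 (IZR k)).
  assert (h1 : 1 <= Cmod (IZR k + Ci * kappa)%C) by nra.
  rewrite Cmod_inv by (apply Cmod_gt_0; lra).
  rewrite <- Rinv_1. apply Rinv_le_contravar; lra.
Qed.

(** The free resolvent (D + i kappa)^(-1). The lower bound on |kappa| keeps its symbol at most 1 in
    modulus. *)
Definition Rk (kappa : R) (H : 1 <= Rabs kappa) (f : rdseq) : rdseq :=
  Adiag _ (kappa_growth kappa H) f.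

Lemma Rk_bound (kappa : R) (k : Z) : 1 <= Rabs kappa ->
  1 <= Cmod (IZR k + Ci * kappa)%C /\ wt k <= 2 * Cmod (IZR k + Ci * kappa)%C.
Proof.
  intros H.
  assert (E := Cmod_ksq (IZR k) kappa). assert (P := Cmod_ge_0 (IZR k + Ci * kappa)%C).
  assert (h := pow2_abs kappa). assert (h2 := pow2_ge_0 (IZR k)). assert (h3 := pow2_abs (IZR k)).
  assert (h1 : 1 <= Cmod (IZR k + Ci * kappa)%C) by nra.
  split; auto. unfold wt. assert (h4 := Rabs_pos (IZR k)).
  assert (Rabs (IZR k) <= Cmod (IZR k + Ci * kappa)%C) by nra. lra.
Qed.

Lemma Rk_inv (kappa : R) (H : 1 <= Rabs kappa) (f : rdseq) :
  (AD (Rk kappa H f) + ik kappa * Rk kappa H f)%A = f.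
Proof.
  apply rd_ext. intros k. unfold ik. rewrite Aadd_co, Amul_cst, AD_co. simpl.
  field. apply Cmod_gt_0. destruct (Rk_bound kappa k H). lra.
Qed.

Lemma nrm_le_norm2 (a : R) (f g : rdseq) : 0 <= a ->
  norm2 f <= a ^ 2 * norm2 g -> nrm f <= a * nrm g.
Proof.
  intros Ha H. assert (h1 := nrm_pos f). assert (h2 := nrm_pos g).
  rewrite <- !nrm_sq in H. apply Rsqr_incr_0; unfold Rsqr; nra.
Qed.

(* Neumann series around (D + i kappa)^(-1).  Each term gains one power of decay on the previous one,
   so geometric decay in l^2 yields geometric decay in every weighted norm. *)
Lemma resolvent_exists (beta kappa mu : R) (u w : rdseq) :
  1 <= mu -> mu <= Rabs kappa ->
  (forall f, beta ^ 2 * norm2 (opX u f) <= / 16 * (norm2 (AD f) + mu ^ 2 * norm2 f)) ->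
  exists b, (opL beta u b + ik kappa * b)%A = w.
Proof.
  intros Hmu Hk HX. assert (H1 : 1 <= Rabs kappa) by lra.
  set (G := Rk kappa H1).
  (* [t] lists the terms of the Neumann series and [p] its partial sums. *)
  set (t := fix t n := match n with O => G w | S n => (- G (Acst beta * opX u (t n)))%A end).
  set (p := fix p n := match n with O => t O | S n => (p n + t (S n))%A end).
  (* The hypothesis on [opX] compares squared norms, so its factor 1/16 is the ratio 1/4 here. *)
  assert (Hnt : forall n, nrm (AD (t n) + ik kappa * t n) <= (/ 4) ^ n * nrm w).
  { induction n.
    - simpl. unfold G. rewrite Rk_inv. lra.
    - replace (AD (t (S n)) + ik kappa * t (S n))%A with (- (Acst beta * opX u (t n)))%A.
      2: { rewrite <- (Rk_inv kappa H1 (Acst beta * opX u (t n))) at 1. fold G.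
           change (t (S n)) with (- G (Acst beta * opX u (t n)))%A. rewrite AD_opp. ring. }
      rewrite nrm_opp. apply Rle_trans with (/ 4 * nrm (AD (t n) + ik kappa * t n)).
      + apply (nrm_le_norm2 _); [lra|]. rewrite norm2_Dk.
        rewrite <- nrm_sq, nrm_cst, Cmod_R.
        replace (Rabs beta * nrm (opX u (t n)) * (Rabs beta * nrm (opX u (t n))))
          with (Rabs beta ^ 2 * (nrm (opX u (t n)) * nrm (opX u (t n)))) by ring.
        rewrite pow2_abs, nrm_sq. apply Rle_trans with (1 := HX (t n)).
        replace ((/ 4) ^ 2) with (/ 16) by field.
        apply Rmult_le_compat_l; [lra|]. apply Rplus_le_compat_l.
        apply Rmult_le_compat_r; [apply norm2_pos|]. rewrite <- (pow2_abs kappa).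
        apply pow_incr. lra.
      + simpl. lra. }
  (* Induction on the weight: a bound on [t n] at order [m] gives one on [t (S n)] at order [m + 1],
     since dividing by k + i kappa gains a power. The 8 is 2 from [Rk_bound] times 4 for the shift
     of [n]. *)
  assert (Hst : forall m, exists c, forall n, small m (c * (/ 4) ^ n) (t n)).
  { induction m as [|m [c Hc]].
    - exists (nrm w). intros n k. simpl. rewrite Rmult_1_r, (Rmult_comm (nrm w)).
      destruct (Rk_bound kappa k H1) as [b1 _].
      apply Rle_trans with (2 := Hnt n). apply Rle_trans with (2 := nrm_term _ k).
      rewrite Aadd_co. unfold ik. rewrite Amul_cst, AD_co.
      replace (IZR k * t n k + Ci * kappa * t n k)%C with ((IZR k + Ci * kappa) * t n k)%C by ring.
      rewrite Cmod_mult. assert (h := Cmod_ge_0 (t n k)). nra.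
    - destruct (small_X u m) as [K [K0 HK]].
      destruct (co_RD (t 0%nat) (S m)) as [c0 Hc0].
      assert (c00 := small_nonneg _ _ _ Hc0).
      assert (cpos : 0 <= c).
      { assert (h := small_nonneg _ _ _ (Hc 0%nat)). simpl in h. lra. }
      assert (P : 0 <= 8 * Rabs beta * (K * c)).
      { assert (h := Rabs_pos beta). repeat apply Rmult_le_pos; lra. }
      exists (c0 + 8 * Rabs beta * (K * c)). intros [|n].
      + apply small_le with (2 := Hc0). simpl. lra.
      + apply small_le with (8 * Rabs beta * (K * c) * (/ 4) ^ S n).
        { apply Rmult_le_compat_r; [left; apply q_pos|lra]. }
        intros k. change (t (S n)) with (- G (Acst beta * opX u (t n)))%A.
        destruct (Rk_bound kappa k H1) as [b1 b2].
        assert (Hg : Cmod ((IZR k + Ci * kappa) * G (Acst beta * opX u (t n))%A k)%C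
                     = Rabs beta * Cmod (opX u (t n) k)).
        { rewrite <- Cmod_R, <- Cmod_mult, <- (Amul_cst beta (opX u (t n))).
          rewrite <- (Rk_inv kappa H1 (Acst beta * opX u (t n))) at 2. fold G.
          unfold ik. rewrite Aadd_co, Amul_cst, AD_co. f_equal. ring. }
        rewrite Aopp_co, Cmod_opp. rewrite Cmod_mult in Hg.
        set (y := Cmod (G (Acst beta * opX u (t n))%A k)) in *.
        assert (y0 : 0 <= y) by apply Cmod_ge_0.
        assert (hX := HK _ _ (Hc n) k). simpl.
        assert (W := wt_pow_ge1 m k). assert (B := Rabs_pos beta).
        apply Rle_trans with (2 * (Rabs beta * Cmod (opX u (t n) k)) * wt k ^ m).
        * rewrite <- Hg. replace (y * (wt k * wt k ^ m)) with ((y * wt k) * wt k ^ m) by ring.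
          apply Rmult_le_compat_r; [lra|]. nra.
        * replace (2 * (Rabs beta * Cmod (opX u (t n) k)) * wt k ^ m)
            with (2 * Rabs beta * (Cmod (opX u (t n) k) * wt k ^ m)) by ring.
          replace (8 * Rabs beta * (K * c) * (/ 4 * (/ 4) ^ n))
            with (2 * Rabs beta * (K * (c * (/ 4) ^ n))) by field.
          apply Rmult_le_compat_l; lra. }
  destruct (rd_complete p) as [b Hb].
  { intros m. destruct (Hst m) as [c Hc]. exists c. intros n.
    apply small_le with (c * (/ 4) ^ S n).
    - assert (h := small_nonneg _ _ _ (Hc n)). simpl. lra.
    - apply small_ext with (2 := Hc (S n)). intros k. rewrite Asub_co.
      change (p (S n)) with (p n + t (S n))%A. rewrite Aadd_co. ring. }
  (* The residual of a partial sum telescopes to one term, which tends to 0. *)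
  assert (Hres : forall n, (opL beta u (p n) + ik kappa * p n - w)%A = (Acst beta * opX u (t n))%A).
  { induction n.
    - change (p 0%nat) with (G w). change (t 0%nat) with (G w).
      rewrite <- (Rk_inv kappa H1 w) at 3. fold G. unfold opL. ring.
    - change (p (S n)) with (p n + t (S n))%A. rewrite opL_add.
      transitivity ((opL beta u (p n) + ik kappa * p n - w)
                    + (opL beta u (t (S n)) + ik kappa * t (S n)))%A; [ring|].
      rewrite IHn. rewrite <- (Rk_inv kappa H1 (Acst beta * opX u (t n))) at 1. fold G.
      change (t (S n)) with (- G (Acst beta * opX u (t n)))%A.
      unfold opL. rewrite AD_opp. ring. }
  exists b. apply rd_ext. intros k.
  destruct (Hb 0%nat) as [c Hc]. destruct (Hst 0%nat) as [c' Hc'].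
  destruct (small_X u 0) as [K [K0 HK]].
  set (z := ((opL beta u b + ik kappa * b)%A k - w k)%C).
  assert (Hz : forall n, Cmod z <=
     (Rabs (IZR k) * c + Rabs beta * (K * c) + Rabs kappa * c + Rabs beta * (K * c')) * (/ 4) ^ n).
  { intros n.
    assert (E : z = (IZR k * (b - p n)%A k + beta * opX u (b - p n)%A k
                     + Ci * kappa * (b - p n)%A k + beta * opX u (t n) k)%C).
    { unfold z. rewrite <- (Amul_cst beta (opX u (t n))), <- Hres.
      rewrite <- (Amul_cst beta), <- (Amul_cst (Ci * kappa)), <- AD_co. fold (ik kappa).
      rewrite <- !Aadd_co, <- Asub_co. f_equal. unfold opL, Asub.
      rewrite AD_add, AD_opp, opX_add, opX_opp. ring. }
    rewrite E.
    assert (B1 := small_term _ _ _ k (Hc n)).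
    assert (B2 := small_term _ _ _ k (HK _ _ (Hc n))).
    assert (B3 := small_term _ _ _ k (HK _ _ (Hc' n))).
    eapply Rle_trans; [apply Cmod_triangle|].
    assert (N1 := Rabs_pos (IZR k)). assert (N2 := Rabs_pos beta). assert (N3 := Rabs_pos kappa).
    assert (M1 := Cmod_triangle (IZR k * (b - p n)%A k) (beta * opX u (b - p n)%A k)).
    assert (M2 := Cmod_triangle (IZR k * (b - p n)%A k + beta * opX u (b - p n)%A k)
                   (Ci * kappa * (b - p n)%A k)).
    rewrite !Cmod_mult, !Cmod_R, ?Cmod_Ci, ?Rmult_1_l in *.
    assert (A1 := Rmult_le_compat_l _ _ _ N1 B1). assert (A2 := Rmult_le_compat_l _ _ _ N2 B2).
    assert (A3 := Rmult_le_compat_l _ _ _ N3 B1). assert (A4 := Rmult_le_compat_l _ _ _ N2 B3).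
    lra. }
  assert (Hz0 : Cmod z <= 0).
  { set (M := Rabs (IZR k) * c + Rabs beta * (K * c) + Rabs kappa * c + Rabs beta * (K * c')) in *.
    apply (is_lim_seq_le (fun _ => Cmod z) (fun n => M * (/ 4) ^ n) (Cmod z) 0 Hz).
    - apply is_lim_seq_const.
    - replace (Finite 0) with (Finite (M * 0)) by (f_equal; ring).
      apply is_lim_seq_mult'; [apply is_lim_seq_const|].
      apply is_lim_seq_geom. rewrite Rabs_pos_eq; lra. }
  assert (Ez : z = 0%C).
  { apply Cmod_eq_0. assert (h := Cmod_ge_0 z). lra. }
  unfold z in Ez. replace ((opL beta u b + ik kappa * b)%A k)
    with (((opL beta u b + ik kappa * b)%A k - w k) + w k)%C by ring.
  rewrite Ez. ring.
Qed.

(** * Differentiation in time *)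

Definition Acont (u : R -> rdseq) (t : R) : Prop :=
  forall m eps, 0 < eps -> exists delta, 0 < delta /\
    forall tau, Rabs (tau - t) < delta -> small m eps (u tau - u t)%A.

(** Differentiability in all weighted sup norms at once. The increment is not divided by [tau - t],
    so [tau = t] needs no exception. *)
Definition Aderiv (u : R -> rdseq) (t : R) (u' : rdseq) : Prop :=
  forall m eps, 0 < eps -> exists delta, 0 < delta /\
    forall tau, Rabs (tau - t) < delta ->
      small m (eps * Rabs (tau - t)) (u tau - u t - Acst (RtoC (tau - t)) * u')%A.

Lemma small_add (m : nat) (c c' : R) (f g : rdseq) :
  small m c f -> small m c' g -> small m (c + c') (f + g)%A.
Proof. apply small_plus. Qed.

Lemma small_cst (m : nat) (c : R) (z : C) (f : rdseq) :
  small m c f -> small m (Cmod z * c) (Acst z * f)%A.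
Proof.
  intros H k. rewrite Amul_cst, Cmod_mult, Rmult_assoc.
  apply Rmult_le_compat_l; auto. apply Cmod_ge_0.
Qed.

Lemma Aderiv_lip (u : R -> rdseq) (t : R) (u' : rdseq) : Aderiv u t u' ->
  forall m, exists K delta, 0 <= K /\ 0 < delta /\
    forall tau, Rabs (tau - t) < delta -> small m (K * Rabs (tau - t)) (u tau - u t)%A.
Proof.
  intros H m. destruct (H m 1 Rlt_0_1) as [d [d0 Hd]]. destruct (co_RD u' m) as [c Hc].
  assert (c0 := small_nonneg _ _ _ Hc).
  exists (1 + c), d. split; [lra|]. split; auto. intros tau Ht.
  replace (u tau - u t)%A with
    ((u tau - u t - Acst (RtoC (tau - t)) * u') + Acst (RtoC (tau - t)) * u')%A by ring.
  replace ((1 + c) * Rabs (tau - t)) with (1 * Rabs (tau - t) + Rabs (tau - t) * c) by ring.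
  apply small_add; auto. rewrite <- Cmod_R. now apply small_cst.
Qed.

Lemma Aderiv_cont (u : R -> rdseq) (t : R) (u' : rdseq) : Aderiv u t u' -> Acont u t.
Proof.
  intros H m eps He. destruct (Aderiv_lip u t u' H m) as [K [d [K0 [d0 Hd]]]].
  exists (Rmin d (eps / (K + 1))).
  assert (P : 0 < eps / (K + 1)) by (apply Rdiv_lt_0_compat; lra).
  split; [now apply Rmin_glb_lt|]. intros tau Ht.
  assert (h1 := Rmin_l d (eps / (K + 1))). assert (h2 := Rmin_r d (eps / (K + 1))).
  apply small_le with (K * Rabs (tau - t)); [|apply Hd; lra].
  apply Rle_trans with ((K + 1) * (eps / (K + 1))).
  - assert (h3 := Rabs_pos (tau - t)). apply Rmult_le_compat; lra.
  - right. field. lra.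
Qed.

Lemma Aderiv_ext (u v : R -> rdseq) (t : R) (u' v' : rdseq) :
  (forall s, u s = v s) -> u' = v' -> Aderiv u t u' -> Aderiv v t v'.
Proof.
  intros H E Hu m eps He. destruct (Hu m eps He) as [d [d0 Hd]]. exists d. split; auto.
  intros tau Ht. rewrite <- !H, <- E. auto.
Qed.

Lemma Aderiv_const (w : rdseq) (t : R) : Aderiv (fun _ => w) t (Acst 0).
Proof.
  intros m eps He. exists 1. split; [lra|]. intros tau _ k.
  replace (w - w - Acst (RtoC (tau - t)) * Acst 0)%A with (Acst 0) by ring.
  simpl. destruct (Z.eqb k 0); rewrite Cmod_0, Rmult_0_l;
    apply Rmult_le_pos; try lra; apply Rabs_pos.
Qed.

Lemma Aderiv_add (u v : R -> rdseq) (t : R) (u' v' : rdseq) :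
  Aderiv u t u' -> Aderiv v t v' -> Aderiv (fun s => u s + v s)%A t (u' + v')%A.
Proof.
  intros Hu Hv m eps He.
  destruct (Hu m (eps / 2)) as [d1 [p1 H1]]; [lra|].
  destruct (Hv m (eps / 2)) as [d2 [p2 H2]]; [lra|].
  exists (Rmin d1 d2). split; [now apply Rmin_glb_lt|]. intros tau Ht.
  assert (h1 := Rmin_l d1 d2). assert (h2 := Rmin_r d1 d2).
  replace (eps * Rabs (tau - t)) with (eps / 2 * Rabs (tau - t) + eps / 2 * Rabs (tau - t)) by field.
  replace (u tau + v tau - (u t + v t) - Acst (RtoC (tau - t)) * (u' + v'))%A with
    ((u tau - u t - Acst (RtoC (tau - t)) * u') + (v tau - v t - Acst (RtoC (tau - t)) * v'))%A by ring.
  apply small_add; [apply H1|apply H2]; lra.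
Qed.

Lemma Aderiv_mul (u v : R -> rdseq) (t : R) (u' v' : rdseq) :
  Aderiv u t u' -> Aderiv v t v' -> Aderiv (fun s => u s * v s)%A t (u' * v t + u t * v')%A.
Proof.
  intros Hu Hv m eps He.
  destruct (co_RD (v t) m) as [cv Hcv]. destruct (co_RD u' (m + 2)%nat) as [cu' Hcu'].
  destruct (co_RD (u t) (m + 2)%nat) as [cu Hcu].
  assert (q1 := small_nonneg _ _ _ Hcv). assert (q2 := small_nonneg _ _ _ Hcu').
  assert (q3 := small_nonneg _ _ _ Hcu).
  (* The 9 is three error terms times the constant 3 of [small_conv]; the added 1 keeps the
     denominators positive. *)
  set (e1 := eps / (9 * (cv + 1))). set (e2 := eps / (9 * (cu' + 1))). set (e3 := eps / (9 * (cu + 1))).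
  assert (r1 : 0 < e1) by (apply Rdiv_lt_0_compat; lra).
  assert (r2 : 0 < e2) by (apply Rdiv_lt_0_compat; lra).
  assert (r3 : 0 < e3) by (apply Rdiv_lt_0_compat; lra).
  destruct (Hu (m + 2)%nat e1 r1) as [d1 [p1 H1]].
  destruct (Aderiv_cont _ _ _ Hv m e2 r2) as [d2 [p2 H2]].
  destruct (Hv m e3 r3) as [d3 [p3 H3]].
  destruct (Aderiv_cont _ _ _ Hv m 1 Rlt_0_1) as [d4 [p4 H4]].
  exists (Rmin (Rmin d1 d2) (Rmin d3 d4)). split.
  { repeat apply Rmin_glb_lt; auto. }
  intros tau Ht.
  assert (a1 := Rmin_l (Rmin d1 d2) (Rmin d3 d4)). assert (a2 := Rmin_r (Rmin d1 d2) (Rmin d3 d4)).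
  assert (a3 := Rmin_l d1 d2). assert (a4 := Rmin_r d1 d2).
  assert (a5 := Rmin_l d3 d4). assert (a6 := Rmin_r d3 d4).
  specialize (H1 tau ltac:(lra)). specialize (H2 tau ltac:(lra)).
  specialize (H3 tau ltac:(lra)). specialize (H4 tau ltac:(lra)).
  set (D := Acst (RtoC (tau - t))) in *. set (x := Rabs (tau - t)) in *.
  assert (x0 : 0 <= x) by apply Rabs_pos.
  replace (u tau * v tau - u t * v t - D * (u' * v t + u t * v'))%A with
    ((u tau - u t - D * u') * v tau + D * (u' * (v tau - v t)) + u t * (v tau - v t - D * v'))%A by ring.
  assert (Hvt : small m (cv + 1) (v tau)).
  { replace (v tau) with (v t + (v tau - v t))%A by ring. apply small_add; auto. }
  apply small_le with (3 * (e1 * x) * (cv + 1) + x * (3 * cu' * e2) + 3 * cu * (e3 * x)).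
  - assert (E1 : e1 * (cv + 1) = eps / 9) by (unfold e1; field; lra).
    assert (E2 : e2 * (cu' + 1) = eps / 9) by (unfold e2; field; lra).
    assert (E3 : e3 * (cu + 1) = eps / 9) by (unfold e3; field; lra).
    assert (F1 : 3 * (e1 * x) * (cv + 1) = eps / 3 * x).
    { replace (3 * (e1 * x) * (cv + 1)) with (3 * (e1 * (cv + 1)) * x) by ring. rewrite E1. field. }
    assert (F2 : x * (3 * cu' * e2) <= eps / 3 * x).
    { replace (x * (3 * cu' * e2)) with (3 * (e2 * cu') * x) by ring.
      apply Rmult_le_compat_r; auto. nra. }
    assert (F3 : 3 * cu * (e3 * x) <= eps / 3 * x).
    { replace (3 * cu * (e3 * x)) with (3 * (e3 * cu) * x) by ring.
      apply Rmult_le_compat_r; auto. nra. }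
    lra.
  - apply small_add; [apply small_add|].
    + now apply small_conv.
    + unfold D, x. rewrite <- Cmod_R. apply small_cst. now apply small_conv.
    + now apply small_conv.
Qed.

Lemma small_P (m : nat) (c : R) (f : rdseq) : small m c f -> small m c (AP f).
Proof.
  intros H k. apply Rle_trans with (2 := H k).
  apply Rmult_le_compat_r; [assert (h1 := wt_pow_ge1 m k); lra|]. apply AP_le.
Qed.

Lemma Aderiv_P (u : R -> rdseq) (t : R) (u' : rdseq) :
  Aderiv u t u' -> Aderiv (fun s => AP (u s)) t (AP u').
Proof.
  intros Hu m eps He. destruct (Hu m eps He) as [d [d0 Hd]]. exists d. split; auto.
  intros tau Ht.
  replace (AP (u tau) - AP (u t) - Acst (RtoC (tau - t)) * AP u')%A
    with (AP (u tau - u t - Acst (RtoC (tau - t)) * u')).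
  - apply small_P; auto.
  - unfold Asub. rewrite !AP_add, !AP_opp, AP_cst_mul. reflexivity.
Qed.

Lemma small_conj (m : nat) (c : R) (f : rdseq) : small m c f -> small m c (Aconj f).
Proof.
  intros H k. simpl. rewrite Cmod_conj, <- wt_opp. apply H.
Qed.

Lemma Aconj_opp (f : rdseq) : Aconj (- f) = (- Aconj f)%A.
Proof.
  apply rd_ext. intros k. rewrite Aopp_co. simpl.
  rewrite Cmult_conj, Cconj_RtoC. ring.
Qed.

Lemma Aderiv_conj (u : R -> rdseq) (t : R) (u' : rdseq) :
  Aderiv u t u' -> Aderiv (fun s => Aconj (u s)) t (Aconj u').
Proof.
  intros Hu m eps He. destruct (Hu m eps He) as [d [d0 Hd]]. exists d. split; auto.
  intros tau Ht.
  replace (Aconj (u tau) - Aconj (u t) - Acst (RtoC (tau - t)) * Aconj u')%A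
    with (Aconj (u tau - u t - Acst (RtoC (tau - t)) * u')).
  - apply small_conj; auto.
  - unfold Asub. now rewrite !Aconj_add, !Aconj_opp, Aconj_mul, Aconj_cst, Cconj_RtoC.
Qed.

Lemma Aderiv_X (u : R -> rdseq) (t : R) (u' b : rdseq) :
  Aderiv u t u' -> Aderiv (fun s => opX (u s) b) t (dX (u t) u' b).
Proof.
  intros Hu. unfold opX, dX. apply Aderiv_mul; auto. apply Aderiv_P.
  apply Aderiv_ext with (3 := Aderiv_mul _ _ t _ _ (Aderiv_conj u t u' Hu) (Aderiv_const b t)).
  - reflexivity.
  - ring.
Qed.

Lemma Aderiv_nrm (u : R -> rdseq) (t : R) (u' : rdseq) : Aderiv u t u' ->
  forall eps, 0 < eps -> exists delta, 0 < delta /\ forall tau, Rabs (tau - t) < delta ->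
    nrm (u tau - u t - Acst (RtoC (tau - t)) * u') <= eps * Rabs (tau - t) /\
    nrm (u tau - u t) <= eps.
Proof.
  intros Hu eps He. destruct (Hu 1%nat (eps / 2)) as [d [d0 Hd]]; [lra|].
  destruct (Aderiv_cont _ _ _ Hu 1%nat (eps / 2)) as [d' [d0' Hd']]; [lra|].
  exists (Rmin d d'). split; [now apply Rmin_glb_lt|]. intros tau Ht.
  assert (h1 := Rmin_l d d'). assert (h2 := Rmin_r d d').
  assert (A1 := nrm_small _ _ (Hd tau ltac:(lra))). assert (A2 := nrm_small _ _ (Hd' tau ltac:(lra))).
  split; lra.
Qed.

Lemma is_derive_eps (f : R -> R) (t l : R) :
  (forall eps, 0 < eps -> exists delta, 0 < delta /\ forall tau, Rabs (tau - t) < delta ->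
     Rabs (f tau - f t - (tau - t) * l) <= eps * Rabs (tau - t)) -> is_derive f t l.
Proof.
  intros H. apply is_derive_Reals. intros eps He.
  destruct (H (eps / 2)) as [d [d0 Hd]]; [lra|]. exists (mkposreal d d0). intros h h0 hd.
  assert (A := Hd (t + h)). replace (t + h - t) with h in A by ring. specialize (A hd).
  replace ((f (t + h) - f t) / h - l) with ((f (t + h) - f t - h * l) / h) by (field; auto).
  unfold Rdiv. rewrite Rabs_mult, Rabs_inv. assert (P := Rabs_pos_lt h h0).
  apply Rmult_lt_reg_r with (Rabs h); auto.
  rewrite Rmult_assoc, Rinv_l, Rmult_1_r; nra.
Qed.

(** The first-order term of the squared norm is 2 Re <u', u>, which vanishes because the generator
    is skew-adjoint; the rest is quadratic in the increment. *)
Lemma mass_derive (beta : R) (V : rdseq) (u : R -> rdseq) (t : R) : Aconj V = V ->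
  Aderiv u t (opB beta V (u t) (u t)) -> is_derive (fun s => norm2 (u s)) t 0.
Proof.
  intros HV Hu. set (u' := opB beta V (u t) (u t)) in *.
  assert (H0 : fst (ip u' (u t)) = 0).
  { assert (h := ip_B beta V (u t) (u t) (u t) HV). fold u' in h.
    rewrite (ip_conj u' (u t)) in h. apply (f_equal fst) in h.
    unfold Cconj, Copp in h. cbn [fst] in h. lra. }
  apply is_derive_eps. intros eps He.
  set (n0 := nrm (u t)). set (n1 := nrm u').
  assert (p0 : 0 <= n0) by apply nrm_pos. assert (p1 : 0 <= n1) by apply nrm_pos.
  set (e := eps / (2 * n0 + n1 + 2 + eps)).
  assert (e0 : 0 < e) by (apply Rdiv_lt_0_compat; lra).
  assert (e1 : e * (2 * n0 + n1 + 1) <= eps).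
  { apply Rle_trans with (e * (2 * n0 + n1 + 2 + eps)).
    - apply Rmult_le_compat_l; lra.
    - right. unfold e. field. lra. }
  assert (e2 : e <= 1).
  { apply Rmult_le_reg_r with (2 * n0 + n1 + 2 + eps); [lra|].
    unfold e, Rdiv. rewrite Rmult_assoc, Rinv_l; lra. }
  destruct (Aderiv_nrm _ _ _ Hu e e0) as [d [d0 Hd]]. exists d. split; auto.
  intros tau Ht. destruct (Hd tau Ht) as [A1 A2].
  set (D := Acst (RtoC (tau - t))) in *. set (x := Rabs (tau - t)) in *.
  assert (x0 : 0 <= x) by apply Rabs_pos.
  set (w := (u tau - u t)%A) in *. set (r := (w - D * u')%A) in *.
  replace (norm2 (u tau)) with (norm2 (u t + w)) by (f_equal; unfold w; ring).
  rewrite norm2_add, (ip_conj w (u t)).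
  replace w with (r + D * u')%A at 1 by (unfold r; ring).
  unfold D at 1. rewrite ip_addl, ip_cstl.
  assert (E : fst (Cconj (ip r (u t) + RtoC (tau - t)%R * ip u' (u t))%C) = fst (ip r (u t))).
  { unfold Cconj, Cplus, Cmult, RtoC. cbn [fst snd]. rewrite H0. ring. }
  rewrite E.
  assert (B1 : Rabs (fst (ip r (u t))) <= e * x * n0).
  { apply Rle_trans with (1 := fst_le_Cmod _). apply Rle_trans with (1 := ip_CS _ _).
    apply Rmult_le_compat_r; auto. }
  assert (B2 : nrm w <= (e + n1) * x).
  { replace w with (r + D * u')%A at 1 by (unfold r; ring).
    apply Rle_trans with (1 := nrm_add _ _). unfold D. rewrite nrm_cst, Cmod_R. fold x n1. lra. }
  assert (B3 : norm2 w <= e * ((e + n1) * x)).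
  { rewrite <- nrm_sq. apply Rmult_le_compat; auto; apply nrm_pos. }
  assert (B4 := norm2_pos w).
  replace (norm2 (u t) + 2 * fst (ip r (u t)) + norm2 w - norm2 (u t) - (tau - t) * 0)
    with (2 * fst (ip r (u t)) + norm2 w) by ring.
  apply Rle_trans with (1 := Rabs_triang _ _). rewrite Rabs_mult, (Rabs_pos_eq (norm2 w)), (Rabs_pos_eq 2) by lra.
  apply Rle_trans with (e * (2 * n0 + n1 + 1) * x).
  - assert (0 <= e * x) by (apply Rmult_le_pos; lra). nra.
  - now apply Rmult_le_compat_r.
Qed.

(** * Evolution of the resolvent *)

Lemma ip_ik (kappa : R) (f g : rdseq) : ip f (ik (- kappa) * g) = ip (ik kappa * f) g.
Proof.
  unfold ik. rewrite ip_cstl, ip_cstr. f_equal.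
  unfold Cconj, Ci, Cmult, RtoC; cbn [fst snd]. f_equal; ring.
Qed.

(** When <f, g> is real, f and i kappa g are orthogonal for the real part of the inner product, and
    this is Pythagoras. *)
Lemma norm2_self_adjoint (kappa : R) (f g : rdseq) : ip f g = ip g f ->
  norm2 (f + ik kappa * g) = norm2 f + kappa ^ 2 * norm2 g.
Proof.
  intros H. rewrite norm2_add. unfold ik at 1. rewrite ip_cstr.
  rewrite (ip_conj f g) in H. set (z := ip f g) in *.
  assert (Hz : snd z = 0).
  { apply (f_equal snd) in H. unfold Cconj in H. cbn [snd] in H. lra. }
  replace (norm2 (ik kappa * g)) with (kappa ^ 2 * norm2 g).
  - unfold Cconj, Ci, Cmult, RtoC; cbn [fst snd]. rewrite Hz. ring.
  - rewrite <- !nrm_sq. unfold ik. rewrite nrm_cst, Cmod_mult, Cmod_Ci, Cmod_R, <- (pow2_abs kappa). ring.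
Qed.

Lemma norm2_L (beta kappa : R) (u f : rdseq) :
  norm2 (opL beta u f + ik kappa * f) = norm2 (opL beta u f) + kappa ^ 2 * norm2 f.
Proof. apply norm2_self_adjoint, ip_L. Qed.

(** Self-adjointness alone bounds the inverse of L + i kappa by 1 / |kappa|, whatever the size of
    [u]. *)
Lemma resolvent_nrm (beta kappa : R) (u f : rdseq) :
  Rabs kappa * nrm f <= nrm (opL beta u f + ik kappa * f).
Proof.
  assert (h := norm2_L beta kappa u f). assert (h1 := norm2_pos (opL beta u f)).
  assert (h2 := nrm_pos f). assert (h3 := nrm_pos (opL beta u f + ik kappa * f)).
  assert (h4 := Rabs_pos kappa).
  apply Rsqr_incr_0; auto; [|now apply Rmult_le_pos]. unfold Rsqr.
  rewrite nrm_sq, h. rewrite <- nrm_sq in h1. rewrite <- (nrm_sq f), <- (pow2_abs kappa).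
  rewrite nrm_sq in h1. nra.
Qed.

Lemma opB_add (beta : R) (V u f g : rdseq) :
  opB beta V u (f + g) = (opB beta V u f + opB beta V u g)%A.
Proof.
  unfold opB. replace (Aconj u * (f + g))%A with (Aconj u * f + Aconj u * g)%A by ring.
  rewrite !AD_add, AP_add. ring.
Qed.

Lemma opB_cst (beta : R) (V u f : rdseq) (c : C) :
  opB beta V u (Acst c * f) = (Acst c * opB beta V u f)%A.
Proof.
  unfold opB. replace (Aconj u * (Acst c * f))%A with (Acst c * (Aconj u * f))%A by ring.
  rewrite !AD_cst_mul, AP_cst_mul. ring.
Qed.

Lemma opX_sub (u f g : rdseq) : opX u (f - g) = (opX u f - opX u g)%A.
Proof. unfold Asub. now rewrite opX_add, opX_opp. Qed.

Lemma opL_sub (beta : R) (u f g : rdseq) : opL beta u (f - g) = (opL beta u f - opL beta u g)%A.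
Proof. unfold opL. rewrite opX_sub. unfold Asub. rewrite AD_add, AD_opp. ring. Qed.

Lemma ip_subl (f g h : rdseq) : ip (f - g) h = (ip f h - ip g h)%C.
Proof. unfold Asub. now rewrite ip_addl, ip_oppl. Qed.

Lemma ip_subr (f g h : rdseq) : ip f (g - h) = (ip f g - ip f h)%C.
Proof. unfold Asub. now rewrite ip_addr, ip_oppr. Qed.

Lemma opL_cst (beta : R) (u f : rdseq) (c : C) : opL beta u (Acst c * f) = (Acst c * opL beta u f)%A.
Proof.
  unfold opL, opX. rewrite AD_cst_mul.
  replace (Aconj u * (Acst c * f))%A with (Acst c * (Aconj u * f))%A by ring.
  rewrite AP_cst_mul. ring.
Qed.

Lemma ik_opp (kappa : R) (f : rdseq) : (ik (- kappa) * f)%A = (- (ik kappa * f))%A.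
Proof.
  unfold ik. rewrite RtoC_opp. replace (Ci * - kappa)%C with (- (Ci * kappa))%C by ring.
  rewrite Acst_opp. ring.
Qed.

Lemma ip_resolvent (beta kappa : R) (u f g : rdseq) :
  ip f (opL beta u g + ik (- kappa) * g) = ip (opL beta u f + ik kappa * f) g.
Proof. now rewrite ip_addr, ip_addl, ip_ik, ip_L. Qed.

(** Formally b' = (L + i kappa)^(-1) (u' - L_t b); paired with u, the resolvent passes to the other
    side and produces [bs]. After the Lax identity all terms with the generator cancel by
    skew-adjointness, and only i (D V) survives. *)
Lemma resolvent_derivative_algebra (beta kappa : R) (V u b bs : rdseq) : Aconj V = V ->
  (opL beta u b + ik kappa * b)%A = u -> (opL beta u bs + ik (- kappa) * bs)%A = u ->
  (ip (opB beta V u u - Acst beta * dX u (opB beta V u u) b) bs + ip b (opB beta V u u))%C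
  = (- ip (Acst Ci * AD V * b) bs)%C.
Proof.
  intros HV Hb Hbs. rewrite (lax beta V u b HV).
  set (Bb := opB beta V u b).
  assert (E : opB beta V u (opL beta u b) = (opB beta V u u - ik kappa * Bb)%A).
  { rewrite <- Hb at 4. rewrite opB_add. unfold ik. rewrite opB_cst. fold Bb. ring. }
  rewrite E.
  replace (opB beta V u u - (opB beta V u u - ik kappa * Bb - opL beta u Bb + Acst Ci * AD V * b))%A
    with (opL beta u Bb + ik kappa * Bb - Acst Ci * AD V * b)%A by ring.
  rewrite ip_subl, <- ip_resolvent, Hbs. unfold Bb. rewrite ip_B by auto. ring.
Qed.

(** The second resolvent identity with [b0] frozen: up to the resolvent at [u], the difference is an
    increment of the explicit map v -> v - beta X_v b0. This is what replaces regularity of b in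
    time. *)
Lemma resolvent_difference (beta kappa : R) (u u0 b b0 : rdseq) :
  (opL beta u b + ik kappa * b)%A = u -> (opL beta u0 b0 + ik kappa * b0)%A = u0 ->
  (opL beta u (b - b0) + ik kappa * (b - b0) =
   (u + Acst (- beta) * opX u b0) - (u0 + Acst (- beta) * opX u0 b0))%A.
Proof.
  intros Hb Hb0. rewrite opL_sub, Acst_opp.
  transitivity ((opL beta u b + ik kappa * b) - (opL beta u b0 + ik kappa * b0))%A; [ring|].
  rewrite Hb. rewrite <- Hb0 at 1. unfold opL. ring.
Qed.

Lemma Aderiv_G (beta : R) (u : R -> rdseq) (t : R) (u' b : rdseq) : Aderiv u t u' ->
  Aderiv (fun s => u s + Acst (- beta) * opX (u s) b)%A t (u' - Acst beta * dX (u t) u' b)%A.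
Proof.
  intros Hu.
  apply Aderiv_ext with (u := fun s => (u s + Acst (- beta) * opX (u s) b)%A)
    (u' := (u' + (Acst 0 * opX (u t) b + Acst (- beta) * dX (u t) u' b))%A).
  - reflexivity.
  - rewrite Acst_opp. ring.
  - apply Aderiv_add; auto. apply (Aderiv_mul (fun _ => Acst (- beta))).
    + apply Aderiv_const.
    + now apply Aderiv_X.
Qed.

Lemma ip_L_real (beta : R) (u f : rdseq) : snd (ip (opL beta u f) f) = 0.
Proof.
  assert (H := ip_conj (opL beta u f) f). rewrite <- ip_L in H.
  apply (f_equal snd) in H. unfold Cconj in H. cbn [snd] in H. lra.
Qed.

(** <b, L b> is real, so only i kappa b contributes. With [norm2_L] this gives |L b|^2 = |u|^2 +
    kappa Im <b, u>. *)
Lemma resolvent_im (beta kappa : R) (u b : rdseq) :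
  (opL beta u b + ik kappa * b)%A = u -> snd (ip b u) = - kappa * norm2 b.
Proof.
  intros H. rewrite <- H at 1. rewrite ip_addr, <- ip_L. unfold ik. rewrite ip_cstr, ip_self.
  assert (h := ip_L_real beta u b).
  unfold Cconj, Ci, Cmult, Cplus, RtoC; cbn [fst snd]. lra.
Qed.

(** [b] and [bs] are any solutions of the resolvent equations near [t], with no continuity assumed;
    [resolvent_nrm] controls [bs] and its increments. *)
Lemma resolvent_derive (beta kappa d : R) (V : rdseq) (u b bs : R -> rdseq) (t : R) :
  0 < d -> 0 < kappa -> Aconj V = V ->
  Aderiv u t (opB beta V (u t) (u t)) ->
  (forall s, Rabs (s - t) < d -> (opL beta (u s) (b s) + ik kappa * b s)%A = u s) ->
  (forall s, Rabs (s - t) < d -> (opL beta (u s) (bs s) + ik (- kappa) * bs s)%A = u s) ->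
  is_derive (fun s => norm2 (u s) - kappa ^ 2 * norm2 (b s)) t
    (- kappa * snd (ip (Acst Ci * AD V * b t) (bs t))).
Proof.
  intros d0 k0 HV Hu Hb Hbs. set (u' := opB beta V (u t) (u t)) in *.
  set (G' := (u' - Acst beta * dX (u t) u' (b t))%A).
  assert (Ht : Rabs (t - t) < d) by (rewrite Rminus_diag, Rabs_R0; auto).
  assert (HF : is_derive (fun s => snd (ip (b s) (u s))) t
                 (- snd (ip (Acst Ci * AD V * b t) (bs t)))).
  { set (l := (- ip (Acst Ci * AD V * b t) (bs t))%C).
    change (is_derive (fun s => snd (ip (b s) (u s))) t (snd l)).
    assert (Hl : l = (ip G' (bs t) + ip (b t) u')%C).
    { symmetry. apply resolvent_derivative_algebra with (kappa := kappa); auto. }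
    apply is_derive_eps. intros eps He.
    set (n0 := nrm (u t)). set (n1 := nrm G'). set (n2 := nrm (b t)).
    assert (p0 : 0 <= n0) by apply nrm_pos. assert (p1 : 0 <= n1) by apply nrm_pos.
    assert (p2 : 0 <= n2) by apply nrm_pos.
    (* One summand for each error in [EF]: [(n0 + 1) / kappa] bounds [bs tau], [n1 / kappa] comes
       from [G'] against the increment of [bs], and [n2] is the norm of [b t]. *)
    set (M := (n0 + 1) / kappa + n1 / kappa + n2 + 1).
    assert (q1 : 0 <= (n0 + 1) / kappa) by (apply Rdiv_le_0_compat; lra).
    assert (q2 : 0 <= n1 / kappa) by (apply Rdiv_le_0_compat; lra).
    assert (M0 : 1 <= M) by (unfold M; lra).
    set (e := Rmin 1 (eps / M)).
    assert (e0 : 0 < e).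
    { apply Rmin_glb_lt; [lra|]. apply Rdiv_lt_0_compat; lra. }
    assert (e1 : e <= 1) by apply Rmin_l.
    assert (eM : e * M <= eps).
    { apply Rle_trans with (eps / M * M).
      - apply Rmult_le_compat_r; [lra|apply Rmin_r].
      - right. field. lra. }
    destruct (Aderiv_nrm _ _ _ Hu e e0) as [d1 [r1 H1]].
    destruct (Aderiv_nrm _ _ _ (Aderiv_G beta u t u' (b t) Hu) e e0) as [d2 [r2 H2]].
    destruct (Aderiv_nrm _ _ _ (Aderiv_G beta u t u' (bs t) Hu) e e0) as [d3 [r3 H3]].
    exists (Rmin (Rmin d d1) (Rmin d2 d3)). split; [repeat apply Rmin_glb_lt; auto|].
    intros tau Htau.
    assert (a1 := Rmin_l (Rmin d d1) (Rmin d2 d3)). assert (a2 := Rmin_r (Rmin d d1) (Rmin d2 d3)).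
    assert (a3 := Rmin_l d d1). assert (a4 := Rmin_r d d1).
    assert (a5 := Rmin_l d2 d3). assert (a6 := Rmin_r d2 d3).
    destruct (H1 tau ltac:(lra)) as [A1 A1']. destruct (H2 tau ltac:(lra)) as [A2 _].
    destruct (H3 tau ltac:(lra)) as [_ A3]. cbv beta in A2, A3. fold u' G' in A2.
    assert (Hbt := Hb tau ltac:(lra)). assert (Hbst := Hbs tau ltac:(lra)).
    assert (Hb0 := Hb t Ht). assert (Hbs0 := Hbs t Ht).
    assert (E1 := resolvent_difference beta kappa _ _ _ _ Hbt Hb0).
    assert (E2 := resolvent_difference beta (- kappa) _ _ _ _ Hbst Hbs0).
    set (D := Acst (RtoC (tau - t))) in *. set (x := Rabs (tau - t)) in *.
    assert (x0 : 0 <= x) by apply Rabs_pos.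
    set (G := (u tau + Acst (- beta) * opX (u tau) (b t) -
               (u t + Acst (- beta) * opX (u t) (b t)))%A) in *.
    assert (N1 : nrm (bs tau) <= (n0 + 1) / kappa).
    { assert (h := resolvent_nrm beta (- kappa) (u tau) (bs tau)).
      rewrite Hbst, Rabs_Ropp, (Rabs_pos_eq kappa) in h by lra.
      assert (h' : nrm (u tau) <= n0 + 1).
      { replace (u tau) with (u t + (u tau - u t))%A by ring.
        apply Rle_trans with (1 := nrm_add _ _). unfold n0. lra. }
      apply Rmult_le_reg_r with kappa; auto. unfold Rdiv. rewrite Rmult_assoc, Rinv_l; lra. }
    assert (N2 : nrm (bs tau - bs t) <= e / kappa).
    { assert (h := resolvent_nrm beta (- kappa) (u tau) (bs tau - bs t)).
      rewrite E2, Rabs_Ropp, (Rabs_pos_eq kappa) in h by lra.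
      apply Rmult_le_reg_r with kappa; auto. unfold Rdiv. rewrite Rmult_assoc, Rinv_l; lra. }
    (* [b tau - b t] paired with [u tau] becomes [G] paired with [bs tau]; the increments [G] and
       [u tau - u t] are then compared with their linear parts. *)
    assert (EF : (ip (b tau) (u tau) - ip (b t) (u t) - RtoC (tau - t)%R * l)%C =
       (ip (G - D * G')%A (bs tau) + RtoC (tau - t)%R * ip G' (bs tau - bs t)%A
        + ip (b t) (u tau - u t - D * u')%A)%C).
    { assert (S1 : ip (b tau - b t) (u tau) = ip G (bs tau)).
      { rewrite <- E1. rewrite <- ip_resolvent, Hbst. reflexivity. }
      rewrite Hl, !ip_subl, !ip_subr in *. unfold D. rewrite ip_cstl, ip_cstr, Cconj_RtoC.
      replace (ip (b tau) (u tau)) with ((ip (b tau) (u tau) - ip (b t) (u tau)) + ip (b t) (u tau))%C by ring.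
      rewrite S1. ring. }
    replace (snd (ip (b tau) (u tau)) - snd (ip (b t) (u t)) - (tau - t) * snd l)
      with (snd (ip (b tau) (u tau) - ip (b t) (u t) - RtoC (tau - t)%R * l)%C)
      by (unfold Cminus, Cplus, Copp, Cmult, RtoC; cbn [fst snd]; ring).
    apply Rle_trans with (1 := snd_le_Cmod _). rewrite EF.
    assert (T1 := Cmod_triangle (ip (G - D * G')%A (bs tau) + RtoC (tau - t)%R * ip G' (bs tau - bs t)%A)
                   (ip (b t) (u tau - u t - D * u')%A)).
    assert (T2 := Cmod_triangle (ip (G - D * G')%A (bs tau)) (RtoC (tau - t)%R * ip G' (bs tau - bs t)%A)).
    rewrite Cmod_mult, Cmod_R in T2. fold x in T2.
    assert (C1 := ip_CS (G - D * G') (bs tau)). assert (C2 := ip_CS G' (bs tau - bs t)).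
    assert (C3 := ip_CS (b t) (u tau - u t - D * u')).
    assert (B1 : nrm (G - D * G') * nrm (bs tau) <= e * x * ((n0 + 1) / kappa)).
    { apply Rmult_le_compat; auto; apply nrm_pos. }
    assert (B2 : nrm G' * nrm (bs tau - bs t) <= n1 * (e / kappa)).
    { apply Rmult_le_compat_l; auto. }
    assert (B3 : nrm (b t) * nrm (u tau - u t - D * u') <= n2 * (e * x)).
    { apply Rmult_le_compat_l; auto. }
    assert (B2' : x * Cmod (ip G' (bs tau - bs t)) <= x * (n1 * (e / kappa))).
    { apply Rmult_le_compat_l; auto. lra. }
    apply Rle_trans with (e * M * x); [|now apply Rmult_le_compat_r].
    unfold M. unfold Rdiv in *. assert (0 <= e * x) by (apply Rmult_le_pos; lra). lra. }
  assert (HD : is_derive (fun s => norm2 (u s) + kappa * snd (ip (b s) (u s))) t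
     (- kappa * snd (ip (Acst Ci * AD V * b t) (bs t)))).
  { set (l := snd (ip (Acst Ci * AD V * b t) (bs t))) in *.
    replace (- kappa * l) with (0 + kappa * - l) by ring.
    apply (is_derive_plus (fun s => norm2 (u s)) (fun s => kappa * snd (ip (b s) (u s))) t 0 (kappa * - l)).
    - exact (mass_derive beta V u t HV Hu).
    - exact (is_derive_scal (fun s => snd (ip (b s) (u s))) t kappa (- l) HF). }
  apply is_derive_ext_loc with (2 := HD). exists (mkposreal d d0). intros s Hs.
  rewrite (resolvent_im beta kappa (u s) (b s)); [real_eq; ring|]. apply Hb. exact Hs.
Qed.

(* With c = (bs - b) / (2 i kappa) and x = L c one has b = x - i kappa c and bs = x + i kappa c:
   the diagonal terms of <v b, bs> are real, and only the cross term 2 kappa Re <v x, c> survives. *)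
Lemma resolvent_derive_bound (beta kappa : R) (u b bs v : rdseq) : 0 < kappa -> Aconj v = v ->
  (opL beta u b + ik kappa * b)%A = u -> (opL beta u bs + ik (- kappa) * bs)%A = u ->
  Rabs (- kappa * snd (ip (v * b) bs)) <=
  l1 v * ((norm2 u - kappa ^ 2 * norm2 b) + norm2 u / kappa ^ 2).
Proof.
  intros k0 Hv Hb Hbs.
  assert (kC : RtoC kappa <> 0%C) by (intros h; apply RtoC_inj in h; lra).
  assert (Ci0 := Ci_neq_0). set (z := (/ (2 * Ci * kappa))%C).
  assert (Hz : (Ci * kappa * z)%C = (/ 2)%C) by (unfold z; field; auto).
  set (c := (Acst z * (bs - b))%A).
  assert (HI : (ik kappa * c)%A = (Acst (/ 2) * (bs - b))%A).
  { unfold ik, c. now rewrite Amul_assoc, <- Acst_mult, Hz. }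
  assert (H2 : Acst 1 = (Acst (/ 2) + Acst (/ 2))%A).
  { rewrite <- Acst_plus. f_equal. field. }
  assert (Hd : opL beta u (bs - b) = (ik kappa * (b + bs))%A).
  { rewrite opL_sub.
    replace (opL beta u bs) with (u - ik (- kappa) * bs)%A by (rewrite <- Hbs at 1; ring).
    replace (opL beta u b) with (u - ik kappa * b)%A by (rewrite <- Hb at 1; ring).
    rewrite ik_opp. ring. }
  set (x := opL beta u c).
  assert (Hx : x = (Acst (/ 2) * (b + bs))%A).
  { unfold x, c. rewrite opL_cst, Hd, <- Hz, Acst_mult. unfold ik. ring. }
  assert (Eb : b = (x + ik (- kappa) * c)%A).
  { rewrite ik_opp, HI, Hx. transitivity (Acst 1 * b)%A; [ring|]. rewrite H2. ring. }
  assert (Ebs : bs = (x + ik kappa * c)%A).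
  { rewrite HI, Hx. transitivity (Acst 1 * bs)%A; [ring|]. rewrite H2. ring. }
  assert (Nb : norm2 b = norm2 x + kappa ^ 2 * norm2 c).
  { rewrite Eb at 1. unfold x at 1. rewrite norm2_L. fold x. ring. }
  assert (Nu : norm2 u = norm2 (opL beta u b) + kappa ^ 2 * norm2 b).
  { rewrite <- Hb at 1. apply norm2_L. }
  (* Since x = L c, L b = L x - i kappa x, whose squared norm is |L x|^2 + kappa^2 |x|^2. *)
  assert (NL : kappa ^ 2 * norm2 x <= norm2 (opL beta u b)).
  { rewrite Eb, opL_add.
    unfold ik at 1. rewrite opL_cst. fold x (ik (- kappa)). rewrite norm2_L.
    assert (h := norm2_pos (opL beta u x)). lra. }
  assert (Him : snd (ip (v * b) bs) = - kappa * (2 * fst (ip (v * x) c))).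
  { rewrite Eb, Ebs.
    replace (v * (x + ik (- kappa) * c))%A with (v * x + ik (- kappa) * (v * c))%A by ring.
    assert (R1 : forall f, snd (ip (v * f) f) = 0).
    { intros f. assert (h := ip_mul v f f). rewrite Hv, (ip_conj (v * f) f) in h.
      apply (f_equal snd) in h. unfold Cconj in h. cbn [snd] in h. lra. }
    assert (R2 : ip (v * c) x = Cconj (ip (v * x) c)).
    { rewrite <- ip_conj, ip_mul, Hv. reflexivity. }
    unfold ik. rewrite !ip_addl, !ip_addr, !ip_cstl, !ip_cstr, R2.
    assert (h1 := R1 x). assert (h2 := R1 c).
    rewrite RtoC_opp.
    destruct (ip (v * x) x) as [z1 z2]. destruct (ip (v * c) c) as [z3 z4].
    destruct (ip (v * x) c) as [z5 z6]. cbn [snd] in h1, h2. subst z2 z4.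
    unfold Cconj, Cmult, Cplus, Copp, Ci, RtoC; cbn [fst snd]. ring. }
  assert (Hc := ip_CS (v * x) c). assert (Hy := young v x).
  assert (Hf := fst_le_Cmod (ip (v * x) c)).
  assert (l0 := l1_pos v). assert (x0 := nrm_pos x). assert (c0 := nrm_pos c).
  assert (B : Rabs (fst (ip (v * x) c)) <= l1 v * (nrm x * nrm c)).
  { apply Rle_trans with (1 := Hf). apply Rle_trans with (1 := Hc). rewrite <- Rmult_assoc.
    now apply Rmult_le_compat_r. }
  rewrite Him.
  replace (- kappa * (- kappa * (2 * fst (ip (v * x) c)))) with (2 * kappa ^ 2 * fst (ip (v * x) c)) by ring.
  rewrite Rabs_mult, Rabs_pos_eq by nra.
  apply Rle_trans with (l1 v * (2 * ((kappa * nrm x) * (kappa * nrm c)))).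
  { apply Rle_trans with (2 * kappa ^ 2 * (l1 v * (nrm x * nrm c))).
    - apply Rmult_le_compat_l; auto. nra.
    - right. ring. }
  apply Rmult_le_compat_l; auto.
  assert (S1 : (kappa * nrm x) ^ 2 <= norm2 u - kappa ^ 2 * norm2 b).
  { rewrite Rpow_mult_distr. replace (nrm x ^ 2) with (norm2 x) by (rewrite <- nrm_sq; ring). lra. }
  (* kappa^4 |c|^2 <= kappa^2 |b|^2 <= |u|^2: this is the origin of the error of order
     kappa^(-2). *)
  assert (S2 : (kappa * nrm c) ^ 2 <= norm2 u / kappa ^ 2).
  { rewrite Rpow_mult_distr. replace (nrm c ^ 2) with (norm2 c) by (rewrite <- nrm_sq; ring).
    apply Rmult_le_reg_r with (kappa ^ 2); [nra|].
    replace (norm2 u / kappa ^ 2 * kappa ^ 2) with (norm2 u) by (field; lra).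
    assert (h1 := norm2_pos (opL beta u b)). assert (h2 := norm2_pos x).
    rewrite Nu, Nb. nra. }
  assert (h := pow2_ge_0 (kappa * nrm x - kappa * nrm c)). lra.
Qed.

(** * Gronwall inequality *)

Lemma gronwall_pos (f : R -> R) (nu T : R) : 0 <= nu ->
  (forall t, Rabs t < T -> exists l : R, is_derive f t l /\ Rabs l <= nu * f t) ->
  forall t, 0 <= t < T -> f t <= exp (nu * t) * f 0.
Proof.
  intros n0 H t Ht.
  set (g := fun s => f s * exp (- nu * s)).
  assert (Hg : forall s, Rabs s < T -> exists l : R, is_derive g s l /\ l <= 0).
  { intros s Hs. destruct (H s Hs) as [l [Hl Hb]].
    exists (l * exp (- nu * s) + f s * (- nu * exp (- nu * s))). split.
    - unfold g. auto_derive.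
      + repeat split. now exists l.
      + change (Derive (fun x => f x) s) with (Derive f s). rewrite (is_derive_unique _ _ _ Hl). ring.
    - assert (h := exp_pos (- nu * s)). assert (h1 := Rle_abs l). nra. }
  enough (Hle : g t <= g 0).
  { unfold g in Hle. rewrite Rmult_0_r, exp_0, Rmult_1_r in Hle.
    replace (f t) with (exp (nu * t) * (f t * exp (- nu * t))).
    - apply Rmult_le_compat_l; auto. left. apply exp_pos.
    - rewrite Rmult_comm, Rmult_assoc, <- exp_plus.
      replace (- nu * t + nu * t) with 0 by ring. rewrite exp_0. ring. }
  destruct (Req_dec t 0) as [->|h]; [lra|].
  assert (Hex : forall s, 0 <= s <= t -> exists l : R, is_derive g s l /\ l <= 0).
  { intros s Hs. apply Hg. rewrite Rabs_pos_eq; lra. }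
  destruct (MVT_gen g 0 t (Derive g)) as [x [Hx1 Hx2]].
  - intros s Hs. rewrite Rmin_left, Rmax_right in Hs by lra.
    destruct (Hex s ltac:(lra)) as [l [Hl _]]. apply Derive_correct. now exists l.
  - intros s Hs. rewrite Rmin_left, Rmax_right in Hs by lra.
    destruct (Hex s ltac:(lra)) as [l [Hl _]]. apply continuity_pt_filterlim.
    apply (ex_derive_continuous g s). now exists l.
  - rewrite Rmin_left, Rmax_right in Hx1 by lra.
    destruct (Hex x Hx1) as [l [Hl Hl0]]. rewrite (is_derive_unique _ _ _ Hl) in Hx2. nra.
Qed.

(** The hypothesis bounds the modulus of the derivative, so it is invariant under t -> -t and
    negative times reduce to positive ones. *)
Lemma gronwall (f : R -> R) (nu T : R) : 0 <= nu -> 0 <= f 0 ->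
  (forall t, Rabs t < T -> exists l : R, is_derive f t l /\ Rabs l <= nu * f t) ->
  forall t, Rabs t < T -> f t <= exp (nu * T) * f 0.
Proof.
  intros n0 f0 H t Ht.
  assert (K : forall s, 0 <= s < T -> exp (nu * s) * f 0 <= exp (nu * T) * f 0).
  { intros s Hs. apply Rmult_le_compat_r; auto.
    destruct (Rle_lt_or_eq_dec (nu * s) (nu * T)) as [h|h].
    - apply Rmult_le_compat_l; lra.
    - left. now apply exp_increasing.
    - rewrite h. lra. }
  destruct (Rle_dec 0 t) as [h|h].
  - rewrite Rabs_pos_eq in Ht by auto.
    apply Rle_trans with (1 := gronwall_pos f nu T n0 H t (conj h Ht)). apply K. lra.
  - rewrite Rabs_left in Ht by lra.
    assert (H' : forall s, Rabs s < T -> exists l : R, is_derive (fun s => f (- s)) s l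
                  /\ Rabs l <= nu * f (- s)).
    { intros s Hs. destruct (H (- s)) as [l [Hl Hb]]; [now rewrite Rabs_Ropp|].
      exists (- l). split; [|now rewrite Rabs_Ropp].
      replace (- l) with (-1 * l) by ring.
      apply (is_derive_comp f (fun s => - s) s l (-1)); auto. auto_derive; auto. }
    assert (A := gronwall_pos (fun s => f (- s)) nu T n0 H' (- t) ltac:(lra)).
    cbv beta in A. rewrite Ropp_involutive, Ropp_0 in A.
    apply Rle_trans with (1 := A). apply K. lra.
Qed.

(** * Comparison of the energies seen by L and by D *)

Lemma nrm_D_Rk (kappa : R) (H : 1 <= Rabs kappa) (f : rdseq) : nrm (AD (Rk kappa H f)) <= nrm f.
Proof.
  rewrite <- (Rk_inv kappa H f) at 2. apply sqrt_le_1_alt. rewrite norm2_Dk.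
  assert (h := norm2_pos (Rk kappa H f)). assert (h1 := pow2_ge_0 kappa). nra.
Qed.

Lemma Rk_resolvent (beta kappa : R) (H : 1 <= Rabs kappa) (u b : rdseq) :
  (opL beta u b + ik kappa * b)%A = u ->
  (Rk kappa H u = b + Rk kappa H (Acst beta * opX u b))%A.
Proof.
  intros E. apply rd_ext. intros k.
  assert (Ek : ((IZR k + Ci * kappa) * b k + (Acst beta * opX u b)%A k)%C = u k).
  { rewrite <- E at 2. unfold opL, ik. rewrite !Aadd_co, !Amul_cst, AD_co. ring. }
  rewrite Aadd_co. cbn [Rk Adiag co]. rewrite <- Ek. field.
  apply Cmod_gt_0. destruct (Rk_bound kappa k H). lra.
Qed.

(** Both |D (D + i kappa)^(-1) u| and |L b| differ from |D b| by at most |w|, where w = beta X b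
    satisfies |w| <= (|D b| + mu |b|) / 4 and mu |b| <= y = mu r / kappa. So each is at most 5/3 of
    the other plus 2/3 of y, rounded to 2 and 1, and (2 a + y)^2 <= 8 a^2 + 2 y^2. *)
Lemma energy_comparison (beta kappa mu r : R) (H : 1 <= Rabs kappa) (u b : rdseq) :
  1 <= mu <= kappa -> 0 <= r ->
  (forall f, beta ^ 2 * norm2 (opX u f) <= / 16 * (norm2 (AD f) + mu ^ 2 * norm2 f)) ->
  (opL beta u b + ik kappa * b)%A = u -> norm2 u <= r ^ 2 ->
  norm2 (AD (Rk kappa H u)) <= 8 * norm2 (opL beta u b) + 2 * mu ^ 2 * r ^ 2 / kappa ^ 2 /\
  norm2 (opL beta u b) <= 8 * norm2 (AD (Rk kappa H u)) + 2 * mu ^ 2 * r ^ 2 / kappa ^ 2.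
Proof.
  intros Hmu r0 HX E Hr.
  set (w := (Acst beta * opX u b)%A).
  assert (nb := nrm_pos b). assert (nD := nrm_pos (AD b)). assert (nw := nrm_pos w).
  assert (Hu : nrm u <= r).
  { apply Rsqr_incr_0; auto using nrm_pos. unfold Rsqr. rewrite nrm_sq. lra. }
  assert (Hb : mu * nrm b <= mu * r / kappa).
  { assert (h := resolvent_nrm beta kappa u b). rewrite E, Rabs_pos_eq in h by lra.
    apply Rmult_le_reg_r with kappa; [lra|].
    replace (mu * r / kappa * kappa) with (mu * r) by (field; lra). nra. }
  assert (Hw : nrm w <= / 4 * (nrm (AD b) + mu * nrm b)).
  { assert (h : 0 <= mu * nrm b) by (apply Rmult_le_pos; lra).
    apply Rsqr_incr_0; [|auto|lra]. unfold Rsqr. unfold w at 1. rewrite nrm_cst.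
    unfold w. rewrite nrm_cst, Cmod_R.
    replace (Rabs beta * nrm (opX u b) * (Rabs beta * nrm (opX u b)))
      with (Rabs beta ^ 2 * (nrm (opX u b) * nrm (opX u b))) by ring.
    rewrite pow2_abs, nrm_sq. apply Rle_trans with (1 := HX b). rewrite <- !nrm_sq. nra. }
  assert (E0 := Rk_resolvent beta kappa H u b E). fold w in E0.
  assert (N0 : nrm (AD (Rk kappa H u)) <= nrm (AD b) + nrm w).
  { rewrite E0, AD_add. apply Rle_trans with (1 := nrm_add _ _).
    apply Rplus_le_compat_l. apply nrm_D_Rk. }
  assert (N0' : nrm (AD b) <= nrm (AD (Rk kappa H u)) + nrm w).
  { replace (AD b) with (AD (Rk kappa H u) - AD (Rk kappa H w))%A by (rewrite E0, AD_add; ring).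
    apply Rle_trans with (1 := nrm_sub _ _). apply Rplus_le_compat_l. apply nrm_D_Rk. }
  assert (N1 : nrm (opL beta u b) <= nrm (AD b) + nrm w) by apply nrm_add.
  assert (N1' : nrm (AD b) <= nrm (opL beta u b) + nrm w).
  { replace (AD b) with (opL beta u b - w)%A by (unfold opL, w; ring). apply nrm_sub. }
  set (y := mu * r / kappa) in *.
  assert (y0 : 0 <= y).
  { unfold y. apply Rdiv_le_0_compat; [apply Rmult_le_pos|]; lra. }
  replace (2 * mu ^ 2 * r ^ 2 / kappa ^ 2) with (2 * y ^ 2) by (unfold y; field; lra).
  rewrite <- !nrm_sq.
  assert (q1 := nrm_pos (AD (Rk kappa H u))). assert (q2 := nrm_pos (opL beta u b)).
  assert (C1 : nrm (AD (Rk kappa H u)) <= 2 * nrm (opL beta u b) + y) by lra.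
  assert (C2 : nrm (opL beta u b) <= 2 * nrm (AD (Rk kappa H u)) + y) by lra.
  split.
  - assert (h := pow2_ge_0 (2 * nrm (opL beta u b) - y)). nra.
  - assert (h := pow2_ge_0 (2 * nrm (AD (Rk kappa H u)) - y)). nra.
Qed.

(** * Dyadic decomposition of the Sobolev norm *)

(** With a ratio of at least 2 a geometric sum stays below its next term. The ratio in use is
    [Rpower 4 s], which is at least 2 because s >= 1/2. *)
Lemma sum_below (rho : R) (m n : nat) : 2 <= rho ->
  sum_n (fun j => if Nat.ltb j m then rho ^ j else 0) n <= rho ^ m.
Proof.
  intros Hr. apply Rle_trans with (rho ^ (Nat.min (S n) m)); [|apply Rle_pow; lia || lra].
  induction n.
  - rewrite sum_O. destruct (Nat.ltb_spec 0 m).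
    + rewrite Nat.min_l by lia. simpl. lra.
    + apply pow_le. lra.
  - rewrite sum_SnR. destruct (Nat.ltb_spec (S n) m).
    + rewrite Nat.min_l by lia. rewrite Nat.min_l in IHn by lia.
      assert (0 < rho ^ S n) by (apply pow_lt; lra).
      change (rho ^ S (S n)) with (rho * rho ^ S n). nra.
    + rewrite Nat.min_r by lia. rewrite Nat.min_r in IHn by lia. lra.
Qed.

Lemma sum_above (theta : R) (m n : nat) : 0 < theta < 1 ->
  sum_n (fun j => if Nat.ltb j m then 0 else theta ^ j) n <= theta ^ m / (1 - theta).
Proof.
  intros Ht.
  enough (sum_n (fun j => if Nat.ltb j m then 0 else theta ^ j) n
          <= theta ^ m / (1 - theta) - theta ^ (Nat.max (S n) m) / (1 - theta)).
  { assert (0 < theta ^ Nat.max (S n) m / (1 - theta)).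
    { apply Rdiv_lt_0_compat; [apply pow_lt|]; lra. } lra. }
  assert (Hs : forall k, theta ^ k / (1 - theta) = theta ^ k + theta ^ S k / (1 - theta)).
  { intros k. simpl. field. lra. }
  induction n.
  - rewrite sum_O. destruct (Nat.ltb_spec 0 m).
    + rewrite Nat.max_r by lia. lra.
    + replace m with 0%nat by lia. change (Nat.max 1 0) with 1%nat. rewrite (Hs 0%nat). lra.
  - rewrite sum_SnR. destruct (Nat.ltb_spec (S n) m).
    + rewrite Nat.max_r by lia. rewrite Nat.max_r in IHn by lia. lra.
    + rewrite Nat.max_l by lia. rewrite Nat.max_l in IHn by lia. rewrite (Hs (S n)) in IHn. lra.
Qed.

Lemma sum_n_le (a b : nat -> R) (n : nat) : (forall j, a j <= b j) -> sum_n a n <= sum_n b n.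
Proof.
  intros H. induction n.
  - rewrite !sum_O. apply H.
  - rewrite !sum_SnR. assert (h := H (S n)). lra.
Qed.

Lemma sum_n_scal (c : R) (a : nat -> R) (n : nat) : sum_n (fun j => c * a j) n = c * sum_n a n.
Proof.
  induction n.
  - now rewrite !sum_O.
  - rewrite !sum_SnR, IHn. real_eq. ring.
Qed.

Lemma sum_n_add (a b : nat -> R) (n : nat) : sum_n (fun j => a j + b j) n = sum_n a n + sum_n b n.
Proof.
  induction n.
  - now rewrite !sum_O.
  - rewrite !sum_SnR, IHn. real_eq. ring.
Qed.

Lemma sum_n_pos (a : nat -> R) (n : nat) : (forall j, 0 <= a j) -> 0 <= sum_n a n.
Proof.
  intros H. replace 0 with (sum_n (fun _ => 0 * 0) n) at 1.
  - apply sum_n_le. intros j. rewrite Rmult_0_l. apply H.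
  - rewrite sum_n_scal. real_eq. ring.
Qed.

Lemma sum_n_term (a : nat -> R) (n j : nat) : (forall j, 0 <= a j) -> (j <= n)%nat ->
  a j <= sum_n a n.
Proof.
  intros H Hj. induction n.
  - replace j with 0%nat by lia. rewrite sum_O. lra.
  - rewrite sum_SnR. destruct (Nat.eq_dec j (S n)) as [->|h].
    + assert (h := sum_n_pos a n H). lra.
    + assert (h1 := IHn ltac:(lia)). assert (h2 := H (S n)). lra.
Qed.

Definition Wt (s : R) (k : Z) : R := Rpower (1 + IZR k ^ 2) s.
(** The squared modulus of the symbol of D (D + i kappa)^(-1) at kappa = 2^j: a smooth cutoff to
    frequencies beyond 2^j. *)
Definition highpass (j : nat) (k : Z) : R := IZR k ^ 2 / (IZR k ^ 2 + 4 ^ j).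
Definition Hsq (s : R) (f : rdseq) : R := ZSeriesR (fun k => Wt s k * Cmod (f k) ^ 2).

Lemma pow4_pos (j : nat) : 0 < 4 ^ j.
Proof. apply pow_lt. lra. Qed.

Lemma highpass_bounds (j : nat) (k : Z) : 0 <= highpass j k <= 1.
Proof.
  assert (h := pow2_ge_0 (IZR k)). assert (h1 := pow4_pos j). unfold highpass. split.
  - apply Rdiv_le_0_compat; lra.
  - apply Rmult_le_reg_r with (IZR k ^ 2 + 4 ^ j); [lra|].
    unfold Rdiv. rewrite Rmult_assoc, Rinv_l; lra.
Qed.

Lemma highpass_le (j : nat) (k : Z) : highpass j k <= IZR k ^ 2 / 4 ^ j.
Proof.
  assert (h := pow2_ge_0 (IZR k)). assert (h1 := pow4_pos j). unfold highpass, Rdiv.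
  apply Rmult_le_compat_l; auto. apply Rinv_le_contravar; lra.
Qed.

Lemma rho_bounds (s : R) : 1 / 2 <= s < 1 -> 2 <= Rpower 4 s < 4.
Proof.
  intros Hs. split.
  - replace 2 with (Rpower 4 (/ 2)).
    + apply Rle_Rpower; lra.
    + replace 4 with (2 ^ 2) by ring. rewrite <- Rpower_pow, Rpower_mult by lra.
      replace (INR 2 * / 2) with 1 by (simpl; field). apply Rpower_1. lra.
  - rewrite <- (Rpower_1 4) at 2 by lra. apply Rpower_lt; lra.
Qed.

Lemma Rpower_pow4 (s : R) (j : nat) : Rpower (4 ^ j) s = Rpower 4 s ^ j.
Proof.
  rewrite <- !Rpower_pow by (try apply exp_pos; lra).
  rewrite !Rpower_mult. f_equal. ring.
Qed.

Lemma Wt_pos (s : R) (k : Z) : 0 < Wt s k.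
Proof. apply exp_pos. Qed.

Lemma Wt_le (s : R) (k : Z) : 0 <= s <= 1 -> Wt s k <= 1 + IZR k ^ 2.
Proof.
  intros Hs. unfold Wt. assert (h := pow2_ge_0 (IZR k)).
  rewrite <- (Rpower_1 (1 + IZR k ^ 2)) at 2 by lra. apply Rle_Rpower; lra.
Qed.

Lemma dyadic_index (k : Z) : k <> 0%Z -> exists j : nat, 4 ^ j <= IZR k ^ 2 < 4 * 4 ^ j /\
  (forall n, Rabs (IZR k) < 2 ^ S n -> (j <= n)%nat).
Proof.
  intros Hk. exists (Z.to_nat (Z.log2 (Z.abs k))).
  assert (L := Z.log2_spec (Z.abs k) ltac:(lia)). assert (L0 := Z.log2_nonneg (Z.abs k)).
  set (l := Z.log2 (Z.abs k)) in *.
  assert (El : l = Z.of_nat (Z.to_nat l)) by lia.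
  set (j := Z.to_nat l) in *. rewrite El in L.
  rewrite <- Nat2Z.inj_succ in L.
  assert (L1 : 2 ^ j <= Rabs (IZR k)).
  { rewrite <- abs_IZR, pow_IZR. apply IZR_le. lia. }
  assert (L2 : Rabs (IZR k) < 2 ^ S j).
  { rewrite <- abs_IZR, pow_IZR. apply IZR_lt. lia. }
  assert (E4 : 4 ^ j = (2 ^ j) ^ 2).
  { replace 4 with (2 ^ 2) by ring. rewrite <- !pow_mult. f_equal. lia. }
  assert (P := pow_lt 2 j ltac:(lra)). rewrite <- (pow2_abs (IZR k)), E4. simpl in L2. repeat split.
  - apply pow_incr. lra.
  - assert (h := Rabs_pos (IZR k)). nra.
  - intros n Hn. destruct (le_lt_dec j n) as [h|h]; auto. exfalso.
    assert (h1 : 2 ^ S n <= 2 ^ j) by (apply Rle_pow; lia || lra). lra.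
Qed.

(** One dyadic term suffices: if 4^j <= k^2 < 4^(j+1), then [highpass j k] is at least 1/2 and
    [Wt s k] is at most 8 times [Rpower 4 s ^ j]. The summand 1 serves k = 0. *)
Lemma Wt_le_dyadic (s : R) (n : nat) (k : Z) : 1 / 2 <= s < 1 -> Rabs (IZR k) < 2 ^ S n ->
  Wt s k <= 1 + 16 * sum_n (fun j => Rpower 4 s ^ j * highpass j k) n.
Proof.
  intros Hs Hk. assert (Hr := rho_bounds s Hs).
  assert (Hpos : forall j, 0 <= Rpower 4 s ^ j * highpass j k).
  { intros j. apply Rmult_le_pos; [apply pow_le; lra|apply highpass_bounds]. }
  destruct (Z.eq_dec k 0) as [->|h].
  - unfold Wt. replace (1 + 0 ^ 2) with 1 by ring.
    replace (Rpower 1 s) with 1 by (unfold Rpower; rewrite ln_1, Rmult_0_r; symmetry; apply exp_0).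
    assert (h1 := sum_n_pos _ n Hpos). lra.
  - destruct (dyadic_index k h) as [j [[h1 h2] h3]].
    assert (Hq : / 2 <= highpass j k).
    { unfold highpass. assert (h4 := pow4_pos j). apply Rmult_le_reg_r with (IZR k ^ 2 + 4 ^ j); [lra|].
      unfold Rdiv. rewrite Rmult_assoc, Rinv_l; lra. }
    assert (HW : Wt s k <= 8 * Rpower 4 s ^ j).
    { unfold Wt. apply Rle_trans with (Rpower (8 * 4 ^ j) s).
      - apply Rle_Rpower_l; [lra|]. split; [|].
        + assert (h4 := pow2_ge_0 (IZR k)). lra.
        + assert (h4 := pow_R1_Rle 4 j ltac:(lra)). lra.
      - rewrite <- Rpower_mult_distr by (try apply pow4_pos; lra).
        rewrite Rpower_pow4. apply Rmult_le_compat_r; [apply pow_le; lra|].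
        rewrite <- (Rpower_1 8) at 2 by lra. apply Rle_Rpower; lra. }
    assert (Ht := sum_n_term _ n j Hpos (h3 n Hk)). cbv beta in Ht.
    assert (0 < Rpower 4 s ^ j) by (apply pow_lt; lra). nra.
Qed.

(** Up to the dyadic index of k the terms are bounded by a geometric sum of ratio rho >= 2, hence by
    its last term; beyond it [highpass j k <= k^2 / 4^j] makes them decay with ratio rho / 4. Here s
    < 1 is used, and the constant degenerates as s tends to 1. *)
Lemma dyadic_le_Wt (s : R) (n : nat) (k : Z) : 1 / 2 <= s < 1 ->
  sum_n (fun j => Rpower 4 s ^ j * highpass j k) n <= (4 + 16 / (4 - Rpower 4 s)) * Wt s k.
Proof.
  intros Hs. assert (Hr := rho_bounds s Hs). set (rho := Rpower 4 s) in *.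
  assert (HC : 0 < 16 / (4 - rho)) by (apply Rdiv_lt_0_compat; lra).
  destruct (Z.eq_dec k 0) as [->|h].
  - replace (sum_n (fun j => rho ^ j * highpass j 0) n) with 0.
    + assert (h := Wt_pos s 0). nra.
    + rewrite (sum_n_ext _ (fun _ => 0 * 0)); [rewrite sum_n_scal; real_eq; ring|].
      intros j. unfold highpass. real_eq. field. assert (h := pow4_pos j). simpl. lra.
  - destruct (dyadic_index k h) as [j0 [[h1 h2] _]].
    assert (HW : rho ^ j0 <= Wt s k).
    { unfold rho, Wt. rewrite <- Rpower_pow4. apply Rle_Rpower_l; [lra|].
      split; [apply pow4_pos|lra]. }
    set (theta := rho / 4).
    assert (Ht : 0 < theta < 1) by (unfold theta; lra).
    apply Rle_trans with (sum_n (fun j => (if Nat.ltb j (S j0) then rho ^ j else 0) +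
       (4 * 4 ^ j0) * (if Nat.ltb j (S j0) then 0 else theta ^ j)) n).
    + apply sum_n_le. intros j. assert (hp : 0 < rho ^ j) by (apply pow_lt; lra).
      assert (hq := highpass_bounds j k). destruct (Nat.ltb j (S j0)).
      * nra.
      * assert (hq' := highpass_le j k). assert (h4 := pow4_pos j).
        rewrite Rplus_0_l. unfold theta, Rdiv. rewrite Rpow_mult_distr, pow_inv.
        apply Rle_trans with (rho ^ j * (4 * 4 ^ j0 * / 4 ^ j)).
        -- apply Rmult_le_compat_l; [lra|]. apply Rle_trans with (1 := hq').
           apply Rmult_le_compat_r; [|lra]. left. now apply Rinv_0_lt_compat.
        -- right. ring.
    + rewrite sum_n_add, sum_n_scal.
      assert (A1 := sum_below rho (S j0) n ltac:(lra)).
      assert (A2 := sum_above theta (S j0) n Ht).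
      assert (h4 := pow4_pos j0).
      assert (A3 : 4 * 4 ^ j0 * (theta ^ S j0 / (1 - theta)) = 4 * rho / (4 - rho) * rho ^ j0).
      { unfold theta. replace ((rho / 4) ^ S j0) with (rho / 4 * (rho ^ j0 * / 4 ^ j0)).
        - field. lra.
        - simpl. unfold Rdiv. rewrite Rpow_mult_distr, pow_inv. ring. }
      assert (A4 : 4 * 4 ^ j0 * sum_n (fun j => if Nat.ltb j (S j0) then 0 else theta ^ j) n
               <= 4 * rho / (4 - rho) * rho ^ j0).
      { rewrite <- A3. apply Rmult_le_compat_l; lra. }
      assert (hp : 0 < rho ^ j0) by (apply pow_lt; lra).
      assert (A5 : 4 * rho / (4 - rho) <= 16 / (4 - rho)).
      { unfold Rdiv. apply Rmult_le_compat_r; [|lra]. left. apply Rinv_0_lt_compat. lra. }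
      assert (A6 : rho ^ S j0 <= 4 * rho ^ j0) by (simpl; nra).
      assert (A7 := Rmult_le_compat_r (rho ^ j0) _ _ (Rlt_le _ _ hp) A5).
      apply Rle_trans with ((4 + 16 / (4 - rho)) * rho ^ j0).
      { rewrite Rmult_plus_distr_r. apply Rplus_le_compat; [exact (Rle_trans _ _ _ A1 A6)|exact (Rle_trans _ _ _ A4 A7)]. }
      apply Rmult_le_compat_l; lra.
Qed.

Lemma weighted_summable (w : Z -> R) (c : R) (f : rdseq) :
  (forall k, 0 <= w k <= c * (1 + IZR k ^ 2)) -> summable (fun k => w k * Cmod (f k) ^ 2).
Proof.
  intros H. apply summable_le with (fun k => c * (Cmod (f k) ^ 2 + Cmod (AD f k) ^ 2)).
  - intros k. rewrite AD_co, Cmod_mult, Cmod_R, Rpow_mult_distr, pow2_abs.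
    assert (h := H k). assert (h1 := pow2_ge_0 (Cmod (f k))).
    rewrite Rabs_pos_eq by (apply Rmult_le_pos; lra). nra.
  - apply summable_scal, summable_plus; apply sq_summable.
Qed.

Lemma Hsq_summable (s : R) (f : rdseq) : 0 <= s <= 1 -> summable (fun k => Wt s k * Cmod (f k) ^ 2).
Proof.
  intros Hs. apply (weighted_summable _ 1). intros k. assert (h := Wt_le s k Hs).
  assert (h1 := Wt_pos s k). lra.
Qed.

Lemma Hsq_pos (s : R) (f : rdseq) : 0 <= s <= 1 -> 0 <= Hsq s f.
Proof.
  intros Hs. apply ZS_pos; [now apply Hsq_summable|]. intros k.
  apply Rmult_le_pos; [left; apply Wt_pos|apply pow2_ge_0].
Qed.

Lemma Hsq_le_H1 (s : R) (f : rdseq) : 0 <= s <= 1 -> Hsq s f <= norm2 f + norm2 (AD f).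
Proof.
  intros Hs. unfold norm2. rewrite <- ZS_plus; try apply sq_summable.
  apply ZS_le; [now apply Hsq_summable|apply summable_plus; apply sq_summable|].
  intros k. rewrite AD_co, Cmod_mult, Cmod_R, Rpow_mult_distr, pow2_abs.
  assert (h := Wt_le s k Hs). assert (h1 := pow2_ge_0 (Cmod (f k))). nra.
Qed.

Definition henergy (j : nat) (f : rdseq) : R := ZSeriesR (fun k => highpass j k * Cmod (f k) ^ 2).

Lemma henergy_summable (j : nat) (f : rdseq) : summable (fun k => highpass j k * Cmod (f k) ^ 2).
Proof.
  apply (weighted_summable _ 1). intros k. assert (h := highpass_bounds j k).
  assert (h1 := pow2_ge_0 (IZR k)). lra.
Qed.

Lemma henergy_le_norm2 (j : nat) (f : rdseq) : henergy j f <= norm2 f.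
Proof.
  apply ZS_le; [apply henergy_summable|apply sq_summable|]. intros k.
  assert (h := highpass_bounds j k). assert (h1 := pow2_ge_0 (Cmod (f k))). nra.
Qed.

Lemma henergy_pos (j : nat) (f : rdseq) : 0 <= henergy j f.
Proof.
  apply ZS_pos; [apply henergy_summable|]. intros k. apply Rmult_le_pos; [apply highpass_bounds|apply pow2_ge_0].
Qed.

Lemma pow4_2 (j : nat) : (2 ^ j) ^ 2 = 4 ^ j.
Proof. replace 4 with (2 ^ 2) by ring. rewrite <- !pow_mult. f_equal. lia. Qed.

Lemma henergy_Rk (j : nat) (H : 1 <= Rabs (2 ^ j)) (f : rdseq) : norm2 (AD (Rk (2 ^ j) H f)) = henergy j f.
Proof.
  apply ZS_ext. intros k. rewrite AD_co, Cmod_mult, Cmod_R, Rpow_mult_distr, pow2_abs.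
  cbn [Rk Adiag co]. rewrite Cmod_mult, Cmod_inv, Rpow_mult_distr, pow_inv, Cmod_ksq, pow4_2.
  - unfold highpass. field. assert (h := pow2_ge_0 (IZR k)). assert (h1 := pow4_pos j). lra.
  - apply Cmod_gt_0. destruct (Rk_bound (2 ^ j) k H). lra.
Qed.

Lemma sum_henergy (rho : R) (f : rdseq) (n : nat) :
  summable (fun k => sum_n (fun j => rho ^ j * highpass j k) n * Cmod (f k) ^ 2) /\
  ZSeriesR (fun k => sum_n (fun j => rho ^ j * highpass j k) n * Cmod (f k) ^ 2) =
  sum_n (fun j => rho ^ j * henergy j f) n.
Proof.
  induction n as [|n [IH1 IH2]].
  - assert (E : forall k, rho ^ 0 * (highpass 0 k * Cmod (f k) ^ 2) =
       sum_n (fun j => rho ^ j * highpass j k) 0 * Cmod (f k) ^ 2).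
    { intros k. rewrite sum_O. ring. }
    split.
    + apply summable_ext with (1 := E). apply summable_scal, henergy_summable.
    + rewrite <- (ZS_ext _ _ E), sum_O, ZS_scal. reflexivity.
  - assert (E : forall k, sum_n (fun j => rho ^ j * highpass j k) n * Cmod (f k) ^ 2 +
         rho ^ S n * (highpass (S n) k * Cmod (f k) ^ 2) =
       sum_n (fun j => rho ^ j * highpass j k) (S n) * Cmod (f k) ^ 2).
    { intros k. rewrite sum_SnR. ring. }
    assert (HS := summable_scal (rho ^ S n) _ (henergy_summable (S n) f)).
    split.
    + apply summable_ext with (1 := E). now apply summable_plus.
    + rewrite <- (ZS_ext _ _ E), sum_SnR, ZS_plus, IH2, ZS_scal; auto.
Qed.

(** The [n]-th partial sum over k involves only |k| < 2^(n+2), where the dyadic sum up to [S n]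
    already dominates the weight. No interchange of infinite sums over [j] and [k] is needed. *)
Lemma Hsq_from_henergy (s M : R) (f : rdseq) : 1 / 2 <= s < 1 ->
  (forall n, norm2 f + 16 * sum_n (fun j => Rpower 4 s ^ j * henergy j f) n <= M) -> Hsq s f <= M.
Proof.
  intros Hs HM.
  apply (ZS_bound (fun k => Wt s k * Cmod (f k) ^ 2)).
  - intros k. apply Rmult_le_pos; [left; apply Wt_pos|apply pow2_ge_0].
  - intros n. apply Rle_trans with (2 := HM (S n)).
    destruct (sum_henergy (Rpower 4 s) f (S n)) as [h1 h2]. rewrite <- h2, <- ZS_scal.
    unfold norm2. rewrite <- ZS_plus; auto using sq_summable, summable_scal.
    set (b := fun k => Cmod (f k) ^ 2 + 16 * (sum_n (fun j => Rpower 4 s ^ j * highpass j k) (S n) * Cmod (f k) ^ 2)).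
    assert (Hb : summable b) by (apply summable_plus; [apply sq_summable|now apply summable_scal]).
    assert (b0 : forall k, 0 <= b k).
    { intros k. assert (h := pow2_ge_0 (Cmod (f k))). assert (hr := rho_bounds s Hs).
      assert (0 <= sum_n (fun j => Rpower 4 s ^ j * highpass j k) (S n)).
      { apply sum_n_pos. intros j. apply Rmult_le_pos; [apply pow_le; lra|apply highpass_bounds]. }
      unfold b. nra. }
    apply Rle_trans with (2 := partial_le_ZS b n Hb b0).
    assert (Hk : forall k, Rabs (IZR k) < 2 ^ S (S n) -> Wt s k * Cmod (f k) ^ 2 <= b k).
    { intros k hk. unfold b. assert (h := Wt_le_dyadic s (S n) k Hs hk).
      assert (h' := pow2_ge_0 (Cmod (f k))). nra. }
    clearbody b. clear h1 h2.
    assert (Hp : forall i, (i <= n)%nat -> zpair (fun k => Wt s k * Cmod (f k) ^ 2) i <= zpair b i).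
    { intros i Hi. assert (P2 : INR i + 1 < 2 ^ S (S n)).
      { rewrite <- S_INR. apply Rlt_le_trans with (2 ^ S i).
        - apply INR_lt_pow2.
        - apply Rle_pow; lra || lia. }
      assert (p := pos_INR i).
      unfold zpair. apply Rplus_le_compat; apply Hk.
      - rewrite <- INR_IZR_INZ, Rabs_pos_eq; lra.
      - rewrite minus_IZR, opp_IZR, <- INR_IZR_INZ, Rabs_left; lra. }
    clear - Hp. revert Hp. generalize (zpair (fun k => Wt s k * Cmod (f k) ^ 2)) (zpair b).
    intros x y. induction n; intros H.
    + rewrite !sum_O. apply H. lia.
    + rewrite !sum_SnR. apply Rplus_le_compat; [|apply H; lia]. apply IHn. intros i hi. apply H. lia.
Qed.

Lemma henergy_le_Hsq (s : R) (f : rdseq) (n : nat) : 1 / 2 <= s < 1 ->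
  sum_n (fun j => Rpower 4 s ^ j * henergy j f) n <= (4 + 16 / (4 - Rpower 4 s)) * Hsq s f.
Proof.
  intros Hs. destruct (sum_henergy (Rpower 4 s) f n) as [h1 h2]. rewrite <- h2.
  unfold Hsq. rewrite <- ZS_scal. apply ZS_le; auto.
  - apply summable_scal, Hsq_summable. lra.
  - intros k. rewrite <- Rmult_assoc. apply Rmult_le_compat_r; [apply pow2_ge_0|].
    now apply dyadic_le_Wt.
Qed.

(** * Smallness of [opX] relative to D at a frequency scale *)

(** Below 2^J the weight is at most 2. Above, y = |k| / 2^J > 1 gives y <= y^(2 s) because 2 s >= 1,
    and y^(2 s) is at most [Wt s k / rho ^ J]. The two contributions are 2 r^2 and r^2. *)
Lemma weight_bound (s r : R) (J : nat) (f : rdseq) : 1 / 2 <= s < 1 ->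
  norm2 f <= r ^ 2 -> Hsq s f <= Rpower 4 s ^ J * r ^ 2 ->
  ZSeriesR (fun k => Cmod (f k) ^ 2 * wN (2 ^ J) k) <= 3 * r ^ 2.
Proof.
  intros Hs Hn HH. assert (Hr := rho_bounds s Hs). set (rho := Rpower 4 s) in *.
  assert (P : 0 < rho ^ J) by (apply pow_lt; lra).
  assert (N1 : 1 <= 2 ^ J) by (apply pow_R1_Rle; lra).
  assert (Hw : forall k, wN (2 ^ J) k <= 2 + / rho ^ J * Wt s k).
  { intros k. unfold wN. set (y := Rabs (IZR k) / 2 ^ J).
    assert (W0 := Wt_pos s k). assert (I0 : 0 < / rho ^ J) by now apply Rinv_0_lt_compat.
    destruct (Rle_dec y 1) as [h|h]; [nra|].
    enough (y <= / rho ^ J * Wt s k) by lra.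
    assert (y1 : 1 < y) by lra.
    apply Rle_trans with (Rpower y (2 * s)).
    { rewrite <- (Rpower_1 y) at 1 by lra. apply Rle_Rpower; lra. }
    assert (E : Rpower y (2 * s) * rho ^ J = Rpower (IZR k ^ 2) s).
    { rewrite <- Rpower_mult. replace 2 with (INR 2) by reflexivity.
      rewrite Rpower_pow by lra. unfold rho. rewrite <- Rpower_pow4.
      rewrite Rpower_mult_distr; [|nra|apply pow4_pos]. f_equal.
      rewrite <- pow4_2, <- Rpow_mult_distr. unfold y, Rdiv.
      rewrite Rmult_assoc, Rinv_l, Rmult_1_r, pow2_abs; lra. }
    apply Rmult_le_reg_r with (rho ^ J); auto. rewrite E.
    replace (/ rho ^ J * Wt s k * rho ^ J) with (Wt s k) by (field; lra).
    unfold Wt. apply Rle_Rpower_l; [lra|].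
    assert (h1 : IZR k <> 0).
    { intros h1. unfold y in y1. rewrite h1, Rabs_R0, Rdiv_0_l in y1. lra. }
    assert (h2 := pow2_gt_0 _ h1). lra. }
  apply Rle_trans with (ZSeriesR (fun k => 2 * Cmod (f k) ^ 2 + / rho ^ J * (Wt s k * Cmod (f k) ^ 2))).
  - assert (Hss : summable (fun k => Wt s k * Cmod (f k) ^ 2)) by (apply Hsq_summable; lra).
    apply ZS_le; [now apply wsq_summable|apply summable_plus; apply summable_scal; auto using sq_summable|].
    intros k. assert (h := Hw k). assert (h1 := pow2_ge_0 (Cmod (f k))). nra.
  - assert (Hss : summable (fun k => Wt s k * Cmod (f k) ^ 2)) by (apply Hsq_summable; lra).
    rewrite ZS_plus, !ZS_scal; try (apply summable_scal; auto using sq_summable).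
    fold (norm2 f) (Hsq s f).
    assert (/ rho ^ J * Hsq s f <= r ^ 2).
    { apply Rmult_le_reg_l with (rho ^ J); auto. rewrite <- Rmult_assoc, Rinv_r by lra. lra. }
    lra.
Qed.

(** 2592 = 16 * 18 * 9: the 16 of the conclusion, the 18 of [opX_bound], and (3 r^2)^2 <= 9 r for r
    <= 1. The ratio of 2^J to 2^(J - d) is at most 2^d even when the subtraction truncates to 0. *)
Lemma opX_small (s beta r : R) (d J : nat) (u : rdseq) : 1 / 2 <= s < 1 -> 0 <= r <= 1 ->
  2592 * beta ^ 2 * 2 ^ d * r <= 1 ->
  norm2 u <= r ^ 2 -> Hsq s u <= Rpower 4 s ^ J * r ^ 2 ->
  forall f, beta ^ 2 * norm2 (opX u f) <=
    / 16 * (norm2 (AD f) + (2 ^ (J - d)) ^ 2 * norm2 f).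
Proof.
  intros Hs r0 Hr Hn HH f.
  assert (HW := weight_bound s r J u Hs Hn HH).
  set (N := 2 ^ J) in *. set (mu := 2 ^ (J - d)).
  assert (N1 : 1 <= N) by (apply pow_R1_Rle; lra).
  assert (mu1 : 1 <= mu) by (apply pow_R1_Rle; lra).
  assert (d1 : 1 <= 2 ^ d) by (apply pow_R1_Rle; lra).
  assert (HNm : N / mu <= 2 ^ d).
  { apply Rmult_le_reg_r with mu; [lra|]. replace (N / mu * mu) with N by (field; lra).
    unfold N, mu. rewrite <- pow_add. apply Rle_pow; lra || lia. }
  assert (B := opX_bound N mu u f N1 mu1).
  set (w := ZSeriesR (fun k => Cmod (u k) ^ 2 * wN N k)) in *.
  assert (w0 : 0 <= w).
  { apply ZS_pos; [now apply wsq_summable|]. intros k. assert (h := wN_ge1 N k N1).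
    apply Rmult_le_pos; [apply pow2_ge_0|lra]. }
  set (Q := norm2 (AD f) + mu ^ 2 * norm2 f) in *.
  assert (Q0 : 0 <= Q).
  { assert (h1 := norm2_pos (AD f)). assert (h2 := norm2_pos f). unfold Q. nra. }
  assert (w2 : w ^ 2 <= 9 * r).
  { apply Rle_trans with ((3 * r ^ 2) ^ 2); [apply pow_incr; lra|].
    replace ((3 * r ^ 2) ^ 2) with (9 * (r * (r * r * r))) by ring.
    assert (r * r * r <= 1).
    { assert (r * r <= 1) by nra. assert (0 <= r * r) by nra. nra. }
    nra. }
  assert (C1 : 18 * N / mu * w ^ 2 <= 162 * 2 ^ d * r).
  { replace (18 * N / mu * w ^ 2) with (18 * ((N / mu) * w ^ 2)) by (field; lra).
    assert (0 <= N / mu) by (apply Rdiv_le_0_compat; lra).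
    assert ((N / mu) * w ^ 2 <= 2 ^ d * (9 * r)) by (apply Rmult_le_compat; auto; apply pow2_ge_0).
    lra. }
  assert (b0 := pow2_ge_0 beta).
  apply Rle_trans with (beta ^ 2 * (162 * 2 ^ d * r * Q)).
  - apply Rmult_le_compat_l; auto. apply Rle_trans with (1 := B). now apply Rmult_le_compat_r.
  - replace (beta ^ 2 * (162 * 2 ^ d * r * Q)) with (162 * beta ^ 2 * 2 ^ d * r * Q) by ring.
    apply Rmult_le_compat_r; auto. lra.
Qed.

(** * The a priori bound for the coefficients *)

Lemma mass_le (beta T : R) (V : R -> rdseq) (u : R -> rdseq) :
  (forall t, Aconj (V t) = V t) -> (forall t, Aderiv u t (opB beta (V t) (u t) (u t))) ->
  forall t, Rabs t < T -> norm2 (u t) <= norm2 (u 0).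
Proof.
  intros HV Hu t Ht.
  replace (norm2 (u 0)) with (exp (0 * T) * norm2 (u 0))
    by (rewrite Rmult_0_l, exp_0; ring).
  apply (gronwall (fun t => norm2 (u t)) 0 T); auto; [lra|apply norm2_pos|].
  intros s Hs. exists 0. split.
  - exact (mass_derive beta (V s) u s (HV s) (Hu s)).
  - rewrite Rabs_R0. lra.
Qed.

(** The resolvents at kappa and at -kappa must both exist on the whole interval: the second is the
    adjoint one, which appears in the derivative. *)
Lemma energy_flow (beta kappa mu E T : R) (V u : R -> rdseq) : 0 <= E -> 1 <= mu <= kappa ->
  (forall t, Aconj (V t) = V t) -> (forall t, Aderiv u t (opB beta (V t) (u t) (u t))) ->
  (forall t, Rabs t < T -> l1 (Acst Ci * AD (V t)) <= E) ->
  (forall t, Rabs t < T -> forall f,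
     beta ^ 2 * norm2 (opX (u t) f) <= / 16 * (norm2 (AD f) + mu ^ 2 * norm2 f)) ->
  exists b : R -> rdseq, forall t, Rabs t < T ->
    (opL beta (u t) (b t) + ik kappa * b t)%A = u t /\
    norm2 (opL beta (u t) (b t)) <=
      exp (E * T) * (norm2 (opL beta (u 0) (b 0)) + norm2 (u 0) / kappa ^ 2).
Proof.
  intros E0 Hk HV Hu HE HX.
  assert (Hex : forall kap, Rabs kap = kappa -> exists b : R -> rdseq, forall t, Rabs t < T ->
    (opL beta (u t) (b t) + ik kap * b t)%A = u t).
  { intros kap Hkap.
    (* A solution is selected independently at each time, with an arbitrary value outside the
       interval. *)
    apply (functional_choice (fun t b => Rabs t < T -> (opL beta (u t) b + ik kap * b)%A = u t)).
    intros t. destruct (Rlt_dec (Rabs t) T) as [h|h].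
    - destruct (resolvent_exists beta kap mu (u t) (u t)) as [b Hb]; auto; try lra. now exists b.
    - exists (Acst 0). contradiction. }
  destruct (Hex kappa) as [b Hb]; [rewrite Rabs_pos_eq; lra|].
  destruct (Hex (- kappa)) as [bs Hbs]; [rewrite Rabs_Ropp, Rabs_pos_eq; lra|].
  exists b. intros t Ht. split; [auto|].
  assert (HT0 : Rabs 0 < T).
  { rewrite Rabs_R0. apply Rle_lt_trans with (2 := Ht). apply Rabs_pos. }
  assert (Hnorm : forall s, Rabs s < T ->
    norm2 (opL beta (u s) (b s)) = norm2 (u s) - kappa ^ 2 * norm2 (b s)).
  { intros s Hs. rewrite <- (Hb s Hs) at 2. rewrite norm2_L. ring. }
  (* Adding [c] to F = |L b|^2 turns |F'| <= E (F + |u|^2 / kappa^2) into the homogeneous inequality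
     that Gronwall needs. *)
  set (c := norm2 (u 0) / kappa ^ 2).
  assert (c0 : 0 <= c) by (apply Rdiv_le_0_compat; [apply norm2_pos|apply pow_lt; lra]).
  set (f := fun s => norm2 (u s) - kappa ^ 2 * norm2 (b s) + c).
  enough (f t <= exp (E * T) * f 0).
  { unfold f in H. rewrite <- !Hnorm in H by auto. fold c. lra. }
  apply (gronwall f E T); auto.
  { unfold f. rewrite <- Hnorm by auto. assert (h := norm2_pos (opL beta (u 0) (b 0))). lra. }
  intros s Hs.
  exists (- kappa * snd (ip (Acst Ci * AD (V s) * b s) (bs s))). split.
  - set (l := - kappa * snd (ip (Acst Ci * AD (V s) * b s) (bs s))).
    replace l with (l + 0) by ring.
    apply (is_derive_plus (fun s => norm2 (u s) - kappa ^ 2 * norm2 (b s)) (fun _ => c) s l 0).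
    + apply (resolvent_derive beta kappa (T - Rabs s) (V s) u b bs s); auto; try lra.
      * intros s' Hs'. apply Hb. assert (h := Rabs_triang (s' - s) s).
        replace (s' - s + s) with s' in h by ring. lra.
      * intros s' Hs'. apply Hbs. assert (h := Rabs_triang (s' - s) s).
        replace (s' - s + s) with s' in h by ring. lra.
    + apply (is_derive_const c s).
  - assert (HVs : Aconj (Acst Ci * AD (V s)) = (Acst Ci * AD (V s))%A).
    { rewrite Aconj_mul, Aconj_D, HV, Aconj_cst, Cconj_Ci, Acst_opp. ring. }
    apply Rle_trans with (1 := resolvent_derive_bound beta kappa (u s) (b s) (bs s) _
       ltac:(lra) HVs (Hb s Hs) (Hbs s Hs)).
    assert (Hm := mass_le beta T V u HV Hu s Hs).
    assert (L := norm2_pos (opL beta (u s) (b s))). rewrite Hnorm in L by auto.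
    assert (M := norm2_pos (u s)).
    assert (Hc : norm2 (u s) / kappa ^ 2 <= c).
    { unfold c, Rdiv. apply Rmult_le_compat_r; auto. left. apply Rinv_0_lt_compat, pow_lt. lra. }
    assert (Hc0 : 0 <= norm2 (u s) / kappa ^ 2) by (apply Rdiv_le_0_compat; [auto|apply pow_lt; lra]).
    unfold f. apply Rmult_le_compat; [apply l1_pos|lra|auto|lra].
Qed.

(** [J] is the least exponent that works: failure at [J - 1] gives the upper bound, with a factor
    rho < 4, and the summand [r2] covers J = 0. *)
Lemma dyadic_scale (rho r2 X : R) : 2 <= rho < 4 -> 0 < r2 -> 0 <= X ->
  exists J : nat, X <= rho ^ J * r2 /\ rho ^ J * r2 <= r2 + 4 * X.
Proof.
  intros Hr r0 X0.
  assert (Hn : exists n : nat, X <= rho ^ n * r2).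
  { destruct (INR_unbounded (X / r2)) as [n Hn]. exists n.
    assert (h1 : 2 ^ n <= rho ^ n) by (apply pow_incr; lra).
    assert (h2 := INR_lt_pow2 n). apply Rmult_le_reg_r with (/ r2); [now apply Rinv_0_lt_compat|].
    rewrite Rmult_assoc, Rinv_r by lra. unfold Rdiv in Hn. lra. }
  destruct Hn as [n Hn]. revert Hn. induction n; intros Hn.
  - exists 0%nat. split; auto. simpl. lra.
  - destruct (Rle_dec X (rho ^ n * r2)) as [h|h]; auto.
    exists (S n). split; auto. simpl.
    assert (0 < rho ^ n) by (apply pow_lt; lra).
    assert (0 < rho ^ n * r2) by (apply Rmult_lt_0_compat; auto). nra.
Qed.

Lemma Acont_nrm (u : R -> rdseq) (t : R) : Acont u t -> continuity_pt (fun s => nrm (u s)) t.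
Proof.
  intros H eps He. destruct (H 1%nat (eps / 3)) as [d [d0 Hd]]; [lra|].
  exists d. split; [lra|]. intros s [_ Hs]. simpl in Hs. unfold R_dist in *.
  assert (A := nrm_small _ _ (Hd s Hs)).
  simpl. unfold R_dist. apply Rle_lt_trans with (nrm (u s - u t)); [|lra].
  assert (h1 := nrm_add (u t) (u s - u t)). assert (h2 := nrm_sub (u s) (u s - u t)).
  replace (u t + (u s - u t))%A with (u s) in h1 by ring.
  replace (u s - (u s - u t))%A with (u t) in h2 by ring.
  apply Rabs_le. lra.
Qed.

Lemma Acont_D (u : R -> rdseq) (t : R) : Acont u t -> Acont (fun s => AD (u s)) t.
Proof.
  intros H m eps He. destruct (H (S m) eps He) as [d [d0 Hd]]. exists d. split; auto.
  intros s Hs k. assert (h := Hd s Hs k). rewrite Asub_co in *. rewrite !AD_co.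
  replace (IZR k * u s k - IZR k * u t k)%C with (IZR k * (u s k - u t k))%C by ring.
  rewrite Cmod_mult, Cmod_R. apply Rle_trans with (2 := h). simpl.
  assert (h1 := Cmod_ge_0 (u s k - u t k)%C). assert (h2 := wt_pow_ge1 m k).
  assert (h3 : Rabs (IZR k) <= wt k) by (unfold wt; lra).
  replace (Rabs (IZR k) * Cmod (u s k - u t k)%C * wt k ^ m)
    with (Rabs (IZR k) * (Cmod (u s k - u t k)%C * wt k ^ m)) by ring.
  replace (Cmod (u s k - u t k)%C * (wt k * wt k ^ m))
    with (wt k * (Cmod (u s k - u t k)%C * wt k ^ m)) by ring.
  apply Rmult_le_compat_r; auto. apply Rmult_le_pos; lra.
Qed.

(** Continuity of the H^1 norm on a compact interval. The bound is purely qualitative and serves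
    only to make a supremum finite. *)
Lemma Hsq_bounded (s T : R) (u : R -> rdseq) : 0 <= s <= 1 -> 0 <= T ->
  (forall t, Acont u t) -> exists M, forall t, Rabs t < T -> Hsq s (u t) <= M.
Proof.
  intros Hs HT Hu. set (f := fun t => nrm (u t) * nrm (u t) + nrm (AD (u t)) * nrm (AD (u t))).
  destruct (continuity_ab_maj f (- T) T) as [x [Hx _]]; [lra| |].
  - intros c _. assert (h1 := Acont_nrm _ _ (Hu c)).
    assert (h2 := Acont_nrm _ _ (Acont_D _ _ (Hu c))).
    apply (continuity_pt_plus (fun t => nrm (u t) * nrm (u t)) (fun t => nrm (AD (u t)) * nrm (AD (u t)))).
    + now apply (continuity_pt_mult (fun t => nrm (u t)) (fun t => nrm (u t))).
    + now apply (continuity_pt_mult (fun t => nrm (AD (u t))) (fun t => nrm (AD (u t)))).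
  - exists (f x). intros t Ht. apply Rabs_def2 in Ht.
    apply Rle_trans with (2 := Hx t ltac:(lra)). unfold f. rewrite !nrm_sq. now apply Hsq_le_H1.
Qed.

(** The supremum sg is finite and satisfies sg <= (sg + P) / 2 + K, hence sg <= P + 2 K. *)
Lemma sup_absorb (T P K : R) (f : R -> R) : 0 < T -> 0 <= P ->
  (exists M, forall t, Rabs t < T -> f t <= M) -> 0 <= f 0 ->
  (forall sigma, (forall t, Rabs t < T -> f t <= sigma) ->
     forall t, Rabs t < T -> f t <= / 2 * (sigma + P) + K) ->
  forall t, Rabs t < T -> f t <= P + 2 * K.
Proof.
  intros HT HP [M HM] f0 H.
  destruct (completeness (fun x => exists t, Rabs t < T /\ x = f t)) as [sg [Hub Hlub]].
  - exists M. intros x [t [Ht ->]]. auto.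
  - exists (f 0). exists 0. split; auto. rewrite Rabs_R0. auto.
  - assert (Hs : forall t, Rabs t < T -> f t <= sg).
    { intros t Ht. apply Hub. now exists t. }
    assert (Hle : sg <= / 2 * (sg + P) + K).
    { apply Hlub. intros x [t [Ht ->]]. auto. }
    intros t Ht. assert (h := Hs t Ht). lra.
Qed.

(** The potential enters only through its reality and a bound of its derivative by the mass, so the
    estimate is uniform over all potentials sharing the same [E]. *)
Theorem seq_bound (s beta E : R) : 1 / 2 <= s < 1 -> 0 <= E ->
  exists r, 0 < r <= 1 /\ forall A T, 0 < A -> 0 < T -> exists B, 0 < B /\
  forall V u : R -> rdseq,
    (forall t, Aconj (V t) = V t) -> (forall t, Aderiv u t (opB beta (V t) (u t) (u t))) ->
    (forall t, l1 (Acst Ci * AD (V t)) <= E * norm2 (u t)) ->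
    norm2 (u 0) <= r ^ 2 -> Hsq s (u 0) <= A ^ 2 ->
    forall t, Rabs t < T -> Hsq s (u t) <= B.
Proof.
  intros Hs HE. assert (Hrho := rho_bounds s Hs). set (rho := Rpower 4 s) in *.
  (* 1 / (1 - theta) for the ratio theta = rho / 4 of the sums over high frequencies. *)
  set (Ct := 4 / (4 - rho)). assert (Ct0 : 0 < Ct) by (apply Rdiv_lt_0_compat; lra).
  set (C2 := 4 + 16 / (4 - rho)).
  assert (C20 : 0 < C2).
  { unfold C2. assert (0 < 16 / (4 - rho)) by (apply Rdiv_lt_0_compat; lra). lra. }
  (* The 16 is that of [Hsq_from_henergy]; 1 counts the mass below frequency 2^m, and 2 Ct the
     comparison error at the final time summed over j >= m. *)
  set (K1 := 16 * (1 + 2 * Ct)).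
  (* With 2^d >= 8 K1 the coefficient 4 K1 / 2^d of the supremum is at most 1/2. *)
  assert (Hd : exists d : nat, 8 * K1 <= 2 ^ d).
  { assert (h2 : Rabs 2 > 1) by (rewrite Rabs_pos_eq; lra).
    destruct (Pow_x_infinity 2 h2 (8 * K1)) as [d Hd].
    exists d. assert (h := Hd d (le_n d)). rewrite Rabs_pos_eq in h by (apply pow_le; lra). lra. }
  destruct Hd as [d Hd].
  assert (d1 : 1 <= 2 ^ d) by (apply pow_R1_Rle; lra).
  assert (b0 := pow2_ge_0 beta).
  (* The hypothesis of [opX_small] reads q r <= 1; taking r = 1 / (1 + q) ensures it together with r
     <= 1. *)
  set (q := 2592 * beta ^ 2 * 2 ^ d). assert (q0 : 0 <= q) by (unfold q; apply Rmult_le_pos; [apply Rmult_le_pos|]; lra).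
  set (r := / (1 + q)).
  assert (r0 : 0 < r) by (apply Rinv_0_lt_compat; lra).
  assert (r1 : r <= 1) by (unfold r; rewrite <- Rinv_1; apply Rinv_le_contravar; lra).
  assert (Hr : q * r <= 1).
  { apply Rmult_le_reg_r with (1 + q); [lra|]. unfold r. rewrite Rmult_assoc, Rinv_l; lra. }
  assert (rr : 0 < r ^ 2) by (apply pow_lt; auto).
  exists r. split; [lra|]. intros A T HA HT.
  destruct (dyadic_scale rho (r ^ 2) (A ^ 2) Hrho rr (pow2_ge_0 A)) as [J0 [HJ0 _]].
  set (ex := exp (E * T)). assert (ex0 : 0 < ex) by apply exp_pos.
  set (K2 := 64 * ex * C2 * A ^ 2 + 8 * ex * (2 * 4 ^ J0 + 1) * r ^ 2 * Ct).
  assert (K20 : 0 <= K2).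
  { assert (h := pow4_pos J0). assert (h1 := pow2_ge_0 A).
    unfold K2. apply Rplus_le_le_0_compat; repeat (lra || apply Rmult_le_pos). }
  set (K := r ^ 2 + K1 * (2 * r ^ 2) + 16 * K2).
  assert (K10 : 0 < K1) by (unfold K1; lra).
  assert (K0 : 0 < K) by (unfold K; nra).
  exists (A ^ 2 + 2 * K). split; [assert (h := pow2_ge_0 A); lra|].
  intros V u HV Hu Hl Hm HA0.
  assert (HT0 : Rabs 0 < T) by (rewrite Rabs_R0; auto).
  assert (Hmt : forall t, Rabs t < T -> norm2 (u t) <= r ^ 2).
  { intros t Ht. apply Rle_trans with (2 := Hm). exact (mass_le beta T V u HV Hu t Ht). }
  apply sup_absorb; auto; [apply pow2_ge_0| | |].
  { apply Hsq_bounded; [lra|lra|]. intros t. exact (Aderiv_cont _ _ _ (Hu t)). }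
  { apply Hsq_pos. lra. }
  intros sigma Hsig t Ht.
  assert (sig0 : 0 <= sigma).
  { apply Rle_trans with (2 := Hsig 0 HT0). apply Hsq_pos. lra. }
  assert (PA := pow2_ge_0 A).
  destruct (dyadic_scale rho (r ^ 2) (sigma + A ^ 2) Hrho rr ltac:(lra)) as [J [HJ HJ']].
  (* Natural subtraction: when J < d every dyadic frequency is treated by the resolvent. *)
  set (m := (J - d)%nat). set (J1 := Nat.min J J0). set (m1 := (J1 - d)%nat).
  assert (m1m : (m1 <= m)%nat) by (unfold m1, m, J1; lia).
  assert (HX : forall t, Rabs t < T -> forall f,
     beta ^ 2 * norm2 (opX (u t) f) <= / 16 * (norm2 (AD f) + (2 ^ m) ^ 2 * norm2 f)).
  { intros t' Ht'. apply opX_small with (s := s) (r := r); auto; [lra|].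
    apply Rle_trans with (2 := HJ). assert (h := Hsig t' Ht'). lra. }
  (* The lowered threshold at time 0 keeps the error that is multiplied by [ex] at size 4^J0, free
     of [sigma]. The minimum in [J1] ensures m1 <= m, so that the same kappa serve at both times. *)
  assert (HX1 : forall f,
     beta ^ 2 * norm2 (opX (u 0) f) <= / 16 * (norm2 (AD f) + (2 ^ m1) ^ 2 * norm2 f)).
  { apply opX_small with (s := s) (r := r); auto; [lra|].
    unfold J1. destruct (Nat.min_spec J J0) as [[_ ->]|[_ ->]].
    - apply Rle_trans with (2 := HJ). lra.
    - apply Rle_trans with (2 := HJ0). lra. }
  set (theta := rho / 4). assert (Hth : 0 < theta < 1) by (unfold theta; lra).
  set (Q := 8 * ex * (2 * 4 ^ J0 + 1) * r ^ 2 + 2 * 4 ^ m * r ^ 2).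
  assert (Q0 : 0 <= Q).
  { assert (h := pow4_pos J0). assert (h1 := pow4_pos m).
    unfold Q. apply Rplus_le_le_0_compat; repeat (lra || apply Rmult_le_pos). }
  (* Below 2^m the mass suffices. From 2^m on, comparison at time t, the flow, and comparison at
     time 0 are chained; their two factors 8 give 64. *)
  assert (Hj : forall j, rho ^ j * henergy j (u t) <=
     (r ^ 2 * (if Nat.ltb j m then rho ^ j else 0) + Q * (if Nat.ltb j m then 0 else theta ^ j))
      + 64 * ex * (rho ^ j * henergy j (u 0))).
  { intros j. assert (hr : 0 < rho ^ j) by (apply pow_lt; lra).
    assert (hD0 := henergy_pos j (u 0)). destruct (Nat.ltb_spec j m) as [h|h].
    - assert (h1 := henergy_le_norm2 j (u t)). assert (h2 := Hmt t Ht).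
      assert (0 <= 64 * ex * (rho ^ j * henergy j (u 0))) by (repeat (lra || apply Rmult_le_pos)). nra.
    - assert (P1 : 1 <= 2 ^ m) by (apply pow_R1_Rle; lra).
      assert (P2 : 1 <= 2 ^ m1) by (apply pow_R1_Rle; lra).
      assert (P3 : 2 ^ m <= 2 ^ j) by (apply Rle_pow; lra || lia).
      assert (P4 : 2 ^ m1 <= 2 ^ m) by (apply Rle_pow; lra || lia).
      assert (P5 : 1 <= Rabs (2 ^ j)) by (rewrite Rabs_pos_eq; lra).
      destruct (energy_flow beta (2 ^ j) (2 ^ m) E T V u HE (conj P1 P3) HV Hu) as [b Hb]; auto.
      { intros t' Ht'. apply Rle_trans with (1 := Hl t'). assert (h2 := Hmt t' Ht').
        assert (r ^ 2 <= 1) by nra. nra. }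
      destruct (Hb t Ht) as [Eb Ib]. destruct (Hb 0 HT0) as [E00 _].
      destruct (energy_comparison beta (2 ^ j) (2 ^ m) r P5 (u t) (b t) (conj P1 P3) ltac:(lra)
        (HX t Ht) Eb (Hmt t Ht)) as [I1 _].
      destruct (energy_comparison beta (2 ^ j) (2 ^ m1) r P5 (u 0) (b 0) ltac:(lra) ltac:(lra)
        HX1 E00 Hm) as [_ I2].
      rewrite henergy_Rk, !pow4_2 in I1. rewrite henergy_Rk, !pow4_2 in I2. rewrite pow4_2 in Ib.
      fold ex in Ib.
      assert (h4 := pow4_pos j). assert (i4 : 0 < / 4 ^ j) by now apply Rinv_0_lt_compat.
      assert (Hm1 : 4 ^ m1 <= 4 ^ J0) by (apply Rle_pow; [lra|unfold m1, J1; lia]).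
      assert (S1 : 2 * 4 ^ m1 * r ^ 2 / 4 ^ j <= 2 * 4 ^ J0 * r ^ 2 * / 4 ^ j).
      { unfold Rdiv. apply Rmult_le_compat_r; [lra|]. apply Rmult_le_compat_r; lra. }
      assert (S2 : norm2 (u 0) / 4 ^ j <= r ^ 2 * / 4 ^ j).
      { unfold Rdiv. apply Rmult_le_compat_r; lra. }
      assert (S3 : norm2 (opL beta (u t) (b t)) <=
        ex * (8 * henergy j (u 0) + (2 * 4 ^ J0 + 1) * r ^ 2 * / 4 ^ j)).
      { apply Rle_trans with (1 := Ib). apply Rmult_le_compat_l; lra. }
      assert (S4 : henergy j (u t) <= 64 * ex * henergy j (u 0) + Q * / 4 ^ j).
      { unfold Q. unfold Rdiv in I1. lra. }
      (* Under the weight rho^j an error of order 4^(-j) becomes theta^j, which is summable. *)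
      replace (rho ^ j) with (theta ^ j * 4 ^ j) at 1.
      2: { rewrite <- Rpow_mult_distr. f_equal. unfold theta. field. }
      assert (ht : 0 < theta ^ j) by (apply pow_lt; lra).
      apply Rle_trans with (theta ^ j * 4 ^ j * (64 * ex * henergy j (u 0) + Q * / 4 ^ j)).
      + apply Rmult_le_compat_l; auto. apply Rmult_le_pos; lra.
      + right. replace (rho ^ j) with (theta ^ j * 4 ^ j).
        * field. lra.
        * rewrite <- Rpow_mult_distr. f_equal. unfold theta. field. }
  assert (Hsum : forall n, sum_n (fun j => rho ^ j * henergy j (u t)) n <=
     (1 + 2 * Ct) * (rho ^ m * r ^ 2) + K2).
  { intros n. apply Rle_trans with (1 := sum_n_le _ _ n Hj).
    rewrite !sum_n_add, !sum_n_scal.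
    assert (A1 := sum_below rho m n ltac:(lra)). assert (A2 := sum_above theta m n Hth).
    assert (A3 := henergy_le_Hsq s (u 0) n Hs). fold rho C2 in A3.
    assert (B1 := Rmult_le_compat_l _ _ _ (Rlt_le _ _ rr) A1).
    assert (B2 := Rmult_le_compat_l _ _ _ Q0 A2).
    assert (B3 : 64 * ex * sum_n (fun j => rho ^ j * henergy j (u 0)) n <= 64 * ex * (C2 * A ^ 2)).
    { apply Rmult_le_compat_l; [lra|]. apply Rle_trans with (1 := A3).
      apply Rmult_le_compat_l; lra. }
    assert (ECt : theta ^ m / (1 - theta) = theta ^ m * Ct).
    { unfold Ct, theta. field. lra. }
    assert (B4 : Q * (theta ^ m / (1 - theta)) <=
       8 * ex * (2 * 4 ^ J0 + 1) * r ^ 2 * Ct + 2 * Ct * (rho ^ m * r ^ 2)).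
    { rewrite ECt. unfold Q.
      assert (Em : rho ^ m = theta ^ m * 4 ^ m).
      { rewrite <- Rpow_mult_distr. f_equal. unfold theta. field. }
      assert (tm : theta ^ m <= 1) by (rewrite <- (pow1 m); apply pow_incr; lra).
      rewrite Em. set (X := 8 * ex * (2 * 4 ^ J0 + 1) * r ^ 2 * Ct).
      assert (X0 : 0 <= X).
      { assert (h := pow4_pos J0). unfold X. repeat (lra || apply Rmult_le_pos). }
      apply Rle_trans with (X * theta ^ m + 2 * Ct * (theta ^ m * 4 ^ m * r ^ 2)).
      - right. unfold X. ring.
      - apply Rplus_le_compat_r. nra. }
    apply Rle_trans with (r ^ 2 * rho ^ m +
      (8 * ex * (2 * 4 ^ J0 + 1) * r ^ 2 * Ct + 2 * Ct * (rho ^ m * r ^ 2)) + 64 * ex * (C2 * A ^ 2)).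
    - apply Rplus_le_compat; auto. apply Rplus_le_compat; auto. exact (Rle_trans _ _ _ B2 B4).
    - unfold K2. right. ring. }
  (* The gain from placing the threshold d octaves below N: rho^m is rho^J divided by rho^d >= 2^d.
     If J < d, then m = 0 and r^2 alone remains. *)
  assert (Hm2 : rho ^ m * r ^ 2 <= 2 * r ^ 2 + 4 * / 2 ^ d * (sigma + A ^ 2)).
  { assert (id : 0 < / 2 ^ d) by (apply Rinv_0_lt_compat; lra).
    assert (id1 : / 2 ^ d <= 1) by (rewrite <- Rinv_1; apply Rinv_le_contravar; lra).
    destruct (le_lt_dec d J) as [h|h].
    - assert (Ep : rho ^ J = rho ^ m * rho ^ d) by (rewrite <- pow_add; f_equal; unfold m; lia).
      assert (hd : 2 ^ d <= rho ^ d) by (apply pow_incr; lra).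
      assert (hm : 0 < rho ^ m * r ^ 2) by (apply Rmult_lt_0_compat; auto; apply pow_lt; lra).
      apply Rmult_le_reg_r with (2 ^ d); [lra|].
      replace ((2 * r ^ 2 + 4 * / 2 ^ d * (sigma + A ^ 2)) * 2 ^ d)
        with (2 * r ^ 2 * 2 ^ d + 4 * (sigma + A ^ 2)) by (field; lra).
      rewrite Ep in HJ'. nra.
    - replace m with 0%nat by (unfold m; lia). simpl (rho ^ 0).
      assert (0 <= 4 * / 2 ^ d * (sigma + A ^ 2)) by (repeat (lra || apply Rmult_le_pos)). lra. }
  apply Hsq_from_henergy; auto. intros n. fold rho. assert (h1 := Hsum n). assert (h2 := Hmt t Ht).
  assert (h3 : K1 * (rho ^ m * r ^ 2) <= K1 * (2 * r ^ 2) + / 2 * (sigma + A ^ 2)).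
  { apply Rle_trans with (K1 * (2 * r ^ 2 + 4 * / 2 ^ d * (sigma + A ^ 2))).
    - apply Rmult_le_compat_l; lra.
    - assert (hk : K1 * (4 * / 2 ^ d) <= / 2).
      { apply Rmult_le_reg_r with (2 ^ d); [lra|].
        replace (K1 * (4 * / 2 ^ d) * 2 ^ d) with (4 * K1) by (field; lra). lra. }
      assert (h4 : 0 <= sigma + A ^ 2) by lra.
      assert (h5 := Rmult_le_compat_r _ _ _ h4 hk). lra. }
  apply Rle_trans with (r ^ 2 + 16 * ((1 + 2 * Ct) * (rho ^ m * r ^ 2) + K2)).
  - apply Rplus_le_compat; auto. apply Rmult_le_compat_l; auto. lra.
  - unfold K. unfold K1 in h3 |- *. lra.
Qed.

(** * Fourier series of smooth periodic functions *)

Definition contC (f : R -> C) : Prop :=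
  (forall x, continuous (fun y => fst (f y)) x) /\ (forall x, continuous (fun y => snd (f y)) x).

Lemma continuous_Rplus (f g : R -> R) (x : R) :
  continuous f x -> continuous g x -> continuous (fun y => f y + g y) x.
Proof. intros Hf Hg. exact (continuous_plus f g x Hf Hg). Qed.

Lemma continuous_Rminus (f g : R -> R) (x : R) :
  continuous f x -> continuous g x -> continuous (fun y => f y - g y) x.
Proof. intros Hf Hg. exact (continuous_minus f g x Hf Hg). Qed.

Lemma continuous_Rmult (f g : R -> R) (x : R) :
  continuous f x -> continuous g x -> continuous (fun y => f y * g y) x.
Proof. intros Hf Hg. exact (continuous_mult f g x Hf Hg). Qed.

Lemma contC_ext (f g : R -> C) : (forall x, f x = g x) -> contC f -> contC g.
Proof.
  intros H [f1 f2]. split; intros x;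
    [apply continuous_ext with (2 := f1 x)|apply continuous_ext with (2 := f2 x)];
    intros y; now rewrite H.
Qed.

Lemma contC_plus (f g : R -> C) : contC f -> contC g -> contC (fun x => f x + g x)%C.
Proof.
  intros [f1 f2] [g1 g2]. split; intros x; [exact (continuous_Rplus _ _ x (f1 x) (g1 x))|
  exact (continuous_Rplus _ _ x (f2 x) (g2 x))].
Qed.

Lemma contC_mult (f g : R -> C) : contC f -> contC g -> contC (fun x => f x * g x)%C.
Proof.
  intros [f1 f2] [g1 g2]. split; intros x; unfold Cmult; cbn [fst snd].
  - apply continuous_Rminus; apply continuous_Rmult; auto.
  - apply continuous_Rplus; apply continuous_Rmult; auto.
Qed.

Lemma contC_const (c : C) : contC (fun _ => c).
Proof. split; intros x; apply continuous_const. Qed.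

Lemma contC_conj (f : R -> C) : contC f -> contC (fun x => Cconj (f x)).
Proof.
  intros [f1 f2]. split; intros x; unfold Cconj; cbn [fst snd]; auto.
  exact (continuous_opp (fun y => snd (f y)) x (f2 x)).
Qed.

Lemma contC_exp (k : Z) : contC (fun x => cexpi (IZR k * x)).
Proof.
  split; intros x; unfold cexpi; cbn [fst snd].
  - apply (ex_derive_continuous (fun y => cos (IZR k * y)) x). auto_derive. auto.
  - apply (ex_derive_continuous (fun y => sin (IZR k * y)) x). auto_derive. auto.
Qed.

Lemma cexpi_plus (x y : R) : cexpi (x + y) = (cexpi x * cexpi y)%C.
Proof. unfold cexpi, Cmult; cbn [fst snd]. rewrite cos_plus, sin_plus. f_equal. ring. Qed.

Lemma cexpi_0 : cexpi 0 = 1%C.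
Proof. unfold cexpi. now rewrite cos_0, sin_0. Qed.

Lemma cexpi_opp (x : R) : cexpi (- x) = Cconj (cexpi x).
Proof. unfold cexpi, Cconj; cbn [fst snd]. now rewrite cos_neg, sin_neg. Qed.

Lemma Cmod_cexpi (x : R) : Cmod (cexpi x) = 1.
Proof.
  unfold cexpi, Cmod; cbn [fst snd].
  replace (cos x ^ 2 + sin x ^ 2) with 1; [apply sqrt_1|].
  assert (h := sin2_cos2 x). unfold Rsqr in h. lra.
Qed.

Lemma cexpi_2PI (k : Z) : cexpi (IZR k * (2 * PI)) = 1%C.
Proof.
  assert (H : forall n : nat, cexpi (INR n * (2 * PI)) = 1%C).
  { intros n. unfold cexpi.
    replace (INR n * (2 * PI)) with (0 + 2 * INR n * PI) by ring.
    now rewrite cos_period, sin_period, cos_0, sin_0. }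
  destruct (Z_le_gt_dec 0 k) as [h|h].
  - rewrite <- (Z2Nat.id k) by lia. rewrite <- INR_IZR_INZ. apply H.
  - replace (IZR k * (2 * PI)) with (- (INR (Z.to_nat (- k)) * (2 * PI))).
    + rewrite cexpi_opp, H. apply Cconj_RtoC.
    + rewrite INR_IZR_INZ, Z2Nat.id by lia. rewrite opp_IZR. ring.
Qed.

Lemma ex_RInt_cont (f : R -> R) (a b : R) : (forall x, continuous f x) -> ex_RInt f a b.
Proof. intros H. apply (ex_RInt_continuous f a b). intros; apply H. Qed.

Definition CInt (f : R -> C) : C :=
  (RInt (fun x => fst (f x)) 0 (2 * PI), RInt (fun x => snd (f x)) 0 (2 * PI)).

Lemma CInt_ext (f g : R -> C) : (forall x, f x = g x) -> CInt f = CInt g.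
Proof. intros H. unfold CInt. f_equal; apply RInt_ext; intros x _; now rewrite H. Qed.

Lemma CInt_plus (f g : R -> C) : contC f -> contC g ->
  CInt (fun x => f x + g x)%C = (CInt f + CInt g)%C.
Proof.
  intros [f1 f2] [g1 g2]. unfold CInt, Cplus; cbn [fst snd]. f_equal.
  - exact (RInt_plus (fun x => fst (f x)) (fun x => fst (g x)) 0 (2 * PI)
      (ex_RInt_cont _ _ _ f1) (ex_RInt_cont _ _ _ g1)).
  - exact (RInt_plus (fun x => snd (f x)) (fun x => snd (g x)) 0 (2 * PI)
      (ex_RInt_cont _ _ _ f2) (ex_RInt_cont _ _ _ g2)).
Qed.

Lemma RInt_scalR (f : R -> R) (c a b : R) : (forall x, continuous f x) ->
  RInt (fun x => c * f x) a b = c * RInt f a b.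
Proof. intros H. exact (RInt_scal f a b c (ex_RInt_cont f a b H)). Qed.

Lemma RInt_plusR (f g : R -> R) (a b : R) : (forall x, continuous f x) -> (forall x, continuous g x) ->
  RInt (fun x => f x + g x) a b = RInt f a b + RInt g a b.
Proof. intros H K. exact (RInt_plus f g a b (ex_RInt_cont f a b H) (ex_RInt_cont g a b K)). Qed.

Lemma CInt_scal (c : C) (f : R -> C) : contC f ->
  CInt (fun x => c * f x)%C = (c * CInt f)%C.
Proof.
  intros [f1 f2]. unfold CInt, Cmult; cbn [fst snd].
  assert (S : forall (d : R) (g : R -> R), (forall x, continuous g x) ->
     forall x, continuous (fun y => d * g y) x).
  { intros d g Hg x. apply continuous_Rmult; auto. apply continuous_const. }
  f_equal.
  - rewrite <- !RInt_scalR by auto.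
    exact (RInt_minus (fun x => fst c * fst (f x)) (fun x => snd c * snd (f x)) 0 (2 * PI)
      (ex_RInt_cont _ _ _ (S _ _ f1)) (ex_RInt_cont _ _ _ (S _ _ f2))).
  - rewrite <- !RInt_scalR by auto. apply RInt_plusR; auto.
Qed.

Lemma RInt_bound (f : R -> R) (M : R) : (forall x, continuous f x) ->
  (forall x, Rabs (f x) <= M) -> Rabs (RInt f 0 (2 * PI)) <= 2 * PI * M.
Proof.
  intros Hc Hf. assert (P := PI_RGT_0).
  replace (2 * PI * M) with ((2 * PI - 0) * M) by ring.
  apply abs_RInt_le_const; [lra|now apply ex_RInt_cont|]. intros; apply Hf.
Qed.

Lemma CInt_bound (f : R -> C) (M : R) : contC f -> (forall x, Cmod (f x) <= M) ->
  Cmod (CInt f) <= 4 * PI * M.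
Proof.
  intros [f1 f2] Hf. apply Rle_trans with (1 := Cmod_le_parts _). unfold CInt; cbn [fst snd].
  assert (h1 := RInt_bound _ M f1 (fun x => Rle_trans _ _ _ (fst_le_Cmod (f x)) (Hf x))).
  assert (h2 := RInt_bound _ M f2 (fun x => Rle_trans _ _ _ (snd_le_Cmod (f x)) (Hf x))).
  replace (4 * PI * M) with (2 * PI * M + 2 * PI * M) by ring. now apply Rplus_le_compat.
Qed.

Lemma fcoef_CInt (f : R -> C) (k : Z) :
  fcoef f k = (RtoC (/ (2 * PI)) * CInt (fun x => f x * cexpi (- (IZR k * x))))%C.
Proof.
  unfold fcoef, CInt, Cmult, RtoC, cexpi; cbn [fst snd].
  rewrite !Rmult_0_l, Rminus_0_r, Rplus_0_r. f_equal; f_equal; apply RInt_ext; intros x _;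
    rewrite cos_neg, sin_neg; real_eq; ring.
Qed.

Lemma contC_exp_neg (k : Z) : contC (fun x => cexpi (- (IZR k * x))).
Proof.
  apply contC_ext with (2 := contC_exp (- k)). intros x. f_equal. rewrite opp_IZR. ring.
Qed.

Lemma contC_fe (f : R -> C) (k : Z) : contC f -> contC (fun x => f x * cexpi (- (IZR k * x)))%C.
Proof. intros Hf. apply contC_mult; auto. apply contC_exp_neg. Qed.

Lemma fcoef_ext (f g : R -> C) (k : Z) : (forall x, f x = g x) -> fcoef f k = fcoef g k.
Proof. intros H. rewrite !fcoef_CInt. f_equal. apply CInt_ext. intros x. now rewrite H. Qed.

Lemma fcoef_plus (f g : R -> C) (k : Z) : contC f -> contC g ->
  fcoef (fun x => f x + g x)%C k = (fcoef f k + fcoef g k)%C.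
Proof.
  intros Hf Hg. rewrite !fcoef_CInt, <- Cmult_plus_distr_l, <- CInt_plus; auto using contC_fe.
  f_equal. apply CInt_ext. intros x. ring.
Qed.

Lemma fcoef_scal (c : C) (f : R -> C) (k : Z) : contC f ->
  fcoef (fun x => c * f x)%C k = (c * fcoef f k)%C.
Proof.
  intros Hf. rewrite !fcoef_CInt.
  replace (c * (RtoC (/ (2 * PI)) * CInt (fun x => f x * cexpi (- (IZR k * x)))))%C
    with (RtoC (/ (2 * PI)) * (c * CInt (fun x => f x * cexpi (- (IZR k * x)))))%C by ring.
  rewrite <- (CInt_scal c) by now apply contC_fe.
  f_equal. apply CInt_ext. intros x. ring.
Qed.

Lemma fcoef_bound (f : R -> C) (M : R) (k : Z) : contC f -> (forall x, Cmod (f x) <= M) ->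
  Cmod (fcoef f k) <= 2 * M.
Proof.
  intros Hf HM. rewrite fcoef_CInt, Cmod_mult, Cmod_R. assert (P := PI_RGT_0).
  rewrite Rabs_pos_eq by (left; apply Rinv_0_lt_compat; lra).
  apply Rmult_le_reg_l with (2 * PI); [lra|].
  rewrite <- Rmult_assoc, Rinv_r, Rmult_1_l by lra.
  replace (2 * PI * (2 * M)) with (4 * PI * M) by ring.
  apply CInt_bound.
  { apply (contC_fe f k Hf). } intros x. rewrite Cmod_mult, Cmod_cexpi, Rmult_1_r. auto.
Qed.

Definition C1fun (f : R -> C) : Prop := (forall x, ex_CDerive f x) /\ contC (CDerive f).

Lemma C1_cont (f : R -> C) : C1fun f -> contC f.
Proof.
  intros [H _]. split; intros x; destruct (H x) as [h1 h2].
  - exact (ex_derive_continuous (fun y => fst (f y)) x h1).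
  - exact (ex_derive_continuous (fun y => snd (f y)) x h2).
Qed.

Lemma CInt_derive (f : R -> C) : C1fun f -> periodic f -> CInt (CDerive f) = 0%C.
Proof.
  intros [Hd [c1 c2]] Hp. unfold CInt, CDerive; cbn [fst snd].
  assert (E : f (2 * PI) = f 0) by (rewrite <- (Hp 0); f_equal; ring).
  rewrite !(RInt_Derive (fun y => fst (f y))), !(RInt_Derive (fun y => snd (f y))), E.
  - unfold RtoC. f_equal; ring.
  - intros x _. apply (Hd x).
  - intros x _. apply c2.
  - intros x _. apply (Hd x).
  - intros x _. apply c1.
Qed.

Lemma is_derive_rot1 (f g : R -> R) (k x : R) : ex_derive f x -> ex_derive g x ->
  is_derive (fun y => f y * cos (- (k * y)) - g y * sin (- (k * y))) x
   (Derive f x * cos (- (k * x)) - Derive g x * sin (- (k * x))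
    + k * (f x * sin (- (k * x)) + g x * cos (- (k * x)))).
Proof.
  intros Hf Hg. auto_derive; [repeat split; auto|].
  change (Derive (fun x => f x) x) with (Derive f x). change (Derive (fun x => g x) x) with (Derive g x). ring.
Qed.

Lemma is_derive_rot2 (f g : R -> R) (k x : R) : ex_derive f x -> ex_derive g x ->
  is_derive (fun y => f y * sin (- (k * y)) + g y * cos (- (k * y))) x
   (Derive f x * sin (- (k * x)) + Derive g x * cos (- (k * x))
    - k * (f x * cos (- (k * x)) - g x * sin (- (k * x)))).
Proof.
  intros Hf Hg. auto_derive; [repeat split; auto|].
  change (Derive (fun x => f x) x) with (Derive f x). change (Derive (fun x => g x) x) with (Derive g x). ring.
Qed.

Lemma CDerive_fe (f : R -> C) (k : Z) : (forall x, ex_CDerive f x) ->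
  (forall x, ex_CDerive (fun x => f x * cexpi (- (IZR k * x)))%C x) /\
  (forall x, CDerive (fun x => f x * cexpi (- (IZR k * x)))%C x =
   (CDerive f x * cexpi (- (IZR k * x)) +
     (- (Ci * IZR k)) * (f x * cexpi (- (IZR k * x))))%C).
Proof.
  intros Hd.
  assert (D1 : forall x, is_derive (fun x => fst (f x * cexpi (- (IZR k * x)))%C) x
    (fst (CDerive f x * cexpi (- (IZR k * x)) + (- (Ci * IZR k)) * (f x * cexpi (- (IZR k * x))))%C)).
  { intros x. destruct (Hd x) as [h1 h2].
    replace (fst _) with
      (Derive (fun y => fst (f y)) x * cos (- (IZR k * x)) - Derive (fun y => snd (f y)) x * sin (- (IZR k * x))
       + IZR k * (fst (f x) * sin (- (IZR k * x)) + snd (f x) * cos (- (IZR k * x))))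
      by (unfold cexpi, CDerive, Cmult, Cplus, Copp, Ci, RtoC; cbn [fst snd]; ring).
    exact (is_derive_rot1 _ _ (IZR k) x h1 h2). }
  assert (D2 : forall x, is_derive (fun x => snd (f x * cexpi (- (IZR k * x)))%C) x
    (snd (CDerive f x * cexpi (- (IZR k * x)) + (- (Ci * IZR k)) * (f x * cexpi (- (IZR k * x))))%C)).
  { intros x. destruct (Hd x) as [h1 h2].
    replace (snd _) with
      (Derive (fun y => fst (f y)) x * sin (- (IZR k * x)) + Derive (fun y => snd (f y)) x * cos (- (IZR k * x))
       - IZR k * (fst (f x) * cos (- (IZR k * x)) - snd (f x) * sin (- (IZR k * x))))
      by (unfold cexpi, CDerive, Cmult, Cplus, Copp, Ci, RtoC; cbn [fst snd]; ring).
    exact (is_derive_rot2 _ _ (IZR k) x h1 h2). }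
  split; intros x.
  - split; eexists; [apply D1|apply D2].
  - apply injective_projections;
      [exact (is_derive_unique _ _ _ (D1 x))|exact (is_derive_unique _ _ _ (D2 x))].
Qed.

(** The derivative of f(x) exp(-i k x) has integral 0 over a period. *)
Lemma fcoef_derive (f : R -> C) (k : Z) : C1fun f -> periodic f ->
  fcoef (CDerive f) k = (Ci * IZR k * fcoef f k)%C.
Proof.
  intros Hf Hp. destruct (CDerive_fe f k (proj1 Hf)) as [h1 h2].
  assert (cf := C1_cont f Hf).
  set (g := fun x => (f x * cexpi (- (IZR k * x)))%C) in *.
  assert (cg : contC g) by now apply contC_fe.
  assert (cd : contC (fun x => CDerive f x * cexpi (- (IZR k * x)))%C) by apply contC_fe, Hf.
  assert (cg' : contC (fun x => (- (Ci * IZR k)) * g x)%C) by (apply contC_mult; auto using contC_const).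
  assert (Cg : C1fun g).
  { split; auto. apply contC_ext with (2 := contC_plus _ _ cd cg'). intros y. now rewrite h2. }
  assert (Pg : periodic g).
  { intros x. unfold g. rewrite Hp. f_equal.
    replace (- (IZR k * (x + 2 * PI))) with (- (IZR k * x) + IZR (- k) * (2 * PI))
      by (rewrite opp_IZR; ring).
    rewrite cexpi_plus, cexpi_2PI. ring. }
  assert (I := CInt_derive g Cg Pg). rewrite (CInt_ext _ _ h2) in I.
  rewrite CInt_plus, CInt_scal in I; auto.
  rewrite !fcoef_CInt. fold g.
  replace (CInt (fun x => CDerive f x * cexpi (- (IZR k * x)))%C) with (Ci * IZR k * CInt g)%C.
  - ring.
  - set (X := CInt (fun x => CDerive f x * cexpi (- (IZR k * x)))%C) in *. fold g in I.
    replace X with ((X + - (Ci * IZR k) * CInt g) + Ci * IZR k * CInt g)%C by ring. rewrite I. ring.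
Qed.

Lemma C1_exp (j : Z) : C1fun (fun x => cexpi (IZR j * x)) /\
  (forall x, CDerive (fun x => cexpi (IZR j * x)) x = (Ci * IZR j * cexpi (IZR j * x))%C).
Proof.
  assert (D1 : forall x, is_derive (fun y => cos (IZR j * y)) x (- IZR j * sin (IZR j * x))).
  { intros x. auto_derive; auto. ring. }
  assert (D2 : forall x, is_derive (fun y => sin (IZR j * y)) x (IZR j * cos (IZR j * x))).
  { intros x. auto_derive; auto. ring. }
  assert (E : forall x, CDerive (fun x => cexpi (IZR j * x)) x = (Ci * IZR j * cexpi (IZR j * x))%C).
  { intros x. transitivity ((- IZR j * sin (IZR j * x), IZR j * cos (IZR j * x)) : C).
    - apply injective_projections;
        [exact (is_derive_unique _ _ _ (D1 x))|exact (is_derive_unique _ _ _ (D2 x))].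
    - unfold Cmult, Ci, RtoC, cexpi; cbn [fst snd]. f_equal; ring. }
  split; auto. split.
  - intros x. split; eexists; [apply D1|apply D2].
  - apply contC_ext with (2 := contC_mult _ _ (contC_const (Ci * IZR j)%C) (contC_exp j)).
    intros y. now rewrite E.
Qed.

Lemma periodic_exp (j : Z) : periodic (fun x => cexpi (IZR j * x)).
Proof.
  intros x. rewrite Rmult_plus_distr_l, cexpi_plus, cexpi_2PI. ring.
Qed.

(** For [j <> k] the derivative rule gives i j z = i k z for the coefficient z, so it vanishes
    without computing an integral. *)
Lemma fcoef_exp (j k : Z) : fcoef (fun x => cexpi (IZR j * x)) k = if Z.eqb j k then 1%C else 0%C.
Proof.
  destruct (Z.eqb_spec j k) as [->|h].
  - rewrite fcoef_CInt. rewrite (CInt_ext _ (fun _ => 1%C)).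
    + unfold CInt, RtoC, Cmult; cbn [fst snd]. rewrite !RInt_const.
      unfold scal; simpl; unfold mult; simpl. assert (P := PI_RGT_0). f_equal; field; lra.
    + intros x. rewrite <- cexpi_plus. rewrite Rplus_opp_r. apply cexpi_0.
  - destruct (C1_exp j) as [c1 E]. assert (H := fcoef_derive _ k c1 (periodic_exp j)).
    rewrite (fcoef_ext _ _ k E), fcoef_scal in H by apply contC_exp.
    set (z := fcoef (fun x => cexpi (IZR j * x)) k) in *.
    assert (Hz : ((Ci * (IZR j - IZR k)) * z)%C = 0%C).
    { replace (Ci * (IZR j - IZR k) * z)%C with (Ci * IZR j * z - Ci * IZR k * z)%C by ring.
      rewrite H. ring. }
    apply (f_equal Cmod) in Hz. rewrite !Cmod_mult, Cmod_Ci, Cmod_0, Rmult_1_l in Hz.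
    rewrite <- RtoC_minus, <- minus_IZR, Cmod_R in Hz.
    apply Cmod_eq_0. apply Rmult_integral in Hz. destruct Hz as [Hz|Hz]; auto.
    exfalso. apply (Rabs_no_R0 (IZR (j - k))); auto. apply not_0_IZR. lia.
Qed.

(** * Bessel inequality *)

Definition sqint (f : R -> C) : R := RInt (fun x => Cmod (f x) ^ 2) 0 (2 * PI).

Lemma cont_sq (f : R -> C) : contC f -> forall x, continuous (fun y => Cmod (f y) ^ 2) x.
Proof.
  intros [f1 f2] x. apply continuous_ext with (fun y => fst (f y) * fst (f y) + snd (f y) * snd (f y)).
  - intros y. rewrite Cmod2_alt. unfold Re, Im. real_eq. ring.
  - apply continuous_Rplus; apply continuous_Rmult; auto.
Qed.

Lemma sqint_pos (f : R -> C) : contC f -> 0 <= sqint f.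
Proof.
  intros Hf. apply RInt_ge_0.
  - assert (P := PI_RGT_0). lra.
  - apply ex_RInt_cont. now apply cont_sq.
  - intros x _. apply pow2_ge_0.
Qed.

Lemma sqint_step (f : R -> C) (k : Z) : contC f ->
  sqint (fun x => f x - fcoef f k * cexpi (IZR k * x))%C = sqint f - 2 * PI * Cmod (fcoef f k) ^ 2.
Proof.
  intros Hf. set (c := fcoef f k). assert (P := PI_RGT_0).
  assert (Hfe := contC_fe f k Hf).
  assert (Hcfe : contC (fun x => Cconj c * (f x * cexpi (- (IZR k * x))))%C)
    by (apply contC_mult; auto using contC_const).
  assert (E : forall x, Cmod (f x - c * cexpi (IZR k * x))%C ^ 2 =
     Cmod (f x) ^ 2 + ((-2) * fst (Cconj c * (f x * cexpi (- (IZR k * x))))%C + Cmod c ^ 2)).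
  { intros x. rewrite cexpi_opp, !Cmod2_alt.
    assert (h := sin2_cos2 (IZR k * x)). unfold Rsqr in h.
    set (e := cexpi (IZR k * x)).
    assert (h' : fst e * fst e + snd e * snd e = 1) by (unfold e, cexpi; cbn [fst snd]; lra).
    destruct e as [e1 e2], (f x) as [z1 z2], c as [c1 c2]. cbn [fst snd] in h'.
    unfold Re, Im, Cconj, Cminus, Cplus, Copp, Cmult; cbn [fst snd].
    replace (c1 ^ 2 + c2 ^ 2) with ((c1 ^ 2 + c2 ^ 2) * (e1 * e1 + e2 * e2)) by (rewrite h'; ring).
    ring. }
  unfold sqint. rewrite (RInt_ext _ _ _ _ (fun x _ => E x)).
  destruct Hcfe as [hc _].
  rewrite RInt_plusR; [|now apply cont_sq|].
  2: { intros x. apply continuous_Rplus; [|apply continuous_const].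
       apply continuous_Rmult; auto. apply continuous_const. }
  rewrite RInt_plusR, RInt_scalR, RInt_const; auto.
  2: { intros x. apply continuous_Rmult; auto. apply continuous_const. }
  2: { intros x. apply continuous_const. }
  assert (Ec : RInt (fun x => fst (Cconj c * (f x * cexpi (- (IZR k * x))))%C) 0 (2 * PI)
     = 2 * PI * Cmod c ^ 2).
  { change (fst (CInt (fun x => Cconj c * (f x * cexpi (- (IZR k * x))))%C) = 2 * PI * Cmod c ^ 2).
    rewrite CInt_scal by auto.
    assert (Ec : CInt (fun x => f x * cexpi (- (IZR k * x)))%C = (RtoC (2 * PI) * c)%C).
    { unfold c. rewrite fcoef_CInt, Cmult_assoc, <- RtoC_mult, Rinv_r by lra. ring. }
    rewrite Ec, Cmod2_alt. destruct c as [c1 c2].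
    unfold Re, Im, Cconj, Cmult, RtoC; cbn [fst snd]. ring. }
  rewrite Ec. unfold scal; simpl; unfold mult; simpl. ring.
Qed.

(** One mode is subtracted at a time: by [sqint_step] this costs exactly its share of the integral,
    and by orthogonality it leaves the other coefficients unchanged. Hence the induction over all
    functions at once. *)
Lemma bessel_list (l : list Z) : NoDup l -> forall f, contC f ->
  fold_right (fun k a => Cmod (fcoef f k) ^ 2 + a) 0 l <= / (2 * PI) * sqint f.
Proof.
  assert (P := PI_RGT_0). assert (iP : 0 < / (2 * PI)) by (apply Rinv_0_lt_compat; lra).
  induction 1 as [|k l Hk Hl IH]; intros f Hf; cbn [fold_right].
  - apply Rmult_le_pos; [lra|now apply sqint_pos].
  - set (c := fcoef f k). set (g := fun x => (f x - c * cexpi (IZR k * x))%C).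
    assert (ce : contC (fun x => (- c) * cexpi (IZR k * x))%C)
      by (apply contC_mult; auto using contC_const, contC_exp).
    assert (Hg : contC g).
    { apply contC_ext with (2 := contC_plus _ _ Hf ce). intros y. unfold g. ring. }
    assert (Hc : forall j, j <> k -> fcoef g j = fcoef f j).
    { intros j Hj. rewrite (fcoef_ext g (fun x => f x + (- c) * cexpi (IZR k * x))%C).
      - rewrite fcoef_plus, fcoef_scal, fcoef_exp by auto using contC_exp.
        destruct (Z.eqb_spec k j); [congruence|]. ring.
      - intros x. unfold g. ring. }
    assert (E : fold_right (fun j a => Cmod (fcoef f j) ^ 2 + a) 0 l =
                fold_right (fun j a => Cmod (fcoef g j) ^ 2 + a) 0 l).
    { clear IH Hl. induction l as [|j l IHl]; cbn [fold_right]; auto.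
      rewrite Hc by (intros ->; apply Hk; now left). rewrite IHl; auto.
      intros h. apply Hk. now right. }
    rewrite E. assert (I := IH g Hg). unfold g, c in I. rewrite sqint_step in I by auto.
    fold c in I. fold g in I.
    replace (/ (2 * PI) * (sqint f - 2 * PI * Cmod c ^ 2)) with (/ (2 * PI) * sqint f - Cmod c ^ 2) in I
      by (field; lra).
    lra.
Qed.

(** The frequencies from [-n-1] to [n] of a partial sum, listed in the order in which the pairs are
    added. *)
Fixpoint zlist (n : nat) : list Z :=
  match n with
  | O => (0 :: -1 :: nil)%Z
  | S m => (Z.of_nat (S m) :: (- Z.of_nat (S m) - 1) :: zlist m)%Z
  end.

Lemma zlist_range (n : nat) (k : Z) : In k (zlist n) -> (- Z.of_nat n - 1 <= k <= Z.of_nat n)%Z.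
Proof.
  induction n; cbn [zlist In]; [lia|]. intros [h|[h|h]]; try lia. apply IHn in h. lia.
Qed.

Lemma zlist_NoDup (n : nat) : NoDup (zlist n).
Proof.
  induction n; cbn [zlist].
  - repeat constructor; cbn [In]; lia.
  - constructor; [|constructor; auto].
    + cbn [In]. intros [h|h]; [lia|]. apply zlist_range in h. lia.
    + intros h. apply zlist_range in h. lia.
Qed.

Lemma bessel (f : R -> C) : contC f ->
  summable (fun k => Cmod (fcoef f k) ^ 2) /\
  ZSeriesR (fun k => Cmod (fcoef f k) ^ 2) <= / (2 * PI) * sqint f.
Proof.
  intros Hf. apply ZS_bound.
  - intros k. apply pow2_ge_0.
  - intros n. apply Rle_trans with (2 := bessel_list (zlist n) (zlist_NoDup n) f Hf).
    right. induction n.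
    + rewrite sum_O. unfold zpair. cbn [zlist fold_right]. simpl (Z.of_nat 0). simpl (- 0 - 1)%Z.
      real_eq. ring.
    + rewrite sum_SnR, IHn. unfold zpair. cbn [zlist fold_right]. real_eq. ring.
Qed.

(** * Decay of the coefficients of smooth periodic functions *)

Lemma CDerive_n_S (m : nat) (f : R -> C) : CDerive_n m (CDerive f) = CDerive_n (S m) f.
Proof. induction m; simpl in *; auto. now rewrite IHm. Qed.

Lemma periodic_CDerive (f : R -> C) : periodic f -> periodic (CDerive f).
Proof.
  intros Hp x. unfold CDerive, Derive. f_equal; f_equal; apply Lim_ext; intros h;
  replace (x + 2 * PI + h) with (x + h + 2 * PI) by ring; now rewrite !Hp.
Qed.

Lemma smooth_CDerive (f : R -> C) : smooth f -> smooth (CDerive f).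
Proof. intros H n x. rewrite CDerive_n_S. apply H. Qed.

Lemma smooth_C1 (f : R -> C) : smooth f -> C1fun f.
Proof.
  intros H. split; [exact (H 0%nat)|]. split; intros x; destruct (H 1%nat x) as [h1 h2].
  - exact (ex_derive_continuous (fun y => fst (CDerive f y)) x h1).
  - exact (ex_derive_continuous (fun y => snd (CDerive f y)) x h2).
Qed.

Lemma periodic_shift {V : Type} (f : R -> V) : (forall x, f (x + 2 * PI) = f x) ->
  forall (k : Z) (x : R), f (x + IZR k * (2 * PI)) = f x.
Proof.
  intros Hp.
  assert (HN : forall n : nat, forall x, f (x + INR n * (2 * PI)) = f x).
  { induction n; intros x; [f_equal; simpl; ring|].
    replace (x + INR (S n) * (2 * PI)) with ((x + INR n * (2 * PI)) + 2 * PI)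
      by (rewrite S_INR; ring). now rewrite Hp, IHn. }
  intros k x. destruct (Z_le_gt_dec 0 k) as [h|h].
  - rewrite <- (Z2Nat.id k), <- INR_IZR_INZ by lia. apply HN.
  - rewrite <- (HN (Z.to_nat (- k)) (x + IZR k * (2 * PI))).
    f_equal. rewrite INR_IZR_INZ, Z2Nat.id, opp_IZR by lia. ring.
Qed.

Lemma cont_periodic_bound (f : R -> R) : (forall x, continuous f x) ->
  (forall x, f (x + 2 * PI) = f x) -> exists M, forall x, f x <= M.
Proof.
  intros Hc Hp. assert (P := PI_RGT_0).
  destruct (continuity_ab_maj f 0 (2 * PI)) as [m [Hm _]]; [lra| |].
  - intros c _. apply continuity_pt_filterlim. apply Hc.
  - exists (f m). intros x.
    destruct (archimed (x / (2 * PI))) as [a1 a2].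
    set (k := (1 - up (x / (2 * PI)))%Z).
    rewrite <- (periodic_shift f Hp k x). apply Hm. unfold k. rewrite minus_IZR.
    set (U := IZR (up (x / (2 * PI)))) in *.
    assert (E : x = x / (2 * PI) * (2 * PI)) by (field; lra).
    set (y := x / (2 * PI)) in *. rewrite E. split; nra.
Qed.

Lemma periodic_Cmod_bound (f : R -> C) : contC f -> periodic f -> exists M, forall x, Cmod (f x) <= M.
Proof.
  intros Hf Hp. destruct (cont_periodic_bound (fun x => Cmod (f x) ^ 2)) as [M HM].
  - now apply cont_sq.
  - intros x. now rewrite Hp.
  - exists (M + 1). intros x. assert (h := HM x). cbv beta in h. assert (h1 := Cmod_ge_0 (f x)). nra.
Qed.

Lemma fcoef_derive_n (f : R -> C) (m : nat) (k : Z) : smooth f -> periodic f ->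
  fcoef (CDerive_n m f) k = ((Ci * IZR k) ^ m * fcoef f k)%C.
Proof.
  revert f. induction m; intros f Hs Hp.
  - simpl. ring.
  - rewrite <- CDerive_n_S, IHm, fcoef_derive; auto using smooth_CDerive, periodic_CDerive, smooth_C1.
    simpl. ring.
Qed.

Lemma fcoef_RD (f : R -> C) : smooth f -> periodic f -> RD (fcoef f).
Proof.
  intros Hs Hp m.
  assert (Hb : forall n, exists M, 0 <= M /\ forall k, Rabs (IZR k) ^ n * Cmod (fcoef f k) <= M).
  { intros n. assert (S' : smooth (CDerive_n n f) /\ periodic (CDerive_n n f)).
    { clear m. revert f Hs Hp. induction n; intros f Hs Hp; auto.
      rewrite <- CDerive_n_S. apply IHn; auto using smooth_CDerive, periodic_CDerive. }
    destruct S' as [s1 s2]. assert (c1 := C1_cont _ (smooth_C1 _ s1)).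
    destruct (periodic_Cmod_bound _ c1 s2) as [M HM].
    exists (2 * M). split; [assert (h := HM 0); assert (h' := Cmod_ge_0 (CDerive_n n f 0)); lra|].
    intros k. assert (h := fcoef_bound _ M k c1 HM).
    rewrite fcoef_derive_n, Cmod_mult, Cmod_pow, Cmod_mult, Cmod_Ci, Cmod_R, Rmult_1_l in h; auto. }
  destruct (Hb 0%nat) as [M0 [p0 H0]]. destruct (Hb m) as [M1 [p1 H1]].
  exists (2 ^ m * (M0 + M1)). intros k.
  assert (h0 := H0 k). assert (h1 := H1 k). simpl in h0. rewrite Rmult_1_l in h0.
  assert (c0 := Cmod_ge_0 (fcoef f k)). assert (a0 := Rabs_pos (IZR k)).
  assert (P2 : 0 < 2 ^ m) by (apply pow_lt; lra).
  unfold wt. destruct (Rle_dec (Rabs (IZR k)) 1) as [h|h].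
  - apply Rle_trans with (Cmod (fcoef f k) * 2 ^ m).
    + apply Rmult_le_compat_l; auto. apply pow_incr. lra.
    + rewrite Rmult_comm. apply Rmult_le_compat_l; lra.
  - apply Rle_trans with (Cmod (fcoef f k) * (2 * Rabs (IZR k)) ^ m).
    + apply Rmult_le_compat_l; auto. apply pow_incr. lra.
    + rewrite Rpow_mult_distr.
      replace (Cmod (fcoef f k) * (2 ^ m * Rabs (IZR k) ^ m))
        with (2 ^ m * (Rabs (IZR k) ^ m * Cmod (fcoef f k))) by ring.
      apply Rmult_le_compat_l; lra.
Qed.

(** * Pointwise Fourier inversion *)

Lemma continuous_eps (f : R -> R) (x : R) :
  (forall eps, 0 < eps -> exists d, 0 < d /\ forall y, Rabs (y - x) < d -> Rabs (f y - f x) < eps) <->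
  continuous f x.
Proof.
  split.
  - intros H. apply filterlim_locally. intros eps.
    destruct (H eps (cond_pos eps)) as [d [d0 Hd]]. exists (mkposreal d d0).
    intros y Hy. exact (Hd y Hy).
  - intros H eps He. apply filterlim_locally with (eps := mkposreal eps He) in H.
    destruct H as [d Hd]. exists d. split; [apply cond_pos|]. intros y Hy. exact (Hd y Hy).
Qed.

Lemma continuous_Rdiv (f g : R -> R) (x : R) :
  continuous f x -> continuous g x -> g x <> 0 -> continuous (fun y => f y / g y) x.
Proof.
  intros Hf Hg H. apply continuous_Rmult; auto.
  apply continuity_pt_filterlim. apply continuity_pt_inv; auto.
  now apply continuity_pt_filterlim.
Qed.

Definition slope (f : R -> R) (x0 l y : R) : R :=
  if Req_EM_T y x0 then l else (f y - f x0) / (y - x0).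

Lemma slope_cont (f : R -> R) (x0 l : R) : is_derive f x0 l -> continuous (slope f x0 l) x0.
Proof.
  intros H. apply is_derive_Reals in H. apply continuous_eps. intros eps He.
  destruct (H eps He) as [d Hd]. exists d. split; [apply cond_pos|]. intros y Hy.
  unfold slope. destruct (Req_EM_T x0 x0) as [_|n]; [|now elim n].
  destruct (Req_EM_T y x0) as [->|n].
  - rewrite Rminus_diag, Rabs_R0. auto.
  - assert (h : y - x0 <> 0) by lra. specialize (Hd (y - x0) h Hy).
    now replace (x0 + (y - x0)) with y in Hd by ring.
Qed.

(** f(y) cot((y - x) / 2), with the limit value at the zeros of the sine for an [f] that vanishes
    there. *)
Definition cot_mul (f : R -> R) (x y : R) : R :=
  if Req_EM_T (sin ((y - x) / 2)) 0 then 2 * Derive f y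
  else f y * cos ((y - x) / 2) / sin ((y - x) / 2).

(** Near a zero of the sine both functions vanish, so f / sin is the quotient of their difference
    quotients; these extend continuously, and that of the sine has a nonzero limit. *)
Lemma cot_mul_cont (f : R -> R) (x : R) : (forall y, ex_derive f y) ->
  (forall y, sin ((y - x) / 2) = 0 -> f y = 0) -> forall y, continuous (cot_mul f x) y.
Proof.
  intros Hd Hz y0.
  assert (Dsin : forall y, is_derive (fun y => sin ((y - x) / 2)) y (cos ((y - x) / 2) / 2)).
  { intros y. auto_derive; auto. unfold Rdiv, Rminus. ring. }
  assert (Csin : forall y, continuous (fun y => sin ((y - x) / 2)) y).
  { intros y. apply (ex_derive_continuous (fun y => sin ((y - x) / 2)) y). eexists. apply Dsin. }
  assert (Ccos : forall y, continuous (fun y => cos ((y - x) / 2)) y).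
  { intros y. apply (ex_derive_continuous (fun y => cos ((y - x) / 2)) y). auto_derive. auto. }
  assert (Cf : forall y, continuous f y) by (intros y; apply (ex_derive_continuous f y), Hd).
  assert (Nz : forall (g : R -> R), continuous g y0 -> g y0 <> 0 -> locally y0 (fun y => g y <> 0)).
  { intros g Hg Hn. apply continuous_eps with (eps := Rabs (g y0)) in Hg.
    2: now apply Rabs_pos_lt.
    destruct Hg as [d [d0 Hg]]. exists (mkposreal d d0). intros y Hy E.
    specialize (Hg y Hy). rewrite E, Rminus_0_l, Rabs_Ropp in Hg. lra. }
  destruct (Req_EM_T (sin ((y0 - x) / 2)) 0) as [e|n].
  - set (l := Derive f y0).
    assert (Hl : is_derive f y0 l) by (apply Derive_correct, Hd).
    set (A := slope f y0 l). set (B := slope (fun y => sin ((y - x) / 2)) y0 (cos ((y0 - x) / 2) / 2)).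
    assert (cA : continuous A y0) by now apply slope_cont.
    assert (cB : continuous B y0) by (apply slope_cont, Dsin).
    assert (Hcos : cos ((y0 - x) / 2) <> 0).
    { intros h. assert (k := sin2_cos2 ((y0 - x) / 2)). rewrite e, h in k. unfold Rsqr in k. lra. }
    assert (B0 : B y0 <> 0).
    { unfold B, slope. destruct (Req_EM_T y0 y0) as [_|k]; [|now elim k]. lra. }
    apply continuous_ext_loc with (fun y => A y / B y * cos ((y - x) / 2)).
    2: { apply continuous_Rmult; auto. apply continuous_Rdiv; auto. }
    destruct (Nz B cB B0) as [d Hd']. exists d. intros y Hy. specialize (Hd' y Hy).
    unfold cot_mul, A, B, slope in *. rewrite e, (Hz y0 e) in *.
    destruct (Req_EM_T y y0) as [->|h].
    + rewrite e. destruct (Req_EM_T 0 0) as [_|k]; [|now elim k]. unfold l. real_eq. field. auto.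
    + assert (hs : sin ((y - x) / 2) <> 0).
      { intros k. apply Hd'. rewrite k. unfold Rdiv. ring. }
      destruct (Req_EM_T (sin ((y - x) / 2)) 0) as [k|_]; [contradiction|].
      real_eq. field. split; auto. lra.
  - apply continuous_ext_loc with (fun y => f y * cos ((y - x) / 2) / sin ((y - x) / 2)).
    + destruct (Nz _ (Csin y0) n) as [d Hd']. exists d. intros y Hy. specialize (Hd' y Hy).
      unfold cot_mul. destruct (Req_EM_T (sin ((y - x) / 2)) 0); [contradiction|reflexivity].
    + apply continuous_Rdiv; auto. apply continuous_Rmult; auto.
Qed.

Lemma sq_lim_0 (a b : nat -> R) : (forall n, b n ^ 2 <= a n) -> is_lim_seq a 0 -> is_lim_seq b 0.
Proof.
  intros H Ha. apply is_lim_seq_spec in Ha. apply is_lim_seq_spec. intros eps.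
  assert (e2 : 0 < eps * eps) by (apply Rmult_lt_0_compat; apply cond_pos).
  destruct (Ha (mkposreal _ e2)) as [N HN]. exists N. intros n Hn.
  specialize (HN n Hn). simpl in HN. rewrite Rminus_0_r in *.
  assert (h := H n). assert (h1 := Rle_abs (a n)). assert (e0 := cond_pos eps).
  assert (h2 := Rabs_pos (b n)). assert (h3 := pow2_abs (b n)). nra.
Qed.

Lemma ZS_telescope (h : Z -> R) : is_lim_seq (fun n => h (Z.of_nat n)) 0 ->
  is_lim_seq (fun n => h (- Z.of_nat n - 1)%Z) 0 ->
  ZSeriesR (fun k => h (k - 1)%Z - h k) = 0.
Proof.
  intros H1 H2. apply (is_series_unique (zpair (fun k => h (k - 1)%Z - h k))). apply is_series_lim.
  apply is_lim_seq_ext with (fun n => h (- Z.of_nat (S n) - 1)%Z - h (Z.of_nat n)).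
  - intros n. induction n.
    + rewrite sum_O. unfold zpair.
      replace (- Z.of_nat 0 - 1 - 1)%Z with (- Z.of_nat 1 - 1)%Z by lia.
      replace (- Z.of_nat 0 - 1)%Z with (Z.of_nat 0 - 1)%Z by lia. real_eq. ring.
    + rewrite sum_SnR, <- IHn. unfold zpair.
      replace (- Z.of_nat (S n) - 1 - 1)%Z with (- Z.of_nat (S (S n)) - 1)%Z by lia.
      replace (Z.of_nat (S n) - 1)%Z with (Z.of_nat n) by lia. real_eq. ring.
  - replace 0 with (0 - 0) by ring. apply is_lim_seq_minus'; auto.
    exact (proj1 (is_lim_seq_incr_1 (fun n => h (- Z.of_nat n - 1)%Z) 0) H2).
Qed.

(* Chernoff's argument: [f - f x] is a continuous multiple of [e^(i(y-x)) - 1], the quotient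
   being [- 1/2 - (i/2) cot ((y-x)/2)] times [f - f x], so the Fourier series telescopes. *)
Lemma fourier_inversion (f : R -> C) : smooth f -> periodic f ->
  forall x, f x = ZSeriesC (fun k => fcoef f k * cexpi (IZR k * x))%C.
Proof.
  intros Hs Hp x. assert (Hc1 := smooth_C1 f Hs). assert (Hc := C1_cont f Hc1).
  set (f1 := fun y => fst (f y) - fst (f x)). set (f2 := fun y => snd (f y) - snd (f x)).
  assert (Hz : forall y, sin ((y - x) / 2) = 0 -> f y = f x).
  { intros y h. destruct (sin_eq_0_0 _ h) as [k Hk].
    replace y with (x + IZR k * (2 * PI)) by lra. now apply periodic_shift. }
  assert (d1 : forall y, ex_derive f1 y).
  { intros y. unfold f1. apply (ex_derive_minus (fun y => fst (f y)) (fun _ => fst (f x)));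
    [apply (proj1 Hc1)|apply ex_derive_const]. }
  assert (d2 : forall y, ex_derive f2 y).
  { intros y. unfold f2. apply (ex_derive_minus (fun y => snd (f y)) (fun _ => snd (f x)));
    [apply (proj1 Hc1)|apply ex_derive_const]. }
  assert (k1 := cot_mul_cont f1 x d1 ltac:(intros y h; unfold f1; rewrite (Hz y h); ring)).
  assert (k2 := cot_mul_cont f2 x d2 ltac:(intros y h; unfold f2; rewrite (Hz y h); ring)).
  set (g := fun y => (- / 2 * f1 y + / 2 * cot_mul f2 x y, - / 2 * f2 y - / 2 * cot_mul f1 x y) : C).
  assert (Hg : contC g).
  { assert (K : forall (c : R) (h : R -> R) y, continuous h y -> continuous (fun y => c * h y) y).
    { intros c h y Hh. apply continuous_Rmult; auto. apply continuous_const. }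
    split; intros y; unfold g; cbn [fst snd].
    - apply continuous_Rplus; apply K; auto. apply (ex_derive_continuous f1 y), d1.
    - apply continuous_Rminus; apply K; auto. apply (ex_derive_continuous f2 y), d2. }
  assert (Eg : forall y, f y = (f x + (cexpi (- x) * (cexpi (IZR 1 * y) * g y) + (-1) * g y))%C).
  { intros y. rewrite Cmult_assoc, <- cexpi_plus, Rmult_1_l.
    replace (- x + y) with (2 * ((y - x) / 2)) by field.
    set (th := (y - x) / 2).
    unfold cexpi. rewrite cos_2a_sin, sin_2a. unfold g, cot_mul. fold th.
    assert (SC := sin2_cos2 th). unfold Rsqr in SC.
    assert (F1 : f1 y = fst (f y) - fst (f x)) by reflexivity.
    assert (F2 : f2 y = snd (f y) - snd (f x)) by reflexivity.
    destruct (Req_EM_T (sin th) 0) as [e|n].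
    - rewrite e. rewrite (Hz y e).
      unfold Cplus, Cmult, RtoC, Copp; cbn [fst snd].
      rewrite (surjective_pairing (f x)) at 1. f_equal; ring.
    - unfold Cplus, Cmult, RtoC, Copp; cbn [fst snd].
      rewrite (surjective_pairing (f y)) at 1.
      replace (fst (f y)) with (fst (f x) + f1 y * (sin th * sin th + cos th * cos th))
        by (rewrite SC, F1; ring).
      replace (snd (f y)) with (snd (f x) + f2 y * (sin th * sin th + cos th * cos th))
        by (rewrite SC, F2; ring).
      f_equal; field; auto. }
  assert (Hfc : forall k, (fcoef f k * cexpi (IZR k * x))%C =
    ((if Z.eqb k 0 then f x else 0) +
     (fcoef g (k - 1) * cexpi (IZR (k - 1) * x) - fcoef g k * cexpi (IZR k * x)))%C).
  { intros k.
    assert (c1 : contC (fun y => cexpi (IZR 1 * y) * g y)%C) by (apply contC_mult; auto using contC_exp).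
    rewrite (fcoef_ext f _ k Eg).
    rewrite (fcoef_plus (fun _ => f x)); [|apply contC_const|].
    2: { apply contC_plus; apply contC_mult; auto using contC_const. }
    rewrite fcoef_plus, !fcoef_scal; auto.
    2: { apply contC_mult; auto using contC_const. }
    2: { apply contC_mult; auto using contC_const. }
    assert (E1 : fcoef (fun y => cexpi (IZR 1 * y) * g y)%C k = fcoef g (k - 1)).
    { rewrite !fcoef_CInt. f_equal. apply CInt_ext. intros y.
      replace (- (IZR (k - 1) * y)) with (IZR 1 * y + - (IZR k * y)) by (rewrite minus_IZR; ring).
      rewrite cexpi_plus. ring. }
    assert (E2 : fcoef (fun _ => f x) k = if Z.eqb k 0 then f x else 0%C).
    { rewrite (fcoef_ext _ (fun y => f x * cexpi (IZR 0 * y))%C).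
      - rewrite fcoef_scal, fcoef_exp by apply contC_exp. rewrite Z.eqb_sym.
        destruct (Z.eqb k 0); ring.
      - intros y. rewrite Rmult_0_l, cexpi_0. ring. }
    rewrite E1, E2.
    replace (IZR (k - 1) * x) with (- x + IZR k * x) by (rewrite minus_IZR; ring).
    rewrite cexpi_plus. destruct (Z.eqb_spec k 0) as [->|_].
    - rewrite Rmult_0_l, cexpi_0. ring.
    - ring. }
  rewrite (CS_ext _ _ Hfc).
  set (h := fun k => (fcoef g k * cexpi (IZR k * x))%C).
  set (dl := fun k : Z => if Z.eqb k 0 then f x else 0%C).
  assert (Sdl : Csummable dl) by exact (RD_summable _ (RD_cst (f x))).
  assert (Sh : Csummable (fun k => h (k - 1)%Z - h k)%C).
  { apply Csummable_le with (fun k => Cmod (fcoef f k) + Cmod (dl k)).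
    - intros k. replace (h (k - 1)%Z - h k)%C with (fcoef f k * cexpi (IZR k * x) - dl k)%C
        by (rewrite Hfc; unfold dl, h; ring).
      unfold Cminus. apply Rle_trans with (1 := Cmod_triangle _ _).
      rewrite Cmod_opp, Cmod_mult, Cmod_cexpi, Rmult_1_r. lra.
    - apply summable_plus; auto. exact (RD_summable _ (fcoef_RD f Hs Hp)). }
  change (f x = ZSeriesC (fun k => dl k + (h (k - 1)%Z - h k))%C).
  rewrite CS_plus by auto.
  assert (E1 : ZSeriesC dl = f x).
  { rewrite CS_single; auto. intros k Hk. unfold dl. destruct (Z.eqb_spec k 0); [contradiction|auto]. }
  (* [g] is only known to be continuous, but Bessel makes its coefficients tend to 0, which is all
     that the telescoping sum needs. *)
  assert (E2 : ZSeriesC (fun k => h (k - 1)%Z - h k)%C = 0%C).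
  { destruct (bessel g Hg) as [Sg _]. destruct (summable_tail _ Sg) as [t1 t2].
    assert (Hm : forall k, Cmod (h k) = Cmod (fcoef g k)).
    { intros k. unfold h. now rewrite Cmod_mult, Cmod_cexpi, Rmult_1_r. }
    assert (Hf : forall k, fst (h k) ^ 2 <= Cmod (fcoef g k) ^ 2).
    { intros k. rewrite <- Hm, <- (pow2_abs (fst (h k))). apply pow_incr.
      split; [apply Rabs_pos|apply fst_le_Cmod]. }
    assert (Hsn : forall k, snd (h k) ^ 2 <= Cmod (fcoef g k) ^ 2).
    { intros k. rewrite <- Hm, <- (pow2_abs (snd (h k))). apply pow_incr.
      split; [apply Rabs_pos|apply snd_le_Cmod]. }
    unfold ZSeriesC, RtoC. f_equal.
    - apply (ZS_telescope (fun k => fst (h k))).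
      + exact (sq_lim_0 _ _ (fun n => Hf (Z.of_nat n)) t1).
      + exact (sq_lim_0 _ _ (fun n => Hf (- Z.of_nat n - 1)%Z) t2).
    - apply (ZS_telescope (fun k => snd (h k))).
      + exact (sq_lim_0 _ _ (fun n => Hsn (Z.of_nat n)) t1).
      + exact (sq_lim_0 _ _ (fun n => Hsn (- Z.of_nat n - 1)%Z) t2). }
  rewrite E1, E2. ring.
Qed.

(** * Sums of rapidly decaying Fourier series *)

Lemma cos_lip (a b : R) : Rabs (cos a - cos b) <= Rabs (a - b).
Proof.
  destruct (MVT_gen cos b a (fun x => - sin x)) as [c [_ Hc]].
  - intros x _. auto_derive; auto. ring.
  - intros x _. apply continuity_cos.
  - rewrite Hc, Rabs_mult, Rabs_Ropp. assert (h := SIN_bound c).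
    assert (h1 : Rabs (sin c) <= 1) by (apply Rabs_le; lra).
    assert (h2 := Rabs_pos (a - b)). nra.
Qed.

Lemma sin_lip (a b : R) : Rabs (sin a - sin b) <= Rabs (a - b).
Proof.
  destruct (MVT_gen sin b a cos) as [c [_ Hc]].
  - intros x _. auto_derive; auto. ring.
  - intros x _. apply continuity_sin.
  - rewrite Hc, Rabs_mult. assert (h := COS_bound c).
    assert (h1 : Rabs (cos c) <= 1) by (apply Rabs_le; lra).
    assert (h2 := Rabs_pos (a - b)). nra.
Qed.

Lemma cexpi_lip (a b : R) : Cmod (cexpi a - cexpi b)%C <= 2 * Rabs (a - b).
Proof.
  apply Rle_trans with (1 := Cmod_le_parts _).
  unfold cexpi, Cminus, Cplus, Copp; cbn [fst snd].
  assert (h1 := cos_lip a b). assert (h2 := sin_lip a b). unfold Rminus in *. lra.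
Qed.

Definition fsum (c : rdseq) (x : R) : C := ZSeriesC (fun k => c k * cexpi (IZR k * x))%C.

Lemma fsum_terms (c : rdseq) (x : R) : Csummable (fun k => c k * cexpi (IZR k * x))%C.
Proof.
  apply Csummable_le with (fun k => Cmod (c k)); [|apply l1_summable].
  intros k. rewrite Cmod_mult, Cmod_cexpi. lra.
Qed.

(** Varying the coefficients and the point together gives continuity in x and, later, joint
    continuity in time and space. *)
Lemma fsum_diff (c d : rdseq) (x y : R) :
  Cmod (fsum c x - fsum d y)%C <= l1 (c - d) + 2 * l1 (AD d) * Rabs (x - y).
Proof.
  unfold fsum. rewrite <- CS_minus by apply fsum_terms.
  assert (Hb : forall k, Cmod (c k * cexpi (IZR k * x) - d k * cexpi (IZR k * y))%C <=
     Cmod ((c - d)%A k) + 2 * Rabs (x - y) * Cmod (AD d k)).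
  { intros k.
    replace (c k * cexpi (IZR k * x) - d k * cexpi (IZR k * y))%C with
      ((c - d)%A k * cexpi (IZR k * x) + d k * (cexpi (IZR k * x) - cexpi (IZR k * y)))%C
      by (rewrite Asub_co; ring).
    apply Rle_trans with (1 := Cmod_triangle _ _).
    rewrite !Cmod_mult, Cmod_cexpi, AD_co, Cmod_mult, Cmod_R.
    assert (h := cexpi_lip (IZR k * x) (IZR k * y)).
    rewrite <- Rmult_minus_distr_l, Rabs_mult in h.
    assert (h1 := Cmod_ge_0 (d k)). nra. }
  assert (Sb : summable (fun k => Cmod ((c - d)%A k) + 2 * Rabs (x - y) * Cmod (AD d k))).
  { apply summable_plus; [|apply summable_scal]; apply l1_summable. }
  assert (Sa := Csummable_le _ _ Hb Sb).
  apply Rle_trans with (1 := CS_norm _ Sa). apply Rle_trans with (1 := ZS_le _ _ Sa Sb Hb).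
  rewrite ZS_plus, ZS_scal by (try apply summable_scal; apply l1_summable).
  unfold l1. right. ring.
Qed.

Lemma l1_zero (c : rdseq) : l1 (c - c) = 0.
Proof.
  unfold l1. rewrite (ZS_ext _ (fun _ => 0 * 0)); [rewrite ZS_scal; ring|].
  intros k. rewrite Asub_co. replace (c k - c k)%C with (RtoC 0) by ring. rewrite Cmod_0. ring.
Qed.

Lemma fsum_cont (c : rdseq) : contC (fsum c).
Proof.
  assert (H : forall x eps, 0 < eps -> exists d, 0 < d /\ forall y, Rabs (y - x) < d ->
    Cmod (fsum c y - fsum c x)%C < eps).
  { intros x eps He. assert (P := l1_pos (AD c)). exists (eps / (2 * l1 (AD c) + 1)).
    assert (Q : 0 < eps / (2 * l1 (AD c) + 1)) by (apply Rdiv_lt_0_compat; lra).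
    split; auto. intros y Hy. apply Rle_lt_trans with (1 := fsum_diff c c y x).
    rewrite l1_zero. apply Rle_lt_trans with ((2 * l1 (AD c)) * (eps / (2 * l1 (AD c) + 1))).
    - rewrite Rplus_0_l. apply Rmult_le_compat_l; lra.
    - apply Rlt_le_trans with ((2 * l1 (AD c) + 1) * (eps / (2 * l1 (AD c) + 1))).
      + nra.
      + right. field. lra. }
  split; intros x; apply continuous_eps; intros eps He; destruct (H x eps He) as [d [d0 Hd]];
    exists d; split; auto; intros y Hy; apply Rle_lt_trans with (2 := Hd y Hy).
  - exact (fst_le_Cmod (fsum c y - fsum c x)%C).
  - exact (snd_le_Cmod (fsum c y - fsum c x)%C).
Qed.

(** Uniform convergence by the Weierstrass test: the partial sums differ from the limit by at most a
    tail of the majorant, at every x. *)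
Lemma RInt_ZS (phi : Z -> R -> R) (M : Z -> R) : (forall k x, continuous (phi k) x) ->
  (forall k x, Rabs (phi k x) <= M k) -> summable M ->
  (forall x, continuous (fun x => ZSeriesR (fun k => phi k x)) x) ->
  RInt (fun x => ZSeriesR (fun k => phi k x)) 0 (2 * PI) =
  ZSeriesR (fun k => RInt (phi k) 0 (2 * PI)).
Proof.
  intros Hc HM SM HF. assert (P := PI_RGT_0).
  assert (Sx : forall x, summable (fun k => phi k x)) by (intros x; now apply summable_le with M).
  symmetry. apply (is_series_unique (zpair (fun k => RInt (phi k) 0 (2 * PI)))). apply is_series_lim.
  set (F := fun x => ZSeriesR (fun k => phi k x)) in *.
  set (Pn := fun n x => sum_n (zpair (fun k => phi k x)) n).
  assert (HP : forall n, (forall x, continuous (Pn n) x) /\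
    sum_n (zpair (fun k => RInt (phi k) 0 (2 * PI))) n = RInt (Pn n) 0 (2 * PI)).
  { assert (Hz : forall n, (forall x, continuous (fun x => zpair (fun k => phi k x) n) x) /\
      zpair (fun k => RInt (phi k) 0 (2 * PI)) n = RInt (fun x => zpair (fun k => phi k x) n) 0 (2 * PI)).
    { intros n. unfold zpair. split.
      - intros x. apply continuous_Rplus; apply Hc.
      - rewrite RInt_plusR; auto. }
    induction n as [|n [h1 h2]].
    - destruct (Hz 0%nat) as [z1 z2]. split.
      + intros x. apply continuous_ext with (2 := z1 x). intros y. unfold Pn. now rewrite sum_O.
      + rewrite sum_O, z2. apply RInt_ext. intros x _. unfold Pn. now rewrite sum_O.
    - destruct (Hz (S n)) as [z1 z2]. split.
      + intros x. apply continuous_ext with (2 := continuous_Rplus _ _ x (h1 x) (z1 x)).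
        intros y. unfold Pn. now rewrite sum_SnR.
      + rewrite sum_SnR, h2, z2, <- RInt_plusR by auto.
        apply RInt_ext. intros x _. unfold Pn. now rewrite sum_SnR. }
  set (SMa := fun k => Rabs (M k)).
  assert (SSM : summable SMa) by now apply summable_abs.
  assert (Ht : forall n x, Rabs (F x - Pn n x) <= ZSeriesR SMa - sum_n (zpair SMa) n).
  { intros n x. unfold F, Pn.
    unfold ZSeriesR. change (fun n0 : nat => phi (Z.of_nat n0) x + phi (- Z.of_nat n0 - 1)%Z x)
      with (zpair (fun k => phi k x)).
    change (fun n0 : nat => SMa (Z.of_nat n0) + SMa (- Z.of_nat n0 - 1)%Z) with (zpair SMa).
    assert (e1 := summable_ex _ (Sx x)). assert (e2 := summable_ex _ SSM).
    rewrite !Series_tail by auto.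
    assert (Hle : forall k, Rabs (zpair (fun k => phi k x) (S n + k)) <= zpair SMa (S n + k)).
    { intros k. unfold zpair. apply Rle_trans with (1 := Rabs_triang _ _).
      apply Rplus_le_compat; apply Rle_trans with (1 := HM _ x); apply Rle_abs. }
    assert (e3 : ex_series (fun k => zpair SMa (S n + k))) by (now apply ex_series_incr_n).
    apply Rle_trans with (Series (fun k => Rabs (zpair (fun k => phi k x) (S n + k)))).
    - apply Series_Rabs. apply ex_series_le_R with (2 := e3). intros k. now rewrite Rabs_Rabsolu.
    - apply Series_le; auto. intros k. split; [apply Rabs_pos|auto]. }
  assert (Hl : is_lim_seq (fun n => 2 * PI * (ZSeriesR SMa - sum_n (zpair SMa) n)) 0).
  { replace (Finite 0) with (Finite (2 * PI * (ZSeriesR SMa - ZSeriesR SMa))) by (f_equal; ring).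
    apply is_lim_seq_mult'; [apply is_lim_seq_const|].
    apply is_lim_seq_minus'; [apply is_lim_seq_const|]. exact (Series_correct _ (summable_ex _ SSM)). }
  assert (Hd : forall n, Rabs (sum_n (zpair (fun k => RInt (phi k) 0 (2 * PI))) n - RInt F 0 (2 * PI))
     <= 2 * PI * (ZSeriesR SMa - sum_n (zpair SMa) n)).
  { intros n. destruct (HP n) as [h1 h2]. rewrite h2, Rabs_minus_sym.
    replace (RInt F 0 (2 * PI) - RInt (Pn n) 0 (2 * PI)) with (RInt (fun x => F x - Pn n x) 0 (2 * PI)).
    - apply RInt_bound; auto. intros x. now apply continuous_Rminus.
    - exact (RInt_minus F (Pn n) 0 (2 * PI) (ex_RInt_cont _ _ _ HF) (ex_RInt_cont _ _ _ h1)). }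
  replace (RInt F 0 (2 * PI)) with (RInt F 0 (2 * PI) + 0) by ring.
  apply is_lim_seq_ext with (fun n => RInt F 0 (2 * PI) +
    (sum_n (zpair (fun k => RInt (phi k) 0 (2 * PI))) n - RInt F 0 (2 * PI))).
  { intros n. ring. }
  apply is_lim_seq_plus'; [apply is_lim_seq_const|]. apply is_lim_seq_abs_0.
  apply (is_lim_seq_le_le (fun _ => 0) _ (fun n => 2 * PI * (ZSeriesR SMa - sum_n (zpair SMa) n))); auto.
  - intros n. split; [apply Rabs_pos|apply Hd].
  - apply is_lim_seq_const.
Qed.

(** Only the first factor is expanded and integrated term by term. The second need only be
    continuous and bounded, so no series for it is required. *)
Lemma fcoef_mul (c : rdseq) (G : R -> C) (MG : R) (n : Z) : contC G ->
  (forall x, Cmod (G x) <= MG) ->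
  fcoef (fun x => fsum c x * G x)%C n = conv c (fcoef G) n.
Proof.
  intros HG HM. assert (P := PI_RGT_0). unfold conv.
  set (phi := fun j x => (c j * (G x * cexpi (- (IZR (n - j) * x))))%C).
  assert (Hphi : forall x, (fsum c x * G x * cexpi (- (IZR n * x)))%C = ZSeriesC (fun j => phi j x)).
  { intros x. transitivity (G x * cexpi (- (IZR n * x)) * fsum c x)%C; [ring|].
    unfold fsum. rewrite <- CS_scal by apply fsum_terms. apply CS_ext. intros j. unfold phi.
    replace (- (IZR (n - j) * x)) with (- (IZR n * x) + IZR j * x) by (rewrite minus_IZR; ring).
    rewrite cexpi_plus. ring. }
  assert (Cphi : forall j, contC (phi j)).
  { intros j. apply contC_mult; [apply contC_const|]. now apply contC_fe. }
  assert (Bphi : forall j x, Cmod (phi j x) <= MG * Cmod (c j)).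
  { intros j x. unfold phi. rewrite !Cmod_mult, Cmod_cexpi, Rmult_1_r, Rmult_comm.
    apply Rmult_le_compat_r; auto. apply Cmod_ge_0. }
  assert (SB : summable (fun j => MG * Cmod (c j))) by apply summable_scal, l1_summable.
  assert (CT : contC (fun x => ZSeriesC (fun j => phi j x))).
  { assert (K : contC (fun x => fsum c x * G x * cexpi (- (IZR n * x)))%C).
    { apply contC_fe. apply contC_mult; auto. apply fsum_cont. }
    exact (contC_ext _ _ Hphi K). }
  assert (EI : CInt (fun x => ZSeriesC (fun j => phi j x)) = ZSeriesC (fun j => CInt (phi j))).
  { unfold CInt, ZSeriesC; cbn [fst snd]. f_equal.
    - apply (RInt_ZS (fun j x => fst (phi j x)) (fun j => MG * Cmod (c j))); auto.
      + intros j x. apply (proj1 (Cphi j)).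
      + intros j x. apply Rle_trans with (2 := Bphi j x). apply fst_le_Cmod.
      + intros x. exact (proj1 CT x).
    - apply (RInt_ZS (fun j x => snd (phi j x)) (fun j => MG * Cmod (c j))); auto.
      + intros j x. apply (proj2 (Cphi j)).
      + intros j x. apply Rle_trans with (2 := Bphi j x). apply snd_le_Cmod.
      + intros x. exact (proj2 CT x). }
  rewrite fcoef_CInt, (CInt_ext _ _ Hphi), EI.
  assert (Ej : forall j, CInt (phi j) = (RtoC (2 * PI) * (c j * fcoef G (n - j)%Z))%C).
  { intros j. unfold phi. rewrite CInt_scal by now apply contC_fe.
    rewrite fcoef_CInt.
    transitivity (c j * (RtoC (2 * PI) * RtoC (/ (2 * PI))) * CInt (fun x => G x * cexpi (- (IZR (n - j) * x))))%C.
    - rewrite <- RtoC_mult, Rinv_r by lra. ring.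
    - ring. }
  rewrite (CS_ext _ _ Ej), CS_scal.
  - rewrite Cmult_assoc, <- RtoC_mult, Rinv_l by lra. ring.
  - apply conv_terms with (2 * MG); [exact (RD_summable _ (co_RD c))|].
    intros k. now apply fcoef_bound.
Qed.

(** * From the equation to its Fourier coefficients *)

(* The operator Pi_{+,h} d/dx has symbol i (k 1_{k >= 0} + excess h k). *)
Definition excess (h : Rbar) (k : Z) : R := IZR k * (iTh_symbol h k - IZR (Z.sgn k)) / 2.

Lemma coth_opp (y : R) : coth (- y) = - coth y.
Proof.
  unfold coth, cosh, sinh. rewrite Ropp_involutive.
  replace ((exp (- y) - exp y) / 2) with (- ((exp y - exp (- y)) / 2)) by field.
  rewrite Rplus_comm, Rdiv_opp_r. reflexivity.
Qed.

(** coth y - 1 = 1 / (sinh y exp y), where sinh y exp y = (exp(2 y) - 1) / 2 and exp(2 y) = exp(y /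
    2)^4 >= (1 + y / 2)^4. Decay of fourth order is all that [excess_bound] requires. *)
Lemma coth_bound (y : R) : 0 < y -> 0 <= coth y - 1 <= 32 / y ^ 4.
Proof.
  intros Hy.
  assert (E1 : exp (- y) * exp y = 1) by (rewrite <- exp_plus; replace (- y + y) with 0 by ring; apply exp_0).
  assert (Hs : 0 < sinh y).
  { unfold sinh. assert (h := exp_increasing (- y) y ltac:(lra)). lra. }
  assert (p := exp_pos y).
  assert (E : coth y - 1 = / (sinh y * exp y)).
  { unfold coth. apply Rmult_eq_reg_r with (sinh y * exp y); [|apply Rgt_not_eq; nra].
    rewrite Rinv_l by (apply Rgt_not_eq; nra).
    replace ((cosh y / sinh y - 1) * (sinh y * exp y)) with ((cosh y - sinh y) * exp y) by (field; lra).
    unfold cosh, sinh. lra. }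
  assert (H4 : y ^ 4 / 32 <= sinh y * exp y).
  { assert (h := exp_ineq1_le (y / 2)).
    assert (E2 : exp y * exp y = exp (y / 2) ^ 4).
    { simpl. rewrite Rmult_1_r, <- !exp_plus. f_equal. field. }
    assert (h2 : (1 + y / 2) ^ 4 <= exp (y / 2) ^ 4) by (apply pow_incr; lra).
    assert (h3 : 1 + (y / 2) ^ 4 <= (1 + y / 2) ^ 4).
    { set (z := y / 2). assert (0 < z) by (unfold z; lra).
      replace ((1 + z) ^ 4) with (1 + z ^ 4 + (4 * z + 6 * (z * z) + 4 * (z * z * z))) by ring.
      assert (0 < z * z) by nra. assert (0 < z * z * z) by nra. lra. }
    replace (sinh y * exp y) with ((exp y * exp y - exp (- y) * exp y) / 2) by (unfold sinh; field).
    rewrite E1, E2. replace (y ^ 4 / 32) with ((y / 2) ^ 4 / 2) by field. lra. }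
  assert (p4 : 0 < y ^ 4) by now apply pow_lt.
  rewrite E. split.
  - left. apply Rinv_0_lt_compat. nra.
  - replace (32 / y ^ 4) with (/ (y ^ 4 / 32)) by (field; lra).
    apply Rinv_le_contravar; lra.
Qed.

Lemma excess_even (h : Rbar) (k : Z) : excess h (- k) = excess h k.
Proof.
  unfold excess, iTh_symbol. rewrite Z.sgn_opp, !opp_IZR.
  destruct (Z.eqb_spec k 0) as [->|n]; [simpl; field|].
  destruct (Z.eqb_spec (- k) 0); [lia|].
  destruct h as [h| |]; [|field|field].
  replace (h * - IZR k) with (- (h * IZR k)) by ring. rewrite coth_opp. field.
Qed.

(** For finite h and k > 0 the product of k and [excess h k] is k^2 (coth(h k) - 1) / 2; of the four
    powers of decay, two absorb k^2 and two the weight, and 64 is 32 / 2 times 4 from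
    [wt k ^ 2 <= 4 k^2]. For infinite h the excess vanishes. *)
Lemma excess_bound (h : Rbar) (h0 : R) (k : Z) : 0 < h0 -> Rbar_le h0 h ->
  Rabs (IZR k * excess h k) * wt k ^ 2 <= 64 / h0 ^ 4.
Proof.
  intros H0 Hh. assert (P : 0 < h0 ^ 4) by now apply pow_lt.
  assert (P' : 0 <= 64 / h0 ^ 4) by (apply Rdiv_le_0_compat; lra).
  assert (Hpos : forall j, (0 < j)%Z -> Rabs (IZR j * excess h j) * wt j ^ 2 <= 64 / h0 ^ 4).
  { intros j Hj. unfold excess, iTh_symbol.
    destruct (Z.eqb_spec j 0); [lia|]. rewrite Z.sgn_pos by lia.
    assert (J : 1 <= IZR j) by (apply IZR_le; lia).
    destruct h as [h| |]; [| |contradiction].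
    - simpl in Hh. assert (C := coth_bound (h * IZR j) ltac:(nra)).
      set (x := coth (h * IZR j) - 1) in *.
      replace (IZR j * (IZR j * x / 2)) with (IZR j ^ 2 / 2 * x) by field.
      assert (J2 : 0 < IZR j ^ 2) by nra.
      rewrite Rabs_pos_eq by (apply Rmult_le_pos; lra).
      assert (B : x <= 32 / (h0 ^ 4 * IZR j ^ 4)).
      { apply Rle_trans with (1 := proj2 C). unfold Rdiv. apply Rmult_le_compat_l; [lra|].
        rewrite <- Rpow_mult_distr. apply Rinv_le_contravar.
        - apply pow_lt. nra.
        - apply pow_incr. nra. }
      assert (W : wt j ^ 2 <= 4 * IZR j ^ 2).
      { unfold wt. rewrite Rabs_pos_eq by lra. nra. }
      apply Rle_trans with (IZR j ^ 2 / 2 * (32 / (h0 ^ 4 * IZR j ^ 4)) * (4 * IZR j ^ 2)).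
      + assert (w := wt_pow_ge1 2 j). apply Rmult_le_compat; try lra.
        * apply Rmult_le_pos; lra.
        * apply Rmult_le_compat_l; lra.
      + right. field. split; lra.
    - replace (IZR j * (IZR j * (1 - 1) / 2)) with 0 by field. rewrite Rabs_R0. lra. }
  destruct (Z.lt_trichotomy k 0) as [n|[->|p]].
  - rewrite <- (Z.opp_involutive k), excess_even.
    set (j := (- k)%Z). rewrite wt_opp, opp_IZR, Ropp_mult_distr_l_reverse, Rabs_Ropp. apply Hpos. lia.
  - rewrite Rmult_0_l, Rabs_R0, Rmult_0_l. auto.
  - now apply Hpos.
Qed.

Lemma excess_bounded (h : Rbar) (h0 : R) (k : Z) : 0 < h0 -> Rbar_le h0 h ->
  Cmod (RtoC (excess h k)) <= 64 / h0 ^ 4.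
Proof.
  intros H0 Hh. assert (B := excess_bound h h0 k H0 Hh). rewrite Cmod_R.
  destruct (Z.eq_dec k 0) as [->|n].
  - unfold excess. replace (0 * (iTh_symbol h 0 - IZR (Z.sgn 0)) / 2) with 0 by field.
    rewrite Rabs_R0. assert (w := wt_pow_ge1 2 0). rewrite Rmult_0_l, Rabs_R0 in B. lra.
  - apply Rle_trans with (2 := B). rewrite Rabs_mult.
    assert (J : 1 <= Rabs (IZR k)) by (rewrite <- abs_IZR; apply IZR_le; lia).
    assert (w := wt_pow_ge1 2 k). assert (e := Rabs_pos (excess h k)).
    assert (Rabs (excess h k) <= Rabs (IZR k) * Rabs (excess h k)) by nra. nra.
Qed.

Definition Aexcess (h : Rbar) (h0 : R) (H0 : 0 < h0) (Hh : Rbar_le h0 h) (f : rdseq) : rdseq :=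
  Adiag _ (bounded_growth (fun k => RtoC (excess h k)) _ (fun k => excess_bounded h h0 k H0 Hh)) f.

(** Cauchy-Schwarz bounds every coefficient of |u|^2 by the mass alone. *)
Lemma conv_le_nrm (f g : rdseq) (n : Z) : Cmod ((f * g)%A n) <= nrm f * nrm g.
Proof.
  assert (H := conv_dom f g f g (fun k => Rle_refl _) (fun k => Rle_refl _) n).
  apply Rle_trans with (1 := H). rewrite abs_conv, Cmod_R.
  assert (S1 := sq_summable f).
  destruct (ZS_reflect _ n (sq_summable g)) as [S2 E2]. cbv beta in S2, E2.
  destruct (ZS_CS (fun j => Cmod (f j) ^ 2) (fun j => Cmod (g (n - j)%Z) ^ 2)
    (fun j => Cmod (f j) * Cmod (g (n - j)%Z))) as [_ h]; auto.
  - intros; apply pow2_ge_0.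
  - intros; apply pow2_ge_0.
  - intros. right. ring.
  - rewrite E2 in h. fold (norm2 f) (norm2 g) in h.
    set (x := ZSeriesR (fun j => Cmod (f j) * Cmod (g (n - j)%Z))) in *.
    apply Rsqr_incr_0; [|apply Rabs_pos|apply Rmult_le_pos; apply nrm_pos].
    rewrite <- Rsqr_abs. unfold Rsqr. rewrite <- !nrm_sq in h. lra.
Qed.

Definition potential (beta h0 : R) (h : Rbar) (H0 : 0 < h0) (Hh : Rbar_le h0 h) (a : rdseq) : rdseq :=
  (Acst (2 * beta)%R * Aexcess h h0 H0 Hh (a * Aconj a))%A.

(** The symbol [excess] is real and even, so it maps the real function |u|^2 to a real function. *)
Lemma potential_real (beta h0 : R) (h : Rbar) (H0 : 0 < h0) (Hh : Rbar_le h0 h) (a : rdseq) :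
  Aconj (potential beta h0 h H0 Hh a) = potential beta h0 h H0 Hh a.
Proof.
  unfold potential. rewrite Aconj_mul, Aconj_cst, Cconj_RtoC. f_equal.
  assert (Hg : Aconj (a * Aconj a) = (a * Aconj a)%A) by (rewrite Aconj_mul, Aconj_conj; ring).
  set (g := (a * Aconj a)%A) in *. apply rd_ext. intros k. cbn [Aconj Aexcess Adiag co].
  rewrite Cmult_conj, Cconj_RtoC, excess_even. rewrite <- Hg at 2. reflexivity.
Qed.

(** The decay of [excess] makes the derivative of the potential summable using only the mass, hence
    a rate of growth that does not see the H^s norm. The 6 is 2 from the equation times 3 from
    [sum_wt]. *)
Lemma potential_bound (beta h0 : R) (h : Rbar) (H0 : 0 < h0) (Hh : Rbar_le h0 h) (a : rdseq) :
  l1 (Acst Ci * AD (potential beta h0 h H0 Hh a)) <= 6 * Rabs beta * (64 / h0 ^ 4) * norm2 a.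
Proof.
  set (E := 64 / h0 ^ 4). set (g := (a * Aconj a)%A).
  assert (Hn : nrm (Aconj a) = nrm a).
  { unfold nrm, norm2. f_equal. destruct (ZS_reflect _ 0 (sq_summable a)) as [_ e]. cbv beta in e.
    rewrite <- e. apply ZS_ext. intros k. cbn [Aconj co]. now rewrite Cmod_conj. }
  destruct sum_wt as [w1 w2].
  assert (Hk : forall k, Cmod ((Acst Ci * AD (potential beta h0 h H0 Hh a))%A k) <=
     2 * Rabs beta * E * norm2 a * / wt k ^ 2).
  { intros k. rewrite Amul_cst, AD_co. unfold potential. rewrite Amul_cst. cbn [Aexcess Adiag co].
    fold g. rewrite !Cmod_mult, Cmod_Ci, !Cmod_R, Rmult_1_l, Rabs_mult, (Rabs_pos_eq 2) by lra.
    assert (B := excess_bound h h0 k H0 Hh). fold E in B. rewrite Rabs_mult in B.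
    assert (G := conv_le_nrm a (Aconj a) k). rewrite Hn, nrm_sq in G. fold g in G.
    change (Cmod (conv a (Aconj a) k)) with (Cmod (g k)).
    assert (w := wt_pow_ge1 2 k). assert (b0 := Rabs_pos beta).
    assert (B' : Rabs (IZR k) * Rabs (excess h k) <= E * / wt k ^ 2).
    { apply le_div_wt. lra. }
    replace (Rabs (IZR k) * (2 * Rabs beta * (Rabs (excess h k) * Cmod (g k))))
      with (2 * Rabs beta * ((Rabs (IZR k) * Rabs (excess h k)) * Cmod (g k))) by ring.
    replace (2 * Rabs beta * E * norm2 a * / wt k ^ 2)
      with (2 * Rabs beta * ((E * / wt k ^ 2) * norm2 a)) by ring.
    apply Rmult_le_compat_l; [lra|]. apply Rmult_le_compat; auto.
    - apply Rmult_le_pos; apply Rabs_pos.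
    - apply Cmod_ge_0. }
  apply Rle_trans with (ZSeriesR (fun k => 2 * Rabs beta * E * norm2 a * / wt k ^ 2)).
  - apply ZS_le; [apply l1_summable|now apply summable_scal|auto].
  - rewrite ZS_scal.
    assert (E0 : 0 <= E) by (apply Rdiv_le_0_compat; [lra|now apply pow_lt]).
    assert (Q : 0 <= 2 * Rabs beta * E * norm2 a).
    { assert (q1 := Rabs_pos beta). assert (q2 := norm2_pos a). repeat (lra || apply Rmult_le_pos). }
    replace (6 * Rabs beta * E * norm2 a) with (2 * Rabs beta * E * norm2 a * 3) by ring.
    now apply Rmult_le_compat_l.
Qed.

(** * Continuity in time of the right-hand side *)

Lemma Acont_const (f : rdseq) (t : R) : Acont (fun _ => f) t.
Proof.
  intros m eps He. exists 1. split; [lra|]. intros s _ k. rewrite Asub_co.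
  replace (f k - f k)%C with (RtoC 0) by ring. rewrite Cmod_0. lra.
Qed.

Lemma Acont_add (f g : R -> rdseq) (t : R) : Acont f t -> Acont g t -> Acont (fun s => f s + g s)%A t.
Proof.
  intros Hf Hg m eps He. destruct (Hf m (eps / 2)) as [d1 [p1 H1]]; [lra|].
  destruct (Hg m (eps / 2)) as [d2 [p2 H2]]; [lra|].
  exists (Rmin d1 d2). split; [now apply Rmin_glb_lt|]. intros s Hs.
  assert (h1 := Rmin_l d1 d2). assert (h2 := Rmin_r d1 d2).
  replace (f s + g s - (f t + g t))%A with ((f s - f t) + (g s - g t))%A by ring.
  replace eps with (eps / 2 + eps / 2) by field.
  apply small_add; [apply H1|apply H2]; lra.
Qed.

Lemma Acont_mul (f g : R -> rdseq) (t : R) : Acont f t -> Acont g t -> Acont (fun s => f s * g s)%A t.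
Proof.
  intros Hf Hg m eps He.
  destruct (co_RD (f t) (m + 2)%nat) as [c1 Hc1]. destruct (co_RD (g t) m) as [c2 Hc2].
  assert (q1 := small_nonneg _ _ _ Hc1). assert (q2 := small_nonneg _ _ _ Hc2).
  set (e1 := eps / (6 * (c2 + 1))). set (e2 := eps / (6 * (c1 + 1))).
  assert (r1 : 0 < e1) by (apply Rdiv_lt_0_compat; lra).
  assert (r2 : 0 < e2) by (apply Rdiv_lt_0_compat; lra).
  destruct (Hf (m + 2)%nat e1 r1) as [d1 [p1 H1]]. destruct (Hg m e2 r2) as [d2 [p2 H2]].
  destruct (Hg m 1 Rlt_0_1) as [d3 [p3 H3]].
  exists (Rmin d1 (Rmin d2 d3)). split; [repeat apply Rmin_glb_lt; auto|]. intros s Hs.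
  assert (a1 := Rmin_l d1 (Rmin d2 d3)). assert (a2 := Rmin_r d1 (Rmin d2 d3)).
  assert (a3 := Rmin_l d2 d3). assert (a4 := Rmin_r d2 d3).
  specialize (H1 s ltac:(lra)). specialize (H2 s ltac:(lra)). specialize (H3 s ltac:(lra)).
  replace (f s * g s - f t * g t)%A with ((f s - f t) * g s + f t * (g s - g t))%A by ring.
  assert (Hgs : small m (c2 + 1) (g s)).
  { replace (g s) with (g t + (g s - g t))%A by ring. now apply small_add. }
  apply small_le with (3 * e1 * (c2 + 1) + 3 * c1 * e2).
  - assert (E1 : 3 * e1 * (c2 + 1) = eps / 2) by (unfold e1; field; lra).
    assert (E2 : 3 * (c1 + 1) * e2 = eps / 2) by (unfold e2; field; lra). nra.
  - apply small_add; now apply small_conv.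
Qed.

Lemma Acont_P (f : R -> rdseq) (t : R) : Acont f t -> Acont (fun s => AP (f s)) t.
Proof.
  intros H m eps He. destruct (H m eps He) as [d [d0 Hd]]. exists d. split; auto. intros s Hs.
  replace (AP (f s) - AP (f t))%A with (AP (f s - f t)) by (unfold Asub; now rewrite AP_add, AP_opp).
  apply small_P; auto.
Qed.

Lemma Acont_conj (f : R -> rdseq) (t : R) : Acont f t -> Acont (fun s => Aconj (f s)) t.
Proof.
  intros H m eps He. destruct (H m eps He) as [d [d0 Hd]]. exists d. split; auto. intros s Hs.
  replace (Aconj (f s) - Aconj (f t))%A with (Aconj (f s - f t))
    by (unfold Asub; now rewrite Aconj_add, Aconj_opp).
  apply small_conj; auto.
Qed.

Lemma Acont_excess (h : Rbar) (h0 : R) (H0 : 0 < h0) (Hh : Rbar_le h0 h) (f : R -> rdseq) (t : R) :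
  Acont f t -> Acont (fun s => Aexcess h h0 H0 Hh (f s)) t.
Proof.
  set (E := 64 / h0 ^ 4). assert (E0 : 0 < E) by (apply Rdiv_lt_0_compat; [lra|now apply pow_lt]).
  intros H m eps He. destruct (H m (eps / E)) as [d [d0 Hd]]; [now apply Rdiv_lt_0_compat|].
  exists d. split; auto. intros s Hs.
  apply small_le with (E * (eps / E)); [right; field; lra|].
  apply small_ext with (fun k => RtoC (excess h k) * (f s - f t)%A k)%C.
  - intros k. rewrite !Asub_co. cbn [Aexcess Adiag co]. ring.
  - apply small_mult; auto. intros k. now apply excess_bounded.
Qed.

Lemma Acont_opB (beta h0 : R) (h : Rbar) (H0 : 0 < h0) (Hh : Rbar_le h0 h) (a : R -> rdseq) (t : R) :
  Acont a t -> Acont (fun s => opB beta (potential beta h0 h H0 Hh (a s)) (a s) (a s)) t.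
Proof.
  intros Ha. unfold opB, potential.
  apply Acont_add; [apply Acont_add|].
  - apply (Acont_mul (fun _ => Acst Ci)); [apply Acont_const|].
    apply (Acont_D (fun s => AD (a s))), Acont_D, Ha.
  - apply (Acont_mul (fun _ => (Acst (2 * beta) * Acst Ci)%A)); [apply Acont_const|].
    apply (Acont_mul a); auto. apply Acont_P, Acont_D. apply Acont_mul; auto. now apply Acont_conj.
  - apply (Acont_mul _ a); auto. apply (Acont_mul (fun _ => Acst Ci)); [apply Acont_const|].
    apply (Acont_mul (fun _ => Acst (2 * beta)%R)); [apply Acont_const|].
    apply Acont_excess. apply Acont_mul; auto. now apply Acont_conj.
Qed.

(** * The equation in terms of Fourier coefficients *)

Lemma fsum_add (c d : rdseq) (x : R) : fsum (c + d) x = (fsum c x + fsum d x)%C.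
Proof.
  unfold fsum. rewrite <- CS_plus by apply fsum_terms. apply CS_ext. intros k.
  rewrite Aadd_co. ring.
Qed.

Lemma fsum_cst (z : C) (c : rdseq) (x : R) : fsum (Acst z * c) x = (z * fsum c x)%C.
Proof.
  unfold fsum. rewrite <- CS_scal by apply fsum_terms. apply CS_ext. intros k.
  rewrite Amul_cst. ring.
Qed.

Lemma fsum_mul (c d : rdseq) (x : R) : fsum (c * d) x = (fsum c x * fsum d x)%C.
Proof.
  unfold fsum at 1.
  destruct (rd_bound 4 c) as [k1 [k10 Hk1]]. destruct (rd_bound 2 d) as [k2 [k20 Hk2]].
  destruct sum_wt as [w1 _].
  transitivity (ZSeriesC (fun n => ZSeriesC (fun j =>
    (c j * cexpi (IZR j * x)) * (d (n - j)%Z * cexpi (IZR (n - j) * x)))%C)).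
  { apply CS_ext. intros n. cbn [Amul co]. unfold conv. rewrite Cmult_comm, <- CS_scal.
    - apply CS_ext. intros j. replace (IZR n * x) with (IZR j * x + IZR (n - j) * x)
        by (rewrite minus_IZR; ring). rewrite cexpi_plus. ring.
    - apply RD_terms; apply co_RD. }
  rewrite (CS_swap _ (fun n => k2 * / wt n ^ 2) (fun j => k1 * / wt j ^ 2)).
  - rewrite Cmult_comm. unfold fsum at 2. rewrite <- CS_scal by apply fsum_terms.
    apply CS_ext. intros j.
    destruct (CS_shift (fun n => d n * cexpi (IZR n * x))%C (- j) (fsum_terms d x)) as [s1 s2].
    rewrite CS_scal by exact s1. rewrite Cmult_comm. f_equal. exact s2.
  - intros n j. rewrite !Cmod_mult, !Cmod_cexpi, !Rmult_1_r.
    apply conv_dominated; auto; apply Cmod_ge_0.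
  - intros k. apply Rmult_le_pos; auto using wt_inv_nonneg.
  - intros k. apply Rmult_le_pos; auto using wt_inv_nonneg.
  - now apply summable_scal.
  - now apply summable_scal.
Qed.

Lemma fcoef_fsum (c : rdseq) (n : Z) : fcoef (fsum c) n = c n.
Proof.
  transitivity (conv c (fcoef (fun _ => 1%C)) n).
  - rewrite <- (fcoef_mul c (fun _ => 1%C) 1).
    + apply fcoef_ext. intros x. ring.
    + apply contC_const.
    + intros x. rewrite Cmod_1. lra.
  - assert (E : forall k, fcoef (fun _ => 1%C) k = Acst 1 k).
    { intros k. rewrite (fcoef_ext _ (fun x => cexpi (IZR 0 * x))).
      - rewrite fcoef_exp, Z.eqb_sym. reflexivity.
      - intros x. now rewrite Rmult_0_l, cexpi_0. }
    transitivity ((c * Acst 1)%A n).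
    + cbn [Amul co]. unfold conv. apply CS_ext. intros j. now rewrite E.
    + rewrite Amul_comm, Amul_cst. ring.
Qed.

Lemma fcoef_conj (f : R -> C) (k : Z) : contC f ->
  fcoef (fun x => Cconj (f x)) k = Cconj (fcoef f (- k)).
Proof.
  intros Hf. destruct (contC_fe f (- k) Hf) as [c1 c2].
  rewrite !fcoef_CInt, Cmult_conj, Cconj_RtoC. f_equal.
  unfold CInt at 2. unfold Cconj at 2; cbn [fst snd].
  replace (- RInt (fun x => snd (f x * cexpi (- (IZR (- k) * x)))%C) 0 (2 * PI))
    with (RInt (fun x => -1 * snd (f x * cexpi (- (IZR (- k) * x)))%C) 0 (2 * PI))
    by (rewrite RInt_scalR by auto; real_eq; ring).
  unfold CInt. f_equal; apply RInt_ext; intros x _; rewrite opp_IZR;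
    replace (- (- IZR k * x)) with (IZR k * x) by ring;
    rewrite cexpi_opp; unfold Cmult, Cconj; cbn [fst snd]; real_eq; ring.
Qed.

Definition fseq (f : R -> C) (H : periodic f /\ smooth f) : rdseq :=
  mkrd (fcoef f) (fcoef_RD f (proj2 H) (proj1 H)).

Lemma fsum_fseq (f : R -> C) (H : periodic f /\ smooth f) (x : R) : fsum (fseq f H) x = f x.
Proof. symmetry. exact (fourier_inversion f (proj2 H) (proj1 H) x). Qed.

Lemma fourier_derive2 (f : R -> C) (H : periodic f /\ smooth f) (x : R) :
  CDerive_n 2 f x = fsum (- AD (AD (fseq f H))) x.
Proof.
  destruct H as [Hp Hs].
  assert (Hsq : smooth (CDerive_n 2 f)) by (apply (smooth_CDerive (CDerive f)), smooth_CDerive, Hs).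
  assert (Hp2 : periodic (CDerive_n 2 f)) by (apply (periodic_CDerive (CDerive f)), periodic_CDerive, Hp).
  rewrite (fourier_inversion _ Hsq Hp2 x). unfold fsum. apply CS_ext. intros k.
  rewrite fcoef_derive_n by auto. rewrite Aopp_co, !AD_co. cbn [fseq co].
  replace ((Ci * IZR k) ^ 2)%C with (Ci * Ci * (IZR k * IZR k))%C by (simpl; ring).
  replace (Ci * Ci)%C with (- (1))%C; [ring|].
  unfold Ci, Cmult, Copp, RtoC; cbn [fst snd]. f_equal; ring.
Qed.

Lemma fcoef_density (f : R -> C) (H : periodic f /\ smooth f) (k : Z) :
  fcoef (fun y => RtoC (Derive (fun z => (Cmod (f z)) ^ 2) y)) k =
  (Ci * IZR k * (fseq f H * Aconj (fseq f H))%A k)%C.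
Proof.
  assert (Hc1 := smooth_C1 f (proj2 H)). assert (Hc := C1_cont f Hc1).
  set (w := fun z => RtoC (Cmod (f z) ^ 2)).
  set (f1 := fun z => fst (f z)). set (f2 := fun z => snd (f z)).
  assert (Dw : forall x, is_derive (fun z => Cmod (f z) ^ 2) x
     (2 * (f1 x * Derive f1 x) + 2 * (f2 x * Derive f2 x))).
  { intros x. destruct (proj1 Hc1 x) as [h1 h2].
    apply is_derive_ext with (fun z => f1 z ^ 2 + f2 z ^ 2).
    - intros z. rewrite Cmod2_alt. reflexivity.
    - change (ex_derive f1 x) in h1. change (ex_derive f2 x) in h2.
      auto_derive; [repeat split; auto|].
      change (Derive (fun x => f1 x) x) with (Derive f1 x).
      change (Derive (fun x => f2 x) x) with (Derive f2 x). ring. }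
  assert (Ew : forall x, CDerive w x = RtoC (Derive (fun z => Cmod (f z) ^ 2) x)).
  { intros x. unfold CDerive, w, RtoC; cbn [fst snd]. f_equal. apply Derive_const. }
  assert (Cw : C1fun w).
  { split.
    - intros x. split.
      + eexists. apply Dw.
      + apply (ex_derive_ext (fun _ => 0)); [reflexivity|apply ex_derive_const].
    - split; intros x.
      + apply continuous_ext with (fun x => 2 * (f1 x * Derive f1 x) + 2 * (f2 x * Derive f2 x)).
        * intros y. rewrite Ew. symmetry. exact (is_derive_unique _ _ _ (Dw y)).
        * assert (K : forall h : R -> R, continuous h x -> continuous (fun y => 2 * h y) x).
          { intros h Hh. apply continuous_Rmult; auto. apply continuous_const. }
          apply continuous_Rplus; apply K; apply continuous_Rmult.
          -- apply (proj1 Hc).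
          -- apply (proj1 (proj2 Hc1)).
          -- apply (proj2 Hc).
          -- apply (proj2 (proj2 Hc1)).
      + apply continuous_ext with (fun _ => 0); [|apply continuous_const].
        intros y. rewrite Ew. reflexivity. }
  assert (Pw : periodic w) by (intros x; unfold w; now rewrite (proj1 H)).
  rewrite <- (fcoef_ext _ _ k Ew), (fcoef_derive w k Cw Pw). f_equal.
  assert (Cc := contC_conj f Hc).
  destruct (periodic_Cmod_bound f Hc (proj1 H)) as [M HM].
  rewrite (fcoef_ext w (fun x => fsum (fseq f H) x * Cconj (f x))%C).
  - rewrite (fcoef_mul _ _ M).
    + cbn [Amul co]. unfold conv. apply CS_ext. intros j. f_equal. now apply fcoef_conj.
    + auto.
    + intros x. now rewrite Cmod_conj.
  - intros x. rewrite fsum_fseq. unfold w. now rewrite <- Cmod2_conj, RtoC_pow.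
Qed.

Lemma Piplus_density (h : Rbar) (h0 : R) (H0 : 0 < h0) (Hh : Rbar_le h0 h)
  (f : R -> C) (H : periodic f /\ smooth f) (x : R) :
  Piplus h (fun y => RtoC (Derive (fun z => (Cmod (f z)) ^ 2) y)) x =
  fsum (Acst Ci * (AP (AD (Aconj (fseq f H) * fseq f H)) + Aexcess h h0 H0 Hh (fseq f H * Aconj (fseq f H)))) x.
Proof.
  unfold Piplus, fsum. apply CS_ext. intros k. rewrite (fcoef_density f H).
  rewrite (Amul_comm (Aconj (fseq f H))). set (g := (fseq f H * Aconj (fseq f H))%A).
  rewrite Amul_cst, Aadd_co, AP_co, AD_co. cbn [Aexcess Adiag co].
  assert (E : (RtoC ((1 + iTh_symbol h k) / 2)%R * IZR k)%C = ((if Z.leb 0 k then 1 else 0) * IZR k + RtoC (excess h k))%C).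
  { unfold excess, iTh_symbol. destruct (Z.eqb_spec k 0) as [->|n].
    - simpl. rewrite !Rmult_0_l, Rdiv_0_l. ring.
    - destruct (Z.leb_spec 0 k).
      + rewrite Z.sgn_pos by lia. rewrite <- !RtoC_mult, <- RtoC_plus. f_equal. field.
      + rewrite Z.sgn_neg by lia. rewrite <- !RtoC_mult, <- RtoC_plus. f_equal. field. }
  transitivity (Ci * (RtoC ((1 + iTh_symbol h k) / 2)%R * IZR k) * g k * cexpi (IZR k * x))%C; [ring|].
  rewrite E. ring.
Qed.

Lemma rhs_series (h : Rbar) (beta h0 : R) (H0 : 0 < h0) (Hh : Rbar_le h0 h)
  (f : R -> C) (H : periodic f /\ smooth f) (x : R) :
  (Cplus (Cmult (0, -1) (CDerive_n 2 f x))
     (Cmult (RtoC (2 * beta)) (Cmult (f x)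
       (Piplus h (fun y => RtoC (Derive (fun z => (Cmod (f z)) ^ 2) y)) x)))) =
  fsum (opB beta (potential beta h0 h H0 Hh (fseq f H)) (fseq f H) (fseq f H)) x.
Proof.
  rewrite (Piplus_density h h0 H0 Hh f H), (fourier_derive2 f H), <- (fsum_fseq f H x).
  rewrite <- fsum_mul, <- !fsum_cst, <- fsum_add.
  f_equal. unfold opB, potential. set (a := fseq f H).
  replace (Acst ((0, -1) : C)) with (- Acst Ci)%A.
  - rewrite (RtoC_mult 2 beta). ring.
  - rewrite <- Acst_opp. f_equal. unfold Ci, Copp; cbn [fst snd]. f_equal; ring.
Qed.

(** * Time derivative of the coefficients *)

(** A single term of the H^m series controls its coefficient; (1 + |k|)^2 <= 2 (1 + k^2) exchanges
    the two weights at the cost of 2^m. *)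
Lemma Hsnorm_cont (u : R -> R -> C) (H : forall t, periodic (u t) /\ smooth (u t)) (t0 : R) :
  (forall (N : nat) (eps : R), 0 < eps ->
     exists delta, 0 < delta /\ forall t, Rabs (t - t0) < delta ->
       Hsnorm (INR N) (fun x => Cminus (u t x) (u t0 x)) < eps) ->
  Acont (fun t => fseq (u t) (H t)) t0.
Proof.
  intros Hc m eps He. assert (P2 : 1 <= 2 ^ m) by (apply pow_R1_Rle; lra).
  assert (He' : 0 < eps / 2 ^ m) by (apply Rdiv_lt_0_compat; lra).
  destruct (Hc m (eps / 2 ^ m) He') as [d [d0 Hd]]. exists d. split; auto. intros t Ht k.
  specialize (Hd t Ht). set (dd := (fseq (u t) (H t) - fseq (u t0) (H t0))%A).
  assert (Ed : forall k, fcoef (fun x => Cminus (u t x) (u t0 x)) k = dd k).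
  { intros j. assert (c1 := C1_cont _ (smooth_C1 _ (proj2 (H t)))).
    assert (c2 := C1_cont _ (smooth_C1 _ (proj2 (H t0)))).
    rewrite (fcoef_ext _ (fun x => u t x + (-1) * u t0 x)%C); [|intros x; ring].
    assert (c3 : contC (fun x => (-1) * u t0 x)%C) by (apply contC_mult; auto; apply contC_const).
    rewrite fcoef_plus, fcoef_scal by assumption. reflexivity. }
  assert (W : forall j, Rpower (1 + IZR j ^ 2) (INR m) = (1 + IZR j ^ 2) ^ m).
  { intros j. apply Rpower_pow. assert (h := pow2_ge_0 (IZR j)). lra. }
  assert (Ww : forall j, (1 + IZR j ^ 2) ^ m <= wt j ^ m * wt j ^ m).
  { intros j. rewrite <- Rpow_mult_distr. apply pow_incr. unfold wt.
    assert (h := pow2_abs (IZR j)). assert (h1 := Rabs_pos (IZR j)). assert (h2 := pow2_ge_0 (IZR j)). split; nra. }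
  set (F := fun j => (1 + IZR j ^ 2) ^ m * Cmod (dd j) ^ 2).
  assert (EH : Hsnorm (INR m) (fun x => Cminus (u t x) (u t0 x)) = sqrt (ZSeriesR F)).
  { unfold Hsnorm. f_equal. apply ZS_ext. intros j. now rewrite W, Ed. }
  rewrite EH in Hd.
  assert (F0 : forall j, 0 <= F j).
  { intros j. apply Rmult_le_pos; [apply pow_le|apply pow2_ge_0]. assert (h := pow2_ge_0 (IZR j)). lra. }
  (* [Series] takes a default value on divergent series, so a term lies below the sum only once
     summability is known; here it follows from rapid decay. *)
  assert (SF : summable F).
  { destruct (rd_bound (m + 1) dd) as [c [c0 Hcd]]. destruct sum_wt as [w1 _].
    apply summable_le with (fun j => c ^ 2 * / wt j ^ 2); [|now apply summable_scal].
    intros j. rewrite Rabs_pos_eq by auto. assert (w := wt_pow_ge1 2 j).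
    apply Rmult_le_reg_r with (wt j ^ 2); [lra|].
    rewrite (Rmult_assoc (c ^ 2)), Rinv_l, Rmult_1_r by lra.
    apply Rle_trans with ((Cmod (dd j) * wt j ^ (m + 1)) ^ 2).
    - rewrite pow_add, pow_1. unfold F.
      replace ((Cmod (dd j) * (wt j ^ m * wt j)) ^ 2) with ((wt j ^ m * wt j ^ m) * (Cmod (dd j) ^ 2 * wt j ^ 2)) by ring.
      rewrite Rmult_assoc. apply Rmult_le_compat_r; auto.
      apply Rmult_le_pos; [apply pow2_ge_0|lra].
    - apply pow_incr. split; auto. apply Rmult_le_pos; [apply Cmod_ge_0|].
      assert (w' := wt_pow_ge1 (m + 1) j). lra. }
  assert (S0 : 0 <= ZSeriesR F) by now apply ZS_pos.
  assert (Hz : ZSeriesR F <= (eps / 2 ^ m) ^ 2).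
  { rewrite <- (sqrt_sqrt _ S0). assert (h := sqrt_pos (ZSeriesR F)). nra. }
  assert (Hk := Rle_trans _ _ _ (term_le_ZS F k SF F0) Hz). unfold F in Hk.
  assert (Hw2 : wt k ^ m * wt k ^ m <= 2 ^ m * (1 + IZR k ^ 2) ^ m).
  { rewrite <- !Rpow_mult_distr. apply pow_incr. unfold wt.
    assert (h := pow2_abs (IZR k)). assert (h1 := Rabs_pos (IZR k)).
    assert (h2 := pow2_ge_0 (1 - Rabs (IZR k))). split; nra. }
  set (y := Cmod (dd k)) in *. assert (y0 : 0 <= y) by apply Cmod_ge_0.
  assert (w := wt_pow_ge1 m k). set (X := wt k ^ m) in *.
  apply Rsqr_incr_0; [|apply Rmult_le_pos; lra|lra]. unfold Rsqr.
  apply Rle_trans with (2 ^ m * (eps / 2 ^ m) ^ 2).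
  - apply Rle_trans with (2 ^ m * ((1 + IZR k ^ 2) ^ m * y ^ 2)).
    + replace (y * X * (y * X)) with ((X * X) * y ^ 2) by ring. rewrite <- Rmult_assoc.
      apply Rmult_le_compat_r; auto. apply pow2_ge_0.
    + apply Rmult_le_compat_l; lra.
  - replace (2 ^ m * (eps / 2 ^ m) ^ 2) with (eps * eps * / 2 ^ m) by (field; lra).
    rewrite <- (Rmult_1_r (eps * eps)) at 2. apply Rmult_le_compat_l; [nra|].
    rewrite <- Rinv_1. apply Rinv_le_contravar; lra.
Qed.

(** Differentiating the coefficient integrals under the integral sign asks for joint continuity of
    the time derivative. *)
Lemma fsum_cont_2d (c : R -> rdseq) (t x : R) : Acont c t ->
  continuity_2d_pt (fun u v => fst (fsum (c u) v)) t x /\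
  continuity_2d_pt (fun u v => snd (fsum (c u) v)) t x.
Proof.
  intros Hc.
  assert (H : forall eps : posreal, exists d : posreal, forall u v, Rabs (u - t) < d -> Rabs (v - x) < d ->
    Cmod (fsum (c u) v - fsum (c t) x)%C < eps).
  { intros eps. assert (e0 := cond_pos eps).
    destruct (Hc 2%nat (eps / 12)) as [d1 [p1 H1]]; [lra|].
    set (L := l1 (AD (c t))). assert (L0 : 0 <= L) by apply l1_pos.
    set (d2 := eps / (4 * (L + 1))). assert (p2 : 0 < d2) by (apply Rdiv_lt_0_compat; lra).
    exists (mkposreal (Rmin d1 d2) (Rmin_glb_lt _ _ _ p1 p2)). simpl. intros u v Hu Hv.
    assert (h1 := Rmin_l d1 d2). assert (h2 := Rmin_r d1 d2).
    apply Rle_lt_trans with (1 := fsum_diff (c u) (c t) v x). fold L.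
    destruct (small2_sum _ _ (H1 u ltac:(lra))) as [_ s]. fold (l1 (c u - c t)) in s.
    assert (B : 2 * L * Rabs (v - x) <= eps / 2).
    { apply Rle_trans with (2 * (L + 1) * d2).
      - apply Rmult_le_compat; try lra. apply Rabs_pos.
      - right. unfold d2. field. lra. }
    lra. }
  split; intros eps; destruct (H eps) as [d Hd]; exists d; intros u v Hu Hv;
    apply Rle_lt_trans with (2 := Hd u v Hu Hv).
  - exact (fst_le_Cmod (fsum (c u) v - fsum (c t) x)%C).
  - exact (snd_le_Cmod (fsum (c u) v - fsum (c t) x)%C).
Qed.

Lemma continuity_2d_trig (g : R -> R) (k t x : R) : (forall y, continuity_pt g y) ->
  continuity_2d_pt (fun _ v => g (k * v)) t x.
Proof.
  intros Hg. apply (continuity_1d_2d_pt_comp g (fun _ v => k * v)); auto.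
  apply continuity_2d_pt_mult; [apply continuity_2d_pt_const|apply continuity_2d_pt_id2].
Qed.

Lemma is_derive_RInt_time (G dG : R -> R -> R) (t : R) :
  (forall s x, is_derive (fun s => G s x) s (dG s x)) ->
  (forall x, continuity_2d_pt dG t x) -> (forall s x, continuous (G s) x) ->
  is_derive (fun s => RInt (G s) 0 (2 * PI)) t (RInt (dG t) 0 (2 * PI)).
Proof.
  intros HD HC HG.
  rewrite (RInt_ext (dG t) (fun x => Derive (fun s => G s x) t)).
  - apply (is_derive_RInt_param G 0 (2 * PI) t).
    + exists (mkposreal 1 Rlt_0_1). intros s _ x _. eexists. apply HD.
    + intros x _. apply continuity_2d_pt_ext with (2 := HC x).
      intros s y. symmetry. exact (is_derive_unique _ _ _ (HD s y)).
    + exists (mkposreal 1 Rlt_0_1). intros s _. now apply ex_RInt_cont.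
  - intros x _. symmetry. exact (is_derive_unique _ _ _ (HD t x)).
Qed.

Lemma fcoef_time_derive (u : R -> R -> C) (c : R -> rdseq) (k : Z) (t : R) :
  (forall s, contC (u s)) -> Acont c t ->
  (forall s x, ex_CDerive (fun tau => u tau x) s /\ CDerive (fun tau => u tau x) s = fsum (c s) x) ->
  is_derive (fun s => fst (fcoef (u s) k)) t (fst (c t k)) /\
  is_derive (fun s => snd (fcoef (u s) k)) t (snd (c t k)).
Proof.
  intros Hu Hc Hd. rewrite <- (fcoef_fsum (c t) k).
  assert (D1 : forall s x, is_derive (fun tau => fst (u tau x)) s (fst (fsum (c s) x))).
  { intros s x. destruct (Hd s x) as [[h1 _] h2]. rewrite <- h2. now apply Derive_correct. }
  assert (D2 : forall s x, is_derive (fun tau => snd (u tau x)) s (snd (fsum (c s) x))).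
  { intros s x. destruct (Hd s x) as [[_ h1] h2]. rewrite <- h2. now apply Derive_correct. }
  assert (Cc : forall x, continuous (fun x => cos (IZR k * x)) x).
  { intros x. apply (ex_derive_continuous (fun y => cos (IZR k * y)) x). auto_derive. auto. }
  assert (Cs : forall x, continuous (fun x => sin (IZR k * x)) x).
  { intros x. apply (ex_derive_continuous (fun y => sin (IZR k * y)) x). auto_derive. auto. }
  assert (T1 : forall x, continuity_2d_pt (fun _ v => cos (IZR k * v)) t x)
    by (intros x; apply continuity_2d_trig; intros y; apply continuity_cos).
  assert (T2 : forall x, continuity_2d_pt (fun _ v => sin (IZR k * v)) t x)
    by (intros x; apply continuity_2d_trig; intros y; apply continuity_sin).
  assert (Sc : forall (f : R -> R) (l r : R), is_derive f t l -> is_derive (fun s => r * f s) t (r * l)).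
  { intros f l r Hf. exact (is_derive_scal f t r l Hf). }
  assert (Dm : forall (f : R -> R) (l r s : R), is_derive f s l -> is_derive (fun s => f s * r) s (l * r)).
  { intros f l r s Hf. apply is_derive_ext with (fun s => r * f s); [intros; real_eq; ring|].
    replace (l * r) with (r * l) by ring. exact (is_derive_scal f s r l Hf). }
  unfold fcoef; cbn [fst snd]. split; apply Sc.
  - apply (is_derive_RInt_time
      (fun s x => fst (u s x) * cos (IZR k * x) + snd (u s x) * sin (IZR k * x))
      (fun s x => fst (fsum (c s) x) * cos (IZR k * x) + snd (fsum (c s) x) * sin (IZR k * x))).
    + intros s x. exact (is_derive_plus _ _ s _ _ (Dm _ _ _ s (D1 s x)) (Dm _ _ _ s (D2 s x))).
    + intros x. destruct (fsum_cont_2d c t x Hc) as [k1 k2].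
      apply continuity_2d_pt_plus; apply continuity_2d_pt_mult; auto.
    + intros s x. destruct (Hu s) as [k1 k2].
      apply continuous_Rplus; apply continuous_Rmult; auto.
  - apply (is_derive_RInt_time
      (fun s x => snd (u s x) * cos (IZR k * x) - fst (u s x) * sin (IZR k * x))
      (fun s x => snd (fsum (c s) x) * cos (IZR k * x) - fst (fsum (c s) x) * sin (IZR k * x))).
    + intros s x. exact (is_derive_minus _ _ s _ _ (Dm _ _ _ s (D2 s x)) (Dm _ _ _ s (D1 s x))).
    + intros x. destruct (fsum_cont_2d c t x Hc) as [k1 k2].
      apply continuity_2d_pt_minus; apply continuity_2d_pt_mult; auto.
    + intros s x. destruct (Hu s) as [k1 k2].
      apply continuous_Rminus; apply continuous_Rmult; auto.
Qed.

Lemma derive_increment (g g' : R -> R) (t e d tau : R) :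
  (forall s, is_derive g s (g' s)) -> (forall s, Rabs (s - t) < d -> Rabs (g' s - g' t) <= e) ->
  Rabs (tau - t) < d -> Rabs (g tau - g t - (tau - t) * g' t) <= e * Rabs (tau - t).
Proof.
  intros Hg He Ht.
  destruct (MVT_gen g t tau g') as [x [Hx E]].
  - intros x _. apply Hg.
  - intros x _. apply continuity_pt_filterlim. apply (ex_derive_continuous g x). eexists. apply Hg.
  - rewrite E. replace (g' x * (tau - t) - (tau - t) * g' t) with ((g' x - g' t) * (tau - t)) by ring.
    rewrite Rabs_mult. apply Rmult_le_compat_r; [apply Rabs_pos|]. apply He.
    apply Rle_lt_trans with (2 := Ht). revert Hx. unfold Rmin, Rmax.
    destruct (Rle_dec t tau); intros [h1 h2].
    + rewrite !Rabs_pos_eq; lra.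
    + rewrite <- Rabs_Ropp, <- (Rabs_Ropp (tau - t)), !Rabs_pos_eq; lra.
Qed.

(** The mean value inequality on each coefficient is uniform in [k], because the variation of its
    derivative is controlled by the continuity of [c] in the weighted norm. *)
Lemma Aderiv_coefficients (a c : R -> rdseq) (t : R) : Acont c t ->
  (forall k s, is_derive (fun s => fst (a s k)) s (fst (c s k)) /\
               is_derive (fun s => snd (a s k)) s (snd (c s k))) -> Aderiv a t (c t).
Proof.
  intros Hc Hd m eps He. destruct (Hc m (eps / 2)) as [d [d0 H]]; [lra|].
  exists d. split; auto. intros tau Ht k.
  assert (w := wt_pow_ge1 m k). set (e := eps / 2 * / wt k ^ m).
  assert (Hs : forall s, Rabs (s - t) < d -> Cmod (c s k - c t k)%C <= e).
  { intros s Hs. assert (h := small_div _ _ _ k (H s Hs)). now rewrite Asub_co in h. }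
  assert (I1 := derive_increment (fun s => fst (a s k)) (fun s => fst (c s k)) t e d tau
    (fun s => proj1 (Hd k s))
    (fun s hs => Rle_trans _ _ _ (fst_le_Cmod (c s k - c t k)%C) (Hs s hs)) Ht).
  assert (I2 := derive_increment (fun s => snd (a s k)) (fun s => snd (c s k)) t e d tau
    (fun s => proj2 (Hd k s))
    (fun s hs => Rle_trans _ _ _ (snd_le_Cmod (c s k - c t k)%C) (Hs s hs)) Ht).
  rewrite !Asub_co, Amul_cst.
  set (z := (a tau k - a t k - RtoC (tau - t)%R * c t k)%C).
  assert (Hz : Cmod z <= 2 * e * Rabs (tau - t)).
  { apply Rle_trans with (1 := Cmod_le_parts z).
    replace (fst z) with (fst (a tau k) - fst (a t k) - (tau - t) * fst (c t k))
      by (unfold z, Cminus, Cplus, Copp, Cmult, RtoC; cbn [fst snd]; ring).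
    replace (snd z) with (snd (a tau k) - snd (a t k) - (tau - t) * snd (c t k))
      by (unfold z, Cminus, Cplus, Copp, Cmult, RtoC; cbn [fst snd]; ring).
    lra. }
  apply Rle_trans with (2 * e * Rabs (tau - t) * wt k ^ m).
  - apply Rmult_le_compat_r; lra.
  - right. unfold e. field. assert (p := wt_pos k). lra.
Qed.

(** The equation only gives pointwise time derivatives; the right-hand side is continuous in every
    seminorm because [u] is, and this upgrades them to [Aderiv]. *)
Lemma solution_flow (h : Rbar) (beta h0 : R) (H0 : 0 < h0) (Hh : Rbar_le h0 h) (u : R -> R -> C)
  (H : forall t, periodic (u t) /\ smooth (u t)) :
  C_Hinf u -> solves_INLS h beta u -> forall t,
  Aderiv (fun s => fseq (u s) (H s)) t
    (opB beta (potential beta h0 h H0 Hh (fseq (u t) (H t))) (fseq (u t) (H t)) (fseq (u t) (H t))).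
Proof.
  intros [_ Hc] Hs t. set (a := fun s => fseq (u s) (H s)).
  assert (Ca : forall s, Acont a s)
    by (intros s; exact (Hsnorm_cont u H s (fun N eps => Hc N s eps))).
  assert (Cc : forall s, Acont (fun s => opB beta (potential beta h0 h H0 Hh (a s)) (a s) (a s)) s)
    by (intros s; exact (Acont_opB beta h0 h H0 Hh a s (Ca s))).
  apply (Aderiv_coefficients a (fun s => opB beta (potential beta h0 h H0 Hh (a s)) (a s) (a s)));
    [exact (Cc t)|]. intros k s.
  apply (fcoef_time_derive u (fun s => opB beta (potential beta h0 h H0 Hh (a s)) (a s) (a s)) k s);
    [|exact (Cc s)|].
  - intros s'. exact (C1_cont _ (smooth_C1 _ (proj2 (H s')))).
  - intros s' x. destruct (Hs s' x) as [h1 h2]. split; [exact h1|].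
    rewrite h2. exact (rhs_series h beta h0 H0 Hh (u s') (H s') x).
Qed.

(** Only a positive lower bound on [h] enters, through [E]; a fixed [h] and the uniform range are
    both instances. *)
Lemma uniform_bound (s beta h0 : R) : 1 / 2 <= s < 1 -> 0 < h0 ->
  exists r, 0 < r /\ forall A T, 0 < A -> 0 < T -> exists B, 0 < B /\
    forall h : Rbar, Rbar_le h0 h -> forall u : R -> R -> C,
      C_Hinf u -> solves_INLS h beta u ->
      L2norm (u 0) <= r -> Hsnorm s (u 0) <= A ->
      forall t, Rabs t <= T -> Hsnorm s (u t) <= B.
Proof.
  intros Hs H0. assert (P := PI_RGT_0). assert (P1 := PI2_1).
  set (E := 6 * Rabs beta * (64 / h0 ^ 4)).
  assert (E0 : 0 <= E).
  { apply Rmult_le_pos; [assert (b0 := Rabs_pos beta); lra|].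
    apply Rdiv_le_0_compat; [lra|now apply pow_lt]. }
  destruct (seq_bound s beta E Hs E0) as [r [[r0 r1] Hr]].
  exists r. split; auto. intros A T HA HT.
  (* [seq_bound] covers an open time interval, so a longer one is used to reach |t| = T. *)
  destruct (Hr A (T + 1) HA ltac:(lra)) as [B [HB HBu]].
  exists (sqrt B). split; [now apply sqrt_lt_R0|].
  intros h Hh u Hu Hsol HL2 HHs t Ht.
  set (H := proj1 Hu). set (a := fun t => fseq (u t) (H t)).
  change (sqrt (Hsq s (a t)) <= sqrt B). apply sqrt_le_1_alt.
  apply (HBu (fun t => potential beta h0 h H0 Hh (a t)) a).
  - intros t'. apply potential_real.
  - intros t'. exact (solution_flow h beta h0 H0 Hh u H Hu Hsol t').
  - intros t'. apply potential_bound.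
  - assert (c0 := C1_cont _ (smooth_C1 _ (proj2 (H 0)))).
    (* [L2norm] is not normalised by 2 pi; since 2 pi >= 1, the Bessel inequality is enough to bound
       the sum of squares by r^2. *)
    destruct (bessel (u 0) c0) as [_ b].
    change (norm2 (a 0) <= / (2 * PI) * sqint (u 0)) in b.
    assert (S0 := sqint_pos (u 0) c0).
    assert (S1 : sqint (u 0) <= r ^ 2).
    { change (sqrt (sqint (u 0)) <= r) in HL2. rewrite <- (sqrt_sqrt _ S0).
      assert (q := sqrt_pos (sqint (u 0))). nra. }
    apply Rle_trans with (1 := b). apply Rle_trans with (1 * sqint (u 0)); [|lra].
    apply Rmult_le_compat_r; auto. rewrite <- Rinv_1. apply Rinv_le_contravar; lra.
  - change (sqrt (Hsq s (a 0)) <= A) in HHs.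
    assert (S0 : 0 <= Hsq s (a 0)).
    { apply Hsq_pos. lra. }
    rewrite <- (sqrt_sqrt _ S0). assert (q := sqrt_pos (Hsq s (a 0))). nra.
  - lra.
Qed.

Theorem theorem8p4 (s : R) (beta : R) :
  1 / 2 <= s < 1 ->
  (* existence of r, B for each fixed h in (0, oo] *)
  (forall h : Rbar, Rbar_lt 0 h ->
     exists r, 0 < r /\
       forall A T, 0 < A -> 0 < T ->
         exists B, 0 < B /\
           forall u : R -> R -> C,
             C_Hinf u -> solves_INLS h beta u ->
             L2norm (u 0) <= r -> Hsnorm s (u 0) <= A ->
             forall t, Rabs t <= T -> Hsnorm s (u t) <= B) /\
  (* uniformity: r and B can be chosen independently of h in [1, oo] *)
  (exists r, 0 < r /\
     forall A T, 0 < A -> 0 < T ->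
       exists B, 0 < B /\
         forall h : Rbar, Rbar_le 1 h ->
           forall u : R -> R -> C,
             C_Hinf u -> solves_INLS h beta u ->
             L2norm (u 0) <= r -> Hsnorm s (u 0) <= A ->
             forall t, Rabs t <= T -> Hsnorm s (u t) <= B).
Proof.
  intros Hs. split.
  - intros h Hh.
    assert (Hex : exists h0 : R, 0 < h0 /\ Rbar_le h0 h).
    { destruct h as [h| |].
      - exists h. split; [exact Hh|simpl; lra].
      - exists 1. split; [lra|exact I].
      - destruct Hh. }
    destruct Hex as [h0 [H0 Hh0]].
    destruct (uniform_bound s beta h0 Hs H0) as [r [r0 Hr]].
    exists r. split; [exact r0|]. intros A T HA HT.
    destruct (Hr A T HA HT) as [B [HB HBu]]. exists B. split; [exact HB|exact (HBu h Hh0)].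
  - exact (uniform_bound s beta 1 Hs Rlt_0_1).
Qed.
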